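(* Let $n\ge1$. (i) For any nonnegative integer $c$ and any partition $\lambda$ with at most $n$ parts, $$\operatorname{sp}_{2n}\big((c^n);\mathbf x^{\pm1}\big)\cdot\operatorname{sp}_{2n}\big(\lambda;\mathbf x^{\pm1}\big)=\sum_{\nu\subseteq\lambda+(c^n)}\operatorname{sp}_{2n}(\nu;\mathbf x^{\pm1})\sum_{\mu\subseteq((2c)^n),\ \mu\text{ even}}\overline{\mathrm{LR}}_{\lambda,\mu}^{\nu+(c^n)}(c),$$ where $\nu$ ranges over partitions, ''$\mu$ even'' means that all rows of $\mu$ have even length, and $\overline{\mathrm{LR}}_{\lambda,\mu}^{\nu+(c^n)}(c)$ is the number of LR-fillings $F$ of shape $(\nu+(c^n))/\lambda$ with content $\mu$ and with the additional property: $( * )$ if there is an entry $e$ in the $n$-th row of $F$, in column $j$ say, then $F$ must contain at least $2c-2j+1$ other entries $e$ to the right of column $j$. (ii) For any nonnegative integer or half-integer $c$ and any partition or half-partition $\lambda$ with at most $n$ parts, $$\operatorname{so}_{2n+1}\big((c^n);\mathbf x^{\pm1}\big)\cdot\operatorname{so}_{2n+1}\big(\lambda;\mathbf x^{\pm1}\big)=\sum_{\nu\subseteq\lambda+(c^n)}\operatorname{so}_{2n+1}(\nu;\mathbf x^{\pm1})\sum_{\mu\subseteq((2c)^n)}\overline{\mathrm{LR}}_{\lambda,\mu}^{\nu+(c^n)}(c),$$ where $\nu$ ranges over partitions if $\lambda+(c^n)$ is a partition and over half-partitions if $\lambda+(c^n)$ is a half-partition, and $\overline{\mathrm{LR}}_{\lambda,\mu}^{\nu+(c^n)}(c)$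 is defined as in (i), by property $( * )$ (the column index $j$ ranging over integers if $\lambda$ is a partition and over half-integers if $\lambda$ is a half-partition). (iii) Let $n\ge2$. For any nonnegative integer or half-integer $c$ and any $n$-orthogonal partition or half-partition $\lambda$, $$\operatorname{so}_{2n}\big((c^n);\mathbf x^{\pm1}\big)\cdot\operatorname{so}_{2n}\big(\lambda;\mathbf x^{\pm1}\big)=\sum_{\nu\subseteq\lambda+(c^n)}\operatorname{so}_{2n}(\nu;\mathbf x^{\pm1})\Bigg(\sum_{\mu\subseteq((2c)^n),\ \operatorname{oddcols}(((2c)^n)/\mu)=0}\widetilde{\mathrm{LR}}_{\lambda,\mu}^{\nu+(c^n)}(c)\Bigg),$$ where $\nu$ ranges over $n$-orthogonal partitions if $\lambda+(c^n)$ is an $n$-orthogonal partition and over $n$-orthogonal half-partitions if $\lambda+(c^n)$ is an $n$-orthogonal half-partition, and $\widetilde{\mathrm{LR}}_{\lambda,\mu}^{\nu+(c^n)}(c)$ is the number of LR-fillings $F$ of shape $(\nu+(c^n))/\lambda$ with content $\mu$ and with the additional property that for $\ell=1,2,\dots,2c$: if the subfilling that arises from $F$ by deleting the rightmost $2c-\ell$ entries $1$, the rightmost $2c-\ell$ entries $2$, ..., the rightmost $2c-\ell$ entries $n$ (if there are fewer than $2c-\ell$ entries of some size, all of these are deleted) has shape $\nu(\ell)/\lambda$, then $\nu(\ell)_{n-1}+\nu(\ell)_n\ge\ell$.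
   Context: A partition is a weakly decreasing finite sequence of nonnegative integers; a half-integer is a number $k+1/2$, $k$ an integer; a half-partition is a weakly decreasing sequence of nonnegative half-integers. An $n$-orthogonal partition (half-partition) is a sequence $\lambda_1\ge\dots\ge\lambda_{n-1}\ge|\lambda_n|$ of integers (half-integers). All indexing sequences $\lambda,\nu$ are regarded as having exactly $n$ entries; $+$ is componentwise addition; $(c^n)$ is the sequence of $n$ entries $c$; $\mu\subseteq\lambda$ means $\mu_i\le\lambda_i$ for all $i$. The inner sums run over ordinary partitions $\mu$. $\operatorname{oddcols}(\sigma)$ is the number of columns of odd length of a skew diagram $\sigma$. For $\lambda\subseteq\rho$ with all $\rho_i-\lambda_i$ integers, the skew diagram $\rho/\lambda$ has $\rho_i-\lambda_i$ cells in row $i$, located in columns numbered $\lambda_i+1,\lambda_i+2,\dots,\rho_i$ (column numbers may be negative or half-integers). An LR-filling (Littlewood–Richardson filling) of shape $\rho/\lambda$ and content $\mu$ is a filling of the cells of $\rho/\lambda$ with positive integers, weakly increasing along rows (left to right) and strictly increasing down columns, containing exactly $\mu_i$ entries $i$ for each $i$, such that, reading the entries row-wise from top to bottom and in each row from right to left, at any stage the number of $1$'s read is $\ge$ the number of $2$'s, which is $\ge$ the number of $3$'s, etc. (If $\lambda\not\subseteq\rho$ there are none.) For a partition $\lambda=(\lambda_1,\dots,\lambda_n)$, $$\operatorname{sp}_{2n}(\lambda;\mathbf x^{\pm1})=\frac{\det_{1\le i,j\le n}\big(x_j^{\lambda_i+n-i+1}-x_j^{-(\lambda_i+n-i+1)}\big)}{\det_{1\le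 i,j\le n}\big(x_j^{n-i+1}-x_j^{-(n-i+1)}\big)}.$$ For a partition or half-partition $\lambda=(\lambda_1,\dots,\lambda_n)$, $$\operatorname{so}_{2n+1}(\lambda;\mathbf x^{\pm1})=\frac{\det_{1\le i,j\le n}\big(x_j^{\lambda_i+n-i+1/2}-x_j^{-(\lambda_i+n-i+1/2)}\big)}{\det_{1\le i,j\le n}\big(x_j^{n-i+1/2}-x_j^{-(n-i+1/2)}\big)}.$$ For an $n$-orthogonal partition or half-partition $\lambda$, $$\operatorname{so}_{2n}(\lambda;\mathbf x^{\pm1})=\frac{\det_{1\le i,j\le n}\big(x_j^{\lambda_i+n-i}+x_j^{-(\lambda_i+n-i)}\big)+\det_{1\le i,j\le n}\big(x_j^{\lambda_i+n-i}-x_j^{-(\lambda_i+n-i)}\big)}{\det_{1\le i,j\le n}\big(x_j^{n-i}+x_j^{-(n-i)}\big)}.$$ *)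

(* Defs.v *)
From mathcomp Require Import all_boot all_order all_algebra.
From mathcomp Require Import mpoly.
From mathcomp Require Import boolp classical_sets cardinality fsbigop.

Set Implicit Arguments.
Unset Strict Implicit.
Unset Printing Implicit Defensive.

Import Order.TTheory GRing.Theory Num.Theory.
Local Open Scope ring_scope.

(** * Indexing sequences *)

(* Positions are 0-based throughout: the entry usually written la_i, with
   1 <= i <= n, is [la (i - 1)]. *)
Definition indexseq (n : nat) := {ffun 'I_n -> rat}.

Definition half_integer (x : rat) : bool := x - 1 / 2 \is a Num.int.

Definition rect (n : nat) (c : rat) : indexseq n := [ffun=> c].

Definition contained (n : nat) (mu la : indexseq n) : bool :=
  [forall i, mu i <= la i].

Definition weakly_decreasing (n : nat) (la : indexseq n) : bool :=
  [forall i : 'I_n, forall j : 'I_n, (i < j)%N ==> (la j <= la i)].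

Definition is_partition (n : nat) (la : indexseq n) : bool :=
  [&& weakly_decreasing la, [forall i, 0 <= la i]
    & [forall i, la i \is a Num.int]].

Definition is_half_partition (n : nat) (la : indexseq n) : bool :=
  [&& weakly_decreasing la, [forall i, 0 <= la i]
    & [forall i, half_integer (la i)]].

Definition orthogonal_shape (n : nat) (la : indexseq n) : bool :=
  weakly_decreasing la &&
  [forall i : 'I_n, forall j : 'I_n,
    (i.+2 == n) && (j.+1 == n) ==> (`|la j| <= la i)].

Definition is_orth_partition (n : nat) (la : indexseq n) : bool :=
  orthogonal_shape la && [forall i, la i \is a Num.int].

Definition is_orth_half_partition (n : nat) (la : indexseq n) : bool :=
  orthogonal_shape la && [forall i, half_integer (la i)].

Definition even_rows (n : nat) (mu : indexseq n) : bool :=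
  [forall i, mu i / 2 \is a Num.int].

(** * Characters *)

(* The characters are Laurent polynomials in x_1^(1/2), ..., x_n^(1/2).  They
   are taken in the field of rational functions in n independent variables, the
   variables standing for the square roots x_j^(1/2). *)
Definition charField (n : nat) : fieldType := {fraction {mpoly rat[n]}}.

(* x_j^a, for an integer or half-integer a. *)
Definition xpow (n : nat) (j : 'I_n) (a : rat) : charField n :=
  (tofrac ('X_j : {mpoly rat[n]}) : charField n) ^ Num.floor (2 * a).

Definition alt_minus (n : nat) (a : 'I_n -> rat) : charField n :=
  \det (\matrix_(i < n, j < n) (xpow j (a i) - xpow j (- a i))).

Definition alt_plus (n : nat) (a : 'I_n -> rat) : charField n :=
  \det (\matrix_(i < n, j < n) (xpow j (a i) + xpow j (- a i))).

(* In the exponents, i.+1 is the 1-based row index. *)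
Definition sp_char (n : nat) (la : indexseq n) : charField n :=
  alt_minus (fun i : 'I_n => la i + n%:R - i.+1%:R + 1)
  / alt_minus (fun i : 'I_n => n%:R - i.+1%:R + 1).

Definition so_odd_char (n : nat) (la : indexseq n) : charField n :=
  alt_minus (fun i : 'I_n => la i + n%:R - i.+1%:R + 1 / 2)
  / alt_minus (fun i : 'I_n => n%:R - i.+1%:R + 1 / 2).

Definition so_even_char (n : nat) (la : indexseq n) : charField n :=
  (alt_plus (fun i : 'I_n => la i + n%:R - i.+1%:R)
   + alt_minus (fun i : 'I_n => la i + n%:R - i.+1%:R))
  / alt_plus (fun i : 'I_n => n%:R - i.+1%:R).

(** * Skew diagrams and Littlewood-Richardson fillings *)

(* The cells of rho/la, meaningful if la is contained in rho with integral
   differences: the k-th cell (from k = 0) of row i lies in column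
   la i + k + 1. *)
Definition cell (n : nat) (la rho : indexseq n) : finType :=
  {i : 'I_n & 'I_(Num.truncn (rho i - la i))}.

Definition row_of (n : nat) (la rho : indexseq n) (x : cell la rho) : 'I_n :=
  tag x.

Definition col_of (n : nat) (la rho : indexseq n) (x : cell la rho) : rat :=
  la (tag x) + (tagged x).+1%:R.

Definition oddcols (n : nat) (la rho : indexseq n) : nat :=
  count (fun j => odd #|[set x : cell la rho | col_of x == j]%SET|)
        (undup [seq col_of x | x : cell la rho]).

(* The value e : 'I_n stands for the entry e + 1.  Entries larger than n need
   not be considered, as contents have only n components. *)
Definition filling (n : nat) (la rho : indexseq n) : finType :=
  {ffun cell la rho -> 'I_n}.

Section Fillings.
Variables (n : nat) (la rho : indexseq n).
Implicit Types (F : filling la rho) (mu : indexseq n) (c : rat).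

Definition semistandard F : bool :=
  [forall x, forall y, (row_of x == row_of y) && (col_of x < col_of y)
                         ==> (F x <= F y)%N]
  && [forall x, forall y, (row_of x < row_of y)%N && (col_of x == col_of y)
                            ==> (F x < F y)%N].

Definition has_content mu F : bool :=
  [forall e : 'I_n, #|[set x | F x == e]%SET|%:R == mu e].

(* Rows from top to bottom, each row from right to left. *)
Definition reading_word F : seq 'I_n :=
  flatten [seq rev [seq F (Tagged (fun i => 'I_(Num.truncn (rho i - la i))) k)
                   | k : 'I_(Num.truncn (rho i - la i))]
          | i : 'I_n].

Definition lattice_word (w : seq 'I_n) : bool :=
  [forall p : 'I_(size w).+1, forall e : 'I_n, forall e' : 'I_n,
    (e < e')%N ==> (count_mem e' (take p w) <= count_mem e (take p w))%N].

Definition LR_filling mu F : bool :=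
  [&& contained la rho, semistandard F, has_content mu F
    & lattice_word (reading_word F)].

(* The number of entries equal to F x strictly to the right of the column
   of x. *)
Definition copies_to_right F (x : cell la rho) : nat :=
  #|[set y | (F y == F x) && (col_of x < col_of y)]%SET|.

Definition last_row_property c F : bool :=
  [forall x, ((row_of x).+1 == n) ==>
    (2 * c - 2 * col_of x + 1 <= (copies_to_right F x)%:R)].

(* What is left when, for each e, the rightmost m entries e are deleted (all
   of them if there are fewer).  Equal entries of a semistandard filling lie in
   distinct columns, so that x goes iff fewer than m copies of its entry are to
   its right. *)
Definition remaining (m : nat) F : {set cell la rho} :=
  [set x | (m <= copies_to_right F x)%N]%SET.

(* The outer shape nu(l) of the remaining cells: for an LR filling these are
   left-justified in each row. *)
Definition remaining_shape (m : nat) F : indexseq n :=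
  [ffun i => la i + #|[set x in remaining m F | row_of x == i]%SET|%:R].

Definition orth_property c F : bool :=
  let d := Num.truncn (2 * c) in
  [forall l : 'I_d.+1, (0 < l)%N ==>
    [forall i : 'I_n, forall j : 'I_n, (i.+2 == n) && (j.+1 == n) ==>
      (l%:R <= remaining_shape (d - l) F i + remaining_shape (d - l) F j)]].

End Fillings.

Definition LR_bar (n : nat) (la mu rho : indexseq n) (c : rat) : nat :=
  #|[set F : filling la rho | LR_filling mu F && last_row_property c F]%SET|.

Definition LR_tilde (n : nat) (la mu rho : indexseq n) (c : rat) : nat :=
  #|[set F : filling la rho | LR_filling mu F && orth_property c F]%SET|.

(** * Ranges of summation *)

Local Open Scope classical_set_scope.

Definition partitions_in (n : nat) (rho : indexseq n) : set (indexseq n) :=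
  [set nu | is_partition nu /\ contained nu rho].

(* The same kind: integral if rho is integral, half-integral if rho is. *)
Definition same_kind_partitions_in (n : nat) (rho : indexseq n) :
    set (indexseq n) :=
  [set nu | (is_partition rho /\ is_partition nu
             \/ is_half_partition rho /\ is_half_partition nu)
            /\ contained nu rho].

Definition same_kind_orth_partitions_in (n : nat) (rho : indexseq n) :
    set (indexseq n) :=
  [set nu | (is_orth_partition rho /\ is_orth_partition nu
             \/ is_orth_half_partition rho /\ is_orth_half_partition nu)
            /\ contained nu rho].

(* Sums [\sum_(i \in A) _] are 0 by convention when the support is infinite; the
   lemmas below show that this never happens for the sums considered. *)
Lemma finite_bounded_halfint (n B : nat) (A : set (indexseq n)) :
    (forall nu, A nu -> forall i, `|nu i| <= B%:R /\ 2 * nu i \is a Num.int) ->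
  finite_set A.
Proof.
move=> hA.
pose f (g : {ffun 'I_n -> 'I_(4 * B).+1}) : indexseq n :=
  [ffun i => (g i)%:R / 2 - B%:R].
apply: (@sub_finite_set _ _ (f @` setT)); last first.
  by apply: finite_image; exact: finite_finset.
move=> nu /hA hnu.
exists [ffun i => inord (Num.truncn (2 * (nu i + B%:R)))] => //.
apply/ffunP => i; rewrite !ffunE.
have [hB hI] := hnu i; move: hB; rewrite ler_norml => /andP[h1 h2].
have h0 : 0 <= nu i + B%:R by rewrite -lerBlDr sub0r.
have hN : 2 * (nu i + B%:R) \is a Num.nat.
  by rewrite natrEint mulr_ge0 // andbT mulrDr rpredD // rpredM ?intr_nat.
have hle : (Num.truncn (2 * (nu i + B%:R)) <= 4 * B)%N.
  rewrite -(ler_nat rat) truncnK // natrM.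
  rewrite (_ : 4%:R = 2 * 2 :> rat) // -mulrA ler_pM2l //.
  by rewrite mulrDl !mul1r lerD2r.
rewrite inordK // truncnK // mulrAC mulfV ?mul1r ?addrK //.
Qed.

Lemma contained_bound (n : nat) (la : indexseq n) :
  exists B : nat, forall nu : indexseq n, contained nu la ->
    forall i, nu i <= B%:R.
Proof.
exists (\sum_(i < n) Num.bound (la i))%N => nu /forallP hnu i.
apply: le_trans (hnu i) _; apply: le_trans (ler_norm _) _.
apply: le_trans (ltW (archi_boundP (normr_ge0 _))) _.
by rewrite ler_nat (bigD1 i) //= /Num.bound normr_id leq_addr.
Qed.

Lemma int_double (x : rat) :
  x \is a Num.int \/ half_integer x -> 2 * x \is a Num.int.
Proof.
case=> [hx|hx]; first by rewrite rpredM.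
have -> : 2 * x = 2 * (x - 1 / 2) + 1.
  by rewrite mulrBr mul1r mulfV // subrK.
by rewrite rpredD // rpredM.
Qed.

Lemma finite_same_kind_partitions_in (n : nat) (rho : indexseq n) :
  finite_set (same_kind_partitions_in rho).
Proof.
have [B hB] := contained_bound rho.
apply: (@finite_bounded_halfint n B) => nu [hk /hB hc] i.
have [h0 hi] : 0 <= nu i /\ (nu i \is a Num.int \/ half_integer (nu i)).
  case: hk => -[_ /and3P[_ /forallP h0 /forallP hi]]; split=> //.
  - by left.
  - by right.
by rewrite ger0_norm //; split=> //; exact: int_double.
Qed.

Lemma finite_partitions_in (n : nat) (rho : indexseq n) :
  finite_set (partitions_in rho).
Proof.
have [B hB] := contained_bound rho.
apply: (@finite_bounded_halfint n B) => nu [/and3P[_ /forallP h0 /forallP hi]].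
move=> /hB hc i; rewrite ger0_norm ?h0 //; split=> //.
by apply: int_double; left.
Qed.

Lemma finite_same_kind_orth_partitions_in (n : nat) (rho : indexseq n) :
  (1 < n)%N -> finite_set (same_kind_orth_partitions_in rho).
Proof.
case: n rho => [|[|n]] // rho _.
have [B hB] := contained_bound rho.
apply: (@finite_bounded_halfint n.+2 B) => nu [hk /hB hc] i.
have [ho hi] : orthogonal_shape nu
               /\ (nu i \is a Num.int \/ half_integer (nu i)).
  case: hk => -[_ /andP[ho /forallP hi]]; split=> //.
  - by left.
  - by right.
split; last exact: int_double.
case/andP: ho => /forallP hd /forallP hl.
have hlast : `|nu ord_max| <= nu (inord n).
  by have /forallP/(_ ord_max)/implyP := hl (inord n); apply;
     rewrite inordK //= !eqxx.
case: (ltnP i n.+1) => hin.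
  rewrite ger0_norm //; apply: le_trans (normr_ge0 _) (le_trans hlast _).
  case: (ltnP i n) => hin'.
    by have /forallP/(_ (inord n))/implyP := hd i; apply; rewrite inordK.
  have -> : i = inord n by apply: val_inj; rewrite /= inordK //; apply/eqP;
    rewrite eqn_leq hin' -ltnS hin.
  exact: lexx.
have -> : i = ord_max.
  by apply: val_inj; apply/eqP; rewrite eqn_leq hin -ltnS ltn_ord.
exact: le_trans hlast (hc _).
Qed.

(* Main.v *)
Require Import Defs.
From mathcomp Require Import mpoly.
From mathcomp Require Import boolp classical_sets cardinality fsbigop.
From mathcomp Require Import all_boot all_order all_algebra.
From mathcomp Require Import fingroup perm zify ring lra.

Set Implicit Arguments.
Unset Strict Implicit.
Unset Printing Implicit Defensive.

Import Order.TTheory GRing.Theory Num.Theory.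
Local Open Scope ring_scope.

(** Write d for 2c and call a set of rows C a column; it stands for the spin
weight with coordinates +1/2 at the rows in C and -1/2 at the others.  A
semistandard tableau T with d columns (some possibly empty) has as weight the
sum of the weights of its columns.  The three characters indexed by the
rectangle (c^n) are the sums of the monomials x^T over such tableaux: over all
of them for so_(2n+1), over those with even rows for sp_2n, and over those
whose column lengths are congruent to n modulo 2 for so_2n.  The argument
proves this together with the product rule, in the manner of Stembridge's
proof of the Littlewood-Richardson rule, except that his sign-reversing
involution is replaced by an induction on the number of columns.

Read the columns of T from right to left as the steps of a walk starting at
w = lambda + rho, and let A(w) be the alternant of w, which changes sign under
every simple reflection s of the Weyl group.  Let F_D(w) be the sum of
A(w + weight) over all tableaux with m columns that can stand to the left of a
column D.  If s does not move D further to the right, then F_D is again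
antisymmetric under s ([reflective_step], applied to the walls x_i = x_(i+1) in
[walksum_adj] and to the last wall in [walksum_short], [walksum_long] and
[walksum_even]).  A walk that leaves the dominant chamber first stands on a
wall, having just read a column D that crosses it downwards; for such D the sum
over all continuations of the walk is equal to its own opposite.  Only
the walks that stay in the chamber remain ([walksum_dominant]).

The same antisymmetry, applied to f - f o s instead of A, shows that the
multiset of tableau weights is invariant under the Weyl group.  Hence
Q A(w) = F(w), where Q is the sum of the x^T ([alternant_mul]).  From w = rho
only one walk stays in the chamber, the one all of whose columns are full; so
Q A(rho) = A(rho + (c^n)), and Q is the character of (c^n) ([short_walks],
[long_walks], [even_walks]).  The product of the two characters is thus the sum
of the characters of the end points of the walks in the chamber that start at
lambda + rho ([product_rule]).

Finally, these walks are the fillings that are to be counted.  From a filling,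
the k-th column (from k = 0 on the left) is the set of the rows that contain an
entry with exactly k equal entries to its right; conversely an entry is the
rank of its row in its column ([col_word], [walk_filling], [LR_count]).  A walk
stays within the walls x_i = x_(i+1) because the filling is semistandard, and
its columns form a tableau because the reading word is a lattice word.  The
column lengths give the condition on mu ([even_rows_walk], [oddcols_walk]), and
the last wall gives the extra property of the filling ([last_row_walk],
[orth_walk]).

All weights are doubled, so that they are vectors of integers. *)

(** * Columns *)

Section Columns.
Variable n : nat.
Implicit Types (C D : {set 'I_n}) (i j : 'I_n).

Definition nbelow C (v : nat) : nat := #|[set i in C | (i < v)%N]|.

Lemma nbelow0 C : nbelow C 0 = 0%N.
Proof. by apply/eqP; rewrite cards_eq0; apply/eqP/setP => i; rewrite !inE andbF. Qed.

Lemma nbelowS C i : nbelow C i.+1 = (nbelow C i + (i \in C))%N.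
Proof.
rewrite /nbelow (cardsD1 i [set j in C | (j < i.+1)%N]) !inE ltnSn andbT addnC.
congr (_ + _)%N; apply: eq_card => j; rewrite !inE ltnS.
rewrite [(j <= i)%N]leq_eqVlt -(inj_eq val_inj j i).
by case: ltngtP => //= _; rewrite ?andbF ?andbT.
Qed.

Lemma nbelowT C : nbelow C n = #|C|.
Proof. by apply: eq_card => j; rewrite !inE ltn_ord andbT. Qed.

Lemma nbelow_leq C u v : (u <= v)%N -> (nbelow C u <= nbelow C v)%N.
Proof.
move=> uv; apply/subset_leq_card/subsetP => j; rewrite !inE.
by case/andP=> -> /= /leq_trans; apply.
Qed.

Lemma nbelow_setT v : (v <= n)%N -> nbelow setT v = v.
Proof.
elim: v => [|v IH] vn; first by rewrite nbelow0.
by rewrite (nbelowS _ (Ordinal vn)) /= IH 1?ltnW // inE addn1.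
Qed.

Lemma nbelow_le C v : (v <= n)%N -> (nbelow C v <= v)%N.
Proof.
move=> vn; rewrite -[leqRHS](nbelow_setT vn).
by apply/subset_leq_card/subsetP => j; rewrite !inE => /andP[].
Qed.

(** The column C may stand immediately to the left of D in a semistandard
tableau: comparing the numbers of entries below every bound is the same as
comparing the e-th smallest entries for every e. *)
Definition col_le C D : bool := [forall v : 'I_n.+1, (nbelow D v <= nbelow C v)%N].

Lemma col_leP C D :
  reflect (forall v, (v <= n)%N -> (nbelow D v <= nbelow C v)%N) (col_le C D).
Proof.
apply: (iffP forallP) => [H v vn|H v]; last by apply: H; rewrite -ltnS.
exact: (H (Ordinal (vn : (v < n.+1)%N))).
Qed.

Definition col_weight C : {ffun 'I_n -> int} := [ffun i => if i \in C then 1 else -1].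

(** An arbitrary element of the hyperoctahedral group, encoded as a permutation
followed by the sign changes at the positions in e. *)
Definition signed_act (s : 'S_n) (e : {set 'I_n}) (w : {ffun 'I_n -> int}) :
    {ffun 'I_n -> int} :=
  [ffun j => if j \in e then - w (s j) else w (s j)].

Lemma signed_actD s e u v : signed_act s e (u + v) = signed_act s e u + signed_act s e v.
Proof. by apply/ffunP => j; rewrite !ffunE; case: ifP => _; rewrite // opprD. Qed.

End Columns.

(** * Antisymmetry of sums over tableaux *)

Section OneStep.
Variables (R W : zmodType) (K : Type).
Hypothesis R2 : forall x : R, x + x = 0 -> x = 0.
Variables (s : W -> W) (alpha : W).
Hypotheses (sD : forall u v, s (u + v) = s u + s v).
Variables (maxp stable : pred K) (flip : K -> K).

(** Here f D sums an antisymmetric function over the tableaux that fit to the left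
of D, [maxp] selects the columns that s moves to the left, and [stable] those
that s does not move to the right.  The second clause says that passing from
[flip E] to E adds a sum that is antisymmetric about the translate of the
hyperplane of s by alpha; for the generating polynomials it says that the one
of E is the image under a Demazure operator of the one of [flip E].  It is what
makes an induction possible. *)
Definition reflective (f : K -> W -> R) : Prop :=
  (forall D, stable D -> forall w, f D (s w) = - f D w) /\
  (forall E, maxp E -> forall w,
     f E (s (w - alpha)) - f (flip E) (s (w - alpha)) = - (f E w - f (flip E) w)).

Variables (T : finType) (N : K -> pred T) (nx : T -> K) (wt : T -> W)
          (tau : T -> T).

Definition max_trans t t' :=
  [/\ maxp (nx t), nx t' = flip (nx t), wt t' = wt t + alpha,
      s (wt t) = wt t' & s (wt t') = wt t].

Hypotheses (max_stable : forall D, maxp D -> stable D) (tauK : involutive tau).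
Hypothesis N_tau : forall D t, stable D -> N D (tau t) = N D t.
Hypothesis N_cases : forall D t, stable D -> N D t ->
  [\/ [/\ tau t = t, s (wt t) = wt t & stable (nx t)],
      max_trans t (tau t) | max_trans (tau t) t].
Hypothesis N_flip : forall E t, maxp E -> N (flip E) t -> N E t.
Hypothesis N_flipN : forall E t, maxp E -> N E t -> ~~ N (flip E) t ->
  maxp (nx t) /\ s (wt t) = wt t + alpha.
Hypothesis sK : involutive s.

(** Transitions to the left of a stable column come in pairs t, [tau t] whose
contributions cancel: for a fixed transition by the first clause for its target,
for a genuine pair by the first clause for the maximal target together with the
second clause for the difference of the two.  The transitions that are possible
from E but not from [flip E] lead to maximal targets, and the second clause for
the new functions follows from the first one for these. *)
Lemma reflective_step (f g : K -> W -> R) :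
  (forall D w, g D w = \sum_(t | N D t) f (nx t) (w + wt t)) ->
  reflective f -> reflective g.
Proof.
move=> gE [f1 f2]; split=> [D stD w|E maxE w].
  apply/eqP; rewrite -subr_eq0 opprK; apply/eqP/R2.
  rewrite !gE -big_split /=.
  set G := (X in \sum_(t | _) X t).
  suff anti t : N D t -> G t + G (tau t) = 0.
    rewrite [X in _ + X](reindex_inj (inv_inj tauK)) /=.
    rewrite [X in _ + X](eq_bigl (N D)) => [|t]; last exact: N_tau.
    by rewrite -big_split big1.
  (* The value of f at the target of t2, the flip of the target of t1, is its value at
     the latter minus the difference that the second clause controls. *)
  have key t1 t2 : max_trans t1 t2 -> G t1 + G t2 = 0.
    case=> mx nx2 wt2 s1 s2; rewrite /G nx2.
    have st1 := f1 _ (max_stable mx).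
    have e1 : f (nx t1) (s w + wt t1) = - f (nx t1) (w + wt t2).
      by rewrite -st1 sD s2.
    have e2 : f (nx t1) (s w + wt t2) = - f (nx t1) (w + wt t1).
      by rewrite -st1 sD s1.
    have es : s (w + wt t2 - alpha) = s w + wt t2.
      by rewrite wt2 addrA addrK sD s1 wt2.
    have := f2 _ mx (w + wt t2); rewrite es e2 => e3.
    have -> : f (flip (nx t1)) (s w + wt t2) =
      - f (nx t1) (w + wt t1) + (f (nx t1) (w + wt t2) - f (flip (nx t1)) (w + wt t2)).
      by rewrite -[X in _ = _ + X]opprK -e3 opprB [RHS]addrC subrK.
    rewrite e1; set a := f (nx t1) (w + wt t1); set b := f _ (w + wt t2).
    set c := f (flip _) _.
    by rewrite -[- a + _ + _]addrA subrK [- a + b]addrC -[b - a]opprB [- b + a]addrC subrr.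
  move=> Nt; case: (N_cases stD Nt) => [[-> ws st]|/key //|/key].
    by rewrite /G -{1 3}ws -!sD f1 // addNr addr0.
  by rewrite addrC.
have dif w' : g E w' - g (flip E) w' =
    \sum_(t | N E t && ~~ N (flip E) t) f (nx t) (w' + wt t).
  rewrite !gE (bigID (N (flip E))) /=.
  rewrite (eq_bigl (N (flip E))) => [|t]; first by rewrite addrAC subrr add0r.
  by case: (boolP (N (flip E) t)) => [/(N_flip maxE) ->|_]; rewrite ?andbF.
rewrite !dif -sumrN; apply: eq_bigr => t /andP[Nt NNt].
have [mx ws] := N_flipN maxE Nt NNt.
rewrite -f1 ?max_stable //; congr (f _ _); rewrite -{1}[wt t]sK -sD ws.
by rewrite addrCA addrNK addrC.
Qed.
End OneStep.

Section Walks.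
Variables (n : nat) (R : zmodType) (p : nat -> nat -> nat -> bool).
Local Notation col := {set 'I_n}.
Local Notation weight := {ffun 'I_n -> int}.

(** The predicate p constrains the sizes of two adjacent columns; its first argument
is the index of the left one, counted from 0 at the left end. *)
Definition step_ok m (D C : col) : bool := col_le C D && p m #|C| #|D|.

Fixpoint walksum (A : weight -> R) (m : nat) (D : col) (w : weight) : R :=
  if m is m'.+1 then
    \sum_(C | step_ok m' D C) walksum A m' C (w + col_weight C)
  else A w.

End Walks.

Section Flips.
Variable n : nat.
Local Notation col := {set 'I_n}.
Implicit Types (C D : col).

Definition relabel (s : 'S_n) C : col := [set j | s j \in C].

Lemma card_relabel s C : #|relabel s C| = #|C|.
Proof. by rewrite -(card_preimset C (@perm_inj _ s)); apply: eq_card => j; rewrite !inE. Qed.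

Lemma col_weight_relabel s C : col_weight (relabel s C) = signed_act s set0 (col_weight C).
Proof. by apply/ffunP => j; rewrite !ffunE !inE. Qed.

Lemma nbelow_relabel (s : {perm 'I_n}) C v :
  (forall j : 'I_n, (s j < v)%N = (j < v)%N) -> nbelow (relabel s C) v = nbelow C v.
Proof.
move=> sv; rewrite /nbelow -(card_relabel s [set j in C | (j < v)%N]).
by apply: eq_card => j; rewrite !inE sv.
Qed.
End Flips.

(** * The walls between consecutive coordinates *)

Section AdjacentNode.
Variables (n : nat) (R : zmodType) (p : nat -> nat -> nat -> bool).
Hypothesis R2 : forall x : R, x + x = 0 -> x = 0.
Local Notation col := {set 'I_n}.
Local Notation weight := {ffun 'I_n -> int}.
Variables (i i' : 'I_n).
Hypothesis ii' : i' = i.+1 :> nat.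
Implicit Types (C D : col).

Let s := tperm i i'.

Lemma nbelow_relabel_adj C v : v != i.+1 -> nbelow (relabel s C) v = nbelow C v.
Proof. by move=> vi; apply: nbelow_relabel => j; rewrite /s; case: tpermP => [->|->|//];
  lia. Qed.

Definition adj_stable D := (i \in D) ==> (i' \in D).
Definition adj_max D := (i \notin D) && (i' \in D).

(** Unless D contains i but not i', its count at i' equals the one at i or is one less
than the one at i' + 1; so the inequality at i' follows from one of its two
neighbours. *)
Lemma col_le_adj C D : adj_stable D ->
  col_le C D = [forall v : 'I_n.+1, (v != i.+1 :> nat) ==> (nbelow D v <= nbelow C v)%N].
Proof.
move=> st; apply/col_leP/forallP => [H v|H v vn].
  by apply/implyP => _; apply: H; rewrite -ltnS.
have H' u : (u <= n)%N -> u != i.+1 -> (nbelow D u <= nbelow C u)%N.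
  by move=> un ui; have := H (Ordinal (un : (u < n.+1)%N)); rewrite /= ui.
have [vi|vi] := eqVneq v i.+1; last exact: H'.
have iltn := ltn_ord i; have i'ltn := ltn_ord i'.
have h1 := H' i ltac:(lia) ltac:(lia).
have h2 := H' i'.+1 ltac:(lia) ltac:(lia).
move: h2; rewrite vi !nbelowS !ii' !nbelowS; move: st; rewrite /adj_stable.
by case: (i \in D); case: (i' \in D) => //= _; lia.
Qed.

Lemma col_le_relabel_adj C D : adj_stable D -> col_le (relabel s C) D = col_le C D.
Proof.
move=> st; rewrite !col_le_adj //; apply: eq_forallb => v.
by case: eqVneq => //= vi; rewrite nbelow_relabel_adj.
Qed.

Lemma nbelow_relabel_le_max C v : (v <= n)%N -> adj_max C ->
  (nbelow C v <= nbelow (relabel s C) v)%N.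
Proof.
move=> vn /andP[/negbTE iC i'C].
have [->|vi] := eqVneq v i.+1; last by rewrite nbelow_relabel_adj.
by rewrite !nbelowS nbelow_relabel_adj ?ltn_eqF // iC addn0 leq_addr.
Qed.

Lemma col_le_relabel_max C E : adj_max E -> col_le C (relabel s E) -> col_le C E.
Proof.
by move=> mx /col_leP H; apply/col_leP => v vn; apply: leq_trans (H _ vn);
  apply: nbelow_relabel_le_max.
Qed.

(** Only the inequality at i' can fail for the reflected column, and it fails by one;
so the count of C does not grow from i to i', and it has to grow from i' to
i' + 1. *)
Lemma col_le_relabel_maxN C E : adj_max E -> col_le C E -> ~~ col_le C (relabel s E) ->
  adj_max C.
Proof.
move=> mx /col_leP H; apply: contraR => nC; apply/col_leP => v vn.
have [vi|vi] := eqVneq v i.+1; last by rewrite nbelow_relabel_adj // H.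
have iltn := ltn_ord i; have i'ltn := ltn_ord i'.
have h1 := H i ltac:(lia); have h2 := H i'.+1 ltac:(lia).
move: mx nC h2; rewrite /adj_max vi !nbelowS nbelow_relabel_adj ?ltn_eqF // inE tpermL ii'
  !nbelowS.
move=> /andP[/negbTE-> ->] /=; case: (i \in C); case: (i' \in C) => //=; lia.
Qed.

Definition adj_root : weight :=
  [ffun j => if j == i then 2 else if j == i' then -2 else 0].

Lemma neq_adj : i != i'.
Proof. by rewrite -(inj_eq val_inj) /=; lia. Qed.

Lemma col_weight_relabel_max C : adj_max C ->
  col_weight (relabel s C) = col_weight C + adj_root.
Proof.
move=> /andP[iC i'C]; apply/ffunP => j; rewrite !ffunE !inE.
have ii := neq_adj.
case: tpermP => [->|->|/eqP/negbTE-> /eqP/negbTE->]; last by rewrite addr0.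
  by rewrite i'C (negbTE iC) eqxx.
by rewrite i'C (negbTE iC) eq_sym (negbTE ii) eqxx.
Qed.

Lemma relabel_adjK : involutive (@relabel n s).
Proof. by move=> C; apply/setP => j; rewrite !inE tpermK. Qed.

Lemma signed_act_adjK : involutive (@signed_act n s set0).
Proof. by move=> C; apply/ffunP => j; rewrite !ffunE !inE tpermK. Qed.

Lemma walksum_adj (A : weight -> R) m D w :
  (forall w, A (signed_act s set0 w) = - A w) -> adj_stable D ->
  walksum p A m D (signed_act s set0 w) = - walksum p A m D w.
Proof.
move=> Aanti; move: D w.
suff H : reflective (signed_act s set0) adj_root adj_max adj_stable (relabel s) (walksum p A m).
  by move=> D w st; apply: H.1.
elim: m => [|m IH]; first by split=> *; rewrite ?Aanti ?subrr ?oppr0.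
have mt C : adj_max C -> max_trans (signed_act s set0) adj_root adj_max (relabel s) id
  (@col_weight n) C (relabel s C).
  move=> mx; split=> //; first exact: col_weight_relabel_max.
    by rewrite col_weight_relabel.
  by rewrite col_weight_relabel signed_act_adjK.
apply: (@reflective_step _ _ _ R2 (signed_act s set0) _ _ adj_max adj_stable (relabel s) col
          (fun D C => step_ok p m D C) id (@col_weight n) (relabel s)) IH => //.
- exact: signed_actD.
- by move=> D /andP[_ i'D]; apply/implyP.
- exact: relabel_adjK.
- by move=> D C st; rewrite /step_ok /= col_le_relabel_adj // card_relabel.
- move=> D C st _; case iC: (i \in C); case i'C: (i' \in C).
  + constructor 1; rewrite -col_weight_relabel; split=> //;
    last by rewrite /= /adj_stable i'C implybT.
      by apply/setP => j; rewrite inE /s; case: tpermP => // ->; rewrite iC i'C.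
    by congr col_weight; apply/setP => j; rewrite inE /s; case: tpermP => // ->; rewrite iC i'C.
  + constructor 3; rewrite -{2}[C]relabel_adjK; apply: mt.
    by rewrite /adj_max !inE tpermL tpermR iC i'C.
  + by constructor 2; apply: mt; rewrite /adj_max iC i'C.
  + constructor 1; rewrite -col_weight_relabel; split=> //; last by rewrite /= /adj_stable iC.
      by apply/setP => j; rewrite inE /s; case: tpermP => // ->; rewrite iC i'C.
    by congr col_weight; apply/setP => j; rewrite inE /s; case: tpermP => // ->; rewrite iC i'C.
- by move=> E C mx /andP[h1 h2]; rewrite /step_ok card_relabel in h2 *;
  rewrite h2 (col_le_relabel_max mx h1).
- move=> E C mx /andP[h1 h2]; rewrite /step_ok card_relabel h2 andbT => h3.
  have mC := col_le_relabel_maxN mx h1 h3; split=> //.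
  by rewrite -col_weight_relabel col_weight_relabel_max.
- exact: signed_act_adjK.
Qed.
End AdjacentNode.

(** * The last wall *)

Section LastNodes.
Variables (n : nat) (R : zmodType).
Hypothesis R2 : forall x : R, x + x = 0 -> x = 0.
Local Notation col := {set 'I_n}.
Local Notation weight := {ffun 'I_n -> int}.
Implicit Types (C D E : col).

Lemma eq_nbelow C D v : (forall j : 'I_n, (j < v)%N -> (j \in C) = (j \in D)) ->
  nbelow C v = nbelow D v.
Proof.
move=> H; apply: eq_card => j; rewrite !inE; case jv: (j < v)%N; rewrite ?andbF //.
by rewrite H.
Qed.

Lemma col_le_trans : transitive (@col_le n).
Proof.
by move=> D C E /col_leP h1 /col_leP h2; apply/col_leP => v vn;
  apply: leq_trans (h2 _ vn) (h1 _ vn).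
Qed.

Section SignChange.
Variable l : 'I_n.
Hypothesis ln : l.+1 = n.

Definition toggle C : col := [set j | (j \in C) (+) (j == l)].

Lemma toggleK : involutive toggle.
Proof. by move=> C; apply/setP => j; rewrite !inE -addbA addbb addbF. Qed.

Lemma in_toggle C : (l \in toggle C) = (l \notin C).
Proof. by rewrite inE eqxx addbT. Qed.

Lemma col_weight_toggle C : col_weight (toggle C) = signed_act 1 [set l] (col_weight C).
Proof.
apply/ffunP => j; rewrite !ffunE !inE perm1.
by case: (j \in C); case: (j == l).
Qed.

Lemma signed_act_signK : involutive (@signed_act n 1 [set l]).
Proof. by move=> C; apply/ffunP => j; rewrite !ffunE !inE !perm1; case: (j == l);
  rewrite ?opprK. Qed.

Lemma nbelow_toggle C v : (v <= l)%N -> nbelow (toggle C) v = nbelow C v.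
Proof.
move=> vl; apply: eq_nbelow => j jv; rewrite inE.
have /negbTE-> : j != l by apply: contraTneq jv => ->; rewrite -leqNgt.
by rewrite addbF.
Qed.

Lemma col_le_last C D :
  col_le C D = [forall v : 'I_n.+1, (v <= l)%N ==> (nbelow D v <= nbelow C v)%N]
            && (nbelow D l + (l \in D) <= nbelow C l + (l \in C))%N.
Proof.
have -> : (nbelow D l + (l \in D) <= nbelow C l + (l \in C))%N = (nbelow D n <= nbelow C n)%N.
  by rewrite -!nbelowS ln.
apply/col_leP/andP => [H|[/forallP H Hn] v vn].
  by split; [apply/forallP => v; apply/implyP => _; apply: H; rewrite -ltnS|apply: H].
have [vl|vl] := leqP v l; last by have -> : v = n by lia.
by have := H (Ordinal (vn : (v < n.+1)%N)); rewrite /= vl.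
Qed.

Lemma col_le_last_out C D : l \notin D ->
  col_le C D = [forall v : 'I_n.+1, (v <= l)%N ==> (nbelow D v <= nbelow C v)%N].
Proof.
move=> lD; rewrite col_le_last (negbTE lD) addn0.
apply/andP/idP => [[]//|H]; split=> //; apply: leq_trans (leq_addr _ _).
have ln1 : (l < n.+1)%N by rewrite ltnS ltnW.
by have /forallP/(_ (Ordinal ln1)) := H; rewrite leqnn.
Qed.

Lemma col_le_toggle C D : l \notin D -> col_le (toggle C) D = col_le C D.
Proof.
move=> lD; rewrite !col_le_last_out //; apply: eq_forallb => v.
by case: leqP => //= vl; rewrite nbelow_toggle.
Qed.

Lemma col_le_toggle_max C E : l \notin E -> col_le C (toggle E) -> col_le C E.
Proof.
move=> lE; rewrite col_le_last col_le_last_out // => /andP[/forallP H _].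
apply/forallP => v; have := H v.
by case: leqP => //= vl; rewrite nbelow_toggle.
Qed.

Lemma col_le_toggle_maxN C E : l \notin E -> col_le C E -> ~~ col_le C (toggle E) ->
  (l \notin C) && (nbelow C l == nbelow E l).
Proof.
move=> lE CE; have h : (nbelow E l <= nbelow C l)%N by move/col_leP: CE; apply; rewrite ltnW.
move: CE; rewrite [col_le C (toggle E)]col_le_last col_le_last_out // => /forallP H.
have -> /= : [forall v : 'I_n.+1, (v <= l)%N ==> (nbelow (toggle E) v <= nbelow C v)%N].
  by apply/forallP => v; have := H v; case: leqP => //= vl; rewrite nbelow_toggle.
rewrite nbelow_toggle // in_toggle lE /= => nle; case: (l \in C) nle => /=; lia.
Qed.

Definition last_root (k : int) : weight := [ffun j => if j == l then k else 0].

Lemma col_weight_toggle_out C : l \notin C ->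
  col_weight (toggle C) = col_weight C + last_root 2.
Proof.
move=> lC; apply/ffunP => j; rewrite !ffunE !inE.
by case: eqVneq => [->|_]; rewrite ?addbF ?addr0 // (negbTE lC).
Qed.

Lemma walksum_short (p : nat -> nat -> nat -> bool) (A : weight -> R) m D w :
  (forall m x y, p m x y) ->
  (forall w, A (signed_act 1 [set l] w) = - A w) -> l \notin D ->
  walksum p A m D (signed_act 1 [set l] w) = - walksum p A m D w.
Proof.
move=> pT Aanti lD.
pose mx D := l \notin D.
suff H : reflective (signed_act 1 [set l]) (last_root 2) mx mx toggle (walksum p A m).
  exact: H.1.
elim: m => [|m IH]; first by split=> *; rewrite ?Aanti ?subrr ?oppr0.
have mt C : mx C -> max_trans (signed_act 1 [set l]) (last_root 2) mx toggle id (@col_weight n)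
  C (toggle C).
  move=> mC; split=> //; first exact: col_weight_toggle_out.
    by rewrite col_weight_toggle.
  by rewrite col_weight_toggle signed_act_signK.
apply: (@reflective_step _ _ _ R2 (signed_act 1 [set l]) _ _ mx mx toggle col
          (fun D C => step_ok p m D C) id (@col_weight n) toggle) IH => //.
- exact: signed_actD.
- exact: toggleK.
- by move=> E C st; rewrite /step_ok /= !pT !andbT col_le_toggle.
- move=> E C st _; case: (boolP (mx C)) => mC; first by constructor 2; apply: mt.
  by constructor 3; rewrite -{2}[C]toggleK; apply: mt; rewrite /mx in_toggle.
- by move=> E C mE; rewrite /step_ok /= !pT !andbT; apply: col_le_toggle_max.
- move=> E C mE; rewrite /step_ok /= !pT !andbT => h1 h2.
  have /andP[mC _] := col_le_toggle_maxN mE h1 h2; split=> //.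
  by rewrite -col_weight_toggle col_weight_toggle_out.
- exact: signed_act_signK.
Qed.

(** Columns 2k and 2k + 1 have the same length for every k: the rows of the tableau
are even. *)
Definition pair_size (m x y : nat) : bool := odd m || (x == y).

(** Two columns of equal length are reflected together.  If only one of them
contains the last row, their total weight lies on the wall and is fixed. *)
Definition toggle2 (t : col * col) :=
  if (l \in t.1) == (l \in t.2) then (toggle t.1, toggle t.2) else t.

Lemma card_last C : #|C| = (nbelow C l + (l \in C))%N.
Proof. by rewrite -nbelowS ln nbelowT. Qed.

Lemma card_toggle2 C D : (l \in C) = (l \in D) ->
  (#|toggle C| == #|toggle D|) = (#|C| == #|D|).
Proof.
by move=> CD; rewrite !card_last !nbelow_toggle // !in_toggle CD !eqn_add2r.
Qed.

Lemma col_le_toggle2 C D : (l \in C) = (l \in D) ->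
  col_le (toggle C) (toggle D) = col_le C D.
Proof.
move=> CD; rewrite !col_le_last !nbelow_toggle // !in_toggle CD !leq_add2r.
congr (_ && _); apply: eq_forallb => v.
by case: leqP => //= vl; rewrite !nbelow_toggle.
Qed.

(** The reflection in the long root acts on pairs of columns, hence the even number
of remaining columns. *)
Lemma walksum_long (A : weight -> R) k D w :
  (forall w, A (signed_act 1 [set l] w) = - A w) -> l \notin D ->
  walksum pair_size A k.*2 D (signed_act 1 [set l] w) = - walksum pair_size A k.*2 D w.
Proof.
move=> Aanti lD.
pose mx D := l \notin D.
suff H : reflective (signed_act 1 [set l]) (last_root 4) mx mx toggle
  (walksum pair_size A k.*2).
  exact: H.1.
elim: k => [|k IH]; first by split=> *; rewrite ?Aanti ?subrr ?oppr0.
have od : odd k.*2 = false by rewrite odd_double.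
pose wt (t : col * col) := col_weight t.1 + col_weight t.2.
pose N D (t : col * col) := [&& col_le t.1 D, col_le t.2 t.1 & #|t.2| == #|t.1|].
have s2 (t : col * col) : (l \in t.1) = (l \in t.2) ->
  wt (toggle2 t) = signed_act 1 [set l] (wt t).
  by move=> e; rewrite /toggle2 e eqxx /wt /= !col_weight_toggle signed_actD.
have tK : involutive toggle2.
  move=> t; rewrite {2}/toggle2; case: ifP => e; last by rewrite /toggle2 e.
  by rewrite /toggle2 /= !in_toggle (eqP e) eqxx !toggleK; case: (t).
have mt (t : col * col) : (l \in t.1) = (l \in t.2) -> l \notin t.2 ->
    max_trans (signed_act 1 [set l]) (last_root 4) mx toggle snd wt t (toggle2 t).
  move=> e lt; split=> //; last by rewrite s2 // signed_act_signK.
  - by rewrite /toggle2 e eqxx.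
  - rewrite /toggle2 /wt e eqxx /= !col_weight_toggle_out ?e // addrACA; congr (_ + _).
    by apply/ffunP => j; rewrite !ffunE; case: eqP.
  - by rewrite s2.
apply: (@reflective_step _ _ _ R2 (signed_act 1 [set l]) _ _ mx mx toggle _ N snd wt toggle2)
  IH => //.
- exact: signed_actD.
- move=> E t mE; rewrite /N /toggle2; case: ifP => // /eqP e.
  by rewrite /= col_le_toggle // col_le_toggle2 // card_toggle2.
- move=> E t mE /and3P[_ /col_leP le2 /eqP e2].
  have [e|ne] := eqVneq (l \in t.1) (l \in t.2).
    have [lt|lt] := boolP (l \in t.2); last by constructor 2; apply: mt.
    constructor 3; rewrite -{2}[t]tK; apply: mt.
      by rewrite /toggle2 e eqxx /= !in_toggle e.
    by rewrite /toggle2 e eqxx /= in_toggle lt.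
  have [l1 l2] : (l \in t.1) = true /\ (l \in t.2) = false.
    have := le2 l (ltnW (ltn_ord l)); move: e2 ne; rewrite !card_last.
    by case: (l \in t.1); case: (l \in t.2) => //=; lia.
  constructor 1; split; rewrite ?/mx ?l2 //; first by rewrite /toggle2 l1 l2.
  apply/ffunP => j; rewrite !ffunE !inE perm1.
  by case: eqP => // ->; rewrite l1 l2.
- by move=> E t mE /and3P[h1 h2 h3]; rewrite /N h2 h3 (col_le_toggle_max mE h1).
- move=> E t mE /and3P[h1 h2 h3]; rewrite /N h2 h3 !andbT => h4.
  have /andP[l1 _] := col_le_toggle_maxN mE h1 h4.
  have l2 : l \notin t.2.
    move/col_leP: h2 (eqP h3) => /(_ l (ltnW (ltn_ord l))); rewrite !card_last.
    by move: l1; case: (l \in t.1); case: (l \in t.2) => //=; lia.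
  split=> //; have e : (l \in t.1) = (l \in t.2) by rewrite (negbTE l1) (negbTE l2).
  by case: (mt t e l2) => _ _ <- ->.
- exact: signed_act_signK.
- move=> E u; rewrite doubleS /=.
  under eq_bigr => Y _ do under eq_bigr => X _ do rewrite -addrA.
  rewrite pair_big_dep /=; apply: eq_bigl => t.
  by rewrite /step_ok /pair_size /= od /= andbT.
Qed.

End SignChange.

Section EvenSignChange.
Variables a b : 'I_n.
Hypotheses (ab : b = a.+1 :> nat) (bn : b.+1 = n).
Let s := tperm a b.
Let e : {set 'I_n} := [set a; b].

(** The reflection in the last root of so_2n exchanges the columns that contain both
of the last two rows with those that contain neither, and fixes the others. *)
Definition toggle_pair C : col := [set j | (s j \in C) (+) (j \in e)].

Definition even_size (m x y : nat) : bool := odd x == odd y.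

Lemma neq_pair : (a == b) = false.
Proof. by apply/eqP => /(congr1 val) /=; lia. Qed.

Lemma in_pair : (a \in e) * (b \in e).
Proof. by split; rewrite !inE eqxx ?orbT. Qed.

Lemma in_toggle_pair C :
  ((a \in toggle_pair C) = (b \notin C)) * ((b \in toggle_pair C) = (a \notin C)).
Proof. by split; rewrite inE in_pair addbT /s ?tpermL ?tpermR. Qed.

Lemma out_toggle_pair C j : j != a -> j != b -> (j \in toggle_pair C) = (j \in C).
Proof. by move=> ja jb; rewrite !inE (negbTE ja) (negbTE jb) addbF /s tpermD // eq_sym. Qed.

Lemma toggle_pairK : involutive toggle_pair.
Proof.
move=> C; apply/setP => j.
have [->|ja] := eqVneq j a; first by rewrite !in_toggle_pair negbK.
have [->|jb] := eqVneq j b; first by rewrite !in_toggle_pair negbK.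
by rewrite !out_toggle_pair.
Qed.

Lemma col_weight_toggle_pair C : col_weight (toggle_pair C) = signed_act s e (col_weight C).
Proof.
apply/ffunP => j; rewrite !ffunE inE.
by case: (s j \in C); case: (j \in e).
Qed.

Lemma signed_act_pairK : involutive (@signed_act n s e).
Proof.
move=> w; apply/ffunP => j; rewrite !ffunE /s.
by case: tpermP => [->|->|/eqP/negbTE ja /eqP/negbTE jb];
  rewrite ?in_pair ?tpermL ?tpermR ?opprK // !inE ja jb /= tpermD // eq_sym ?ja ?jb.
Qed.

Lemma nbelow_toggle_pair C v : (v <= a)%N -> nbelow (toggle_pair C) v = nbelow C v.
Proof.
move=> va; apply: eq_nbelow => j jv; apply: out_toggle_pair;
by apply: contraTneq jv => ->; rewrite -leqNgt ?ab; lia.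
Qed.

Lemma nbelow_last C : nbelow C b = (nbelow C a + (a \in C))%N.
Proof. by rewrite ab nbelowS. Qed.

Lemma card_lastb C : #|C| = (nbelow C a + (a \in C) + (b \in C))%N.
Proof. by rewrite -nbelow_last -nbelowS bn nbelowT. Qed.

Lemma col_le_pair C D :
  col_le C D = [&& [forall v : 'I_n.+1, (v <= a)%N ==> (nbelow D v <= nbelow C v)%N],
                nbelow D a <= nbelow C a, nbelow D b <= nbelow C b & #|D| <= #|C|]%N.
Proof.
apply/col_leP/and4P => [H|[/forallP H Ha Hb Hn] v vn].
  split; try by apply: H; rewrite ltnW.
    by apply/forallP => v; apply/implyP => _; apply: H; rewrite -ltnS.
  by rewrite -(nbelowT C) -(nbelowT D); apply: H.
have [vl|vl] := leqP v a.
  by have := H (Ordinal (vn : (v < n.+1)%N)); rewrite /= vl.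
have [->//|vb] := eqVneq v b.
have -> : v = n by lia.
by rewrite !nbelowT.
Qed.

Lemma odd_card_toggle_pair C : odd #|toggle_pair C| = odd #|C|.
Proof.
rewrite !card_lastb nbelow_toggle_pair // !in_toggle_pair !oddD.
by case: (a \in C); case: (b \in C); case: (odd _).
Qed.

Definition pair_stable D := (a \notin D) || (b \notin D).
Definition pair_max D := (a \notin D) && (b \notin D).

(** The parity of the lengths is essential here: a column that contains both of the
last two rows may fit where the one that contains neither fails by one. *)
Lemma col_le_toggle_pair C D : pair_stable D -> odd #|C| = odd #|D| ->
  col_le C D -> col_le (toggle_pair C) D.
Proof.
move=> st od; rewrite !col_le_pair => /and4P[/forallP h h1 h2 h3]; apply/and4P.
rewrite nbelow_toggle_pair //; split=> //.
- by apply/forallP => v; have := h v; case: leqP => //= vl; rewrite nbelow_toggle_pair.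
- move: st od h2 h3; rewrite /pair_stable !nbelow_last nbelow_toggle_pair // !in_toggle_pair
  !card_lastb !oddD.
  by case: (a \in D); case: (b \in D) => //; case: (a \in C); case: (b \in C) => //= _; lia.
- move: st od h2 h3; rewrite /pair_stable !nbelow_last !card_lastb nbelow_toggle_pair //
  !in_toggle_pair !oddD.
  by case: (a \in D); case: (b \in D) => //; case: (a \in C); case: (b \in C) => //= _; lia.
Qed.

Lemma col_le_toggle_pair_max C E : pair_max E -> col_le C (toggle_pair E) -> col_le C E.
Proof.
move=> /andP[aE bE]; rewrite !col_le_pair => /and4P[/forallP h h1 h2 h3]; apply/and4P.
split.
- by apply/forallP => v; have := h v; case: leqP => //= vl; rewrite nbelow_toggle_pair.
- by move: h1; rewrite nbelow_toggle_pair.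
- by apply: leq_trans h2; rewrite !nbelow_last nbelow_toggle_pair // (negbTE aE); lia.
- apply: leq_trans h3; rewrite !card_lastb nbelow_toggle_pair // (negbTE aE) (negbTE bE); lia.
Qed.

Lemma col_le_toggle_pair_maxN C E : pair_max E -> odd #|C| = odd #|E| ->
  col_le C E -> ~~ col_le C (toggle_pair E) -> pair_max C.
Proof.
move=> /andP[/negbTE aE /negbTE bE] od; rewrite !col_le_pair => /and4P[/forallP h h1 h2 h3].
have -> /= : [forall v : 'I_n.+1, (v <= a)%N ==> (nbelow (toggle_pair E) v <= nbelow C v)%N].
  by apply/forallP => v; have := h v; case: leqP => //= vl; rewrite nbelow_toggle_pair.
move: od h2 h3.
rewrite !nbelow_last !card_lastb nbelow_toggle_pair // !in_toggle_pair aE bE h1 !oddD /pair_max.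
by case: (a \in C); case: (b \in C) => //=; lia.
Qed.

Definition pair_root : weight := [ffun j => if j \in e then 2 else 0].

Lemma col_weight_toggle_pair_max C : pair_max C ->
  col_weight (toggle_pair C) = col_weight C + pair_root.
Proof.
move=> /andP[/negbTE aC /negbTE bC]; apply/ffunP => j; rewrite !ffunE.
have [->|ja] := eqVneq j a; first by rewrite in_pair !in_toggle_pair aC bC.
have [->|jb] := eqVneq j b; first by rewrite in_pair !in_toggle_pair aC bC.
by rewrite out_toggle_pair // !inE (negbTE ja) (negbTE jb) addr0.
Qed.

Lemma walksum_even (A : weight -> R) m D w :
  (forall w, A (signed_act s e w) = - A w) -> pair_stable D ->
  walksum even_size A m D (signed_act s e w) = - walksum even_size A m D w.
Proof.
move=> Aanti stD.
suff H : reflective (signed_act s e) pair_root pair_max pair_stable toggle_pair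
           (walksum even_size A m) by exact: H.1.
elim: m => [|m IH]; first by split=> *; rewrite ?Aanti ?subrr ?oppr0.
have mt C : pair_max C ->
    max_trans (signed_act s e) pair_root pair_max toggle_pair id (@col_weight n) C (toggle_pair
      C).
  move=> mC; split=> //; first exact: col_weight_toggle_pair_max.
    by rewrite col_weight_toggle_pair.
  by rewrite col_weight_toggle_pair signed_act_pairK.
have fixC C : (a \in C) != (b \in C) -> toggle_pair C = C.
  move=> ne; apply/setP => j.
  have [->|ja] := eqVneq j a.
    by rewrite in_toggle_pair; move: ne; case: (a \in C); case: (b \in C).
  have [->|jb] := eqVneq j b; last by rewrite out_toggle_pair.
  by rewrite in_toggle_pair; move: ne; case: (a \in C); case: (b \in C).
apply: (@reflective_step _ _ _ R2 (signed_act s e) _ _ pair_max pair_stable toggle_pair col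
          (fun D C => step_ok even_size m D C) id (@col_weight n) toggle_pair) IH => //.
- exact: signed_actD.
- by move=> E /andP[h _]; rewrite /pair_stable h.
- exact: toggle_pairK.
- move=> E C st; rewrite /step_ok /even_size /= odd_card_toggle_pair.
  case: eqP => od; rewrite ?andbF // !andbT.
  apply/idP/idP; last exact: col_le_toggle_pair.
  by rewrite -{2}[C]toggle_pairK; apply: col_le_toggle_pair; rewrite ?odd_card_toggle_pair.
- move=> E C st _; have [ne|/negbNE/eqP eq] := boolP ((a \in C) != (b \in C)).
    constructor 1; rewrite -col_weight_toggle_pair (fixC _ ne); split=> //.
    by rewrite /= /pair_stable; move: ne; case: (a \in C); case: (b \in C).
  have [aC|aC] := boolP (a \in C); last first.
    by constructor 2; apply: mt; rewrite /pair_max -eq aC.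
  constructor 3; rewrite -{2}[C]toggle_pairK; apply: mt.
  by rewrite /pair_max !in_toggle_pair -eq aC.
- move=> E C mE /andP[h1]; rewrite /step_ok /even_size odd_card_toggle_pair => ->.
  by rewrite (col_le_toggle_pair_max mE h1).
- move=> E C mE /andP[h1]; rewrite /step_ok /even_size odd_card_toggle_pair => h2.
  rewrite h2 andbT => h3.
  have mC := col_le_toggle_pair_maxN mE (eqP h2) h1 h3; split=> //.
  by rewrite -col_weight_toggle_pair col_weight_toggle_pair_max.
- exact: signed_act_pairK.
Qed.

End EvenSignChange.
End LastNodes.

(** * Walks that stay in the chamber *)

Lemma big_tuple_cons (R : nmodType) (T : finType) m (P : pred (seq T)) (F : seq T -> R) :
  \sum_(t : m.+1.-tuple T | P t) F t =
  \sum_(x : T) \sum_(t : m.-tuple T | P (x :: t)) F (x :: t).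
Proof.
rewrite pair_big_dep /= (reindex (fun x : T * m.-tuple T => cons_tuple x.1 x.2)) //=.
exists (fun t : m.+1.-tuple T => (thead t, behead_tuple t)) => [[x t] _|t _] /=.
  by congr pair; apply: val_inj.
by rewrite [RHS]tuple_eta; apply: val_inj.
Qed.

Section Straightening.
Variables (n : nat) (R : zmodType) (p : nat -> nat -> nat -> bool).
Hypothesis R2 : forall x : R, x + x = 0 -> x = 0.
Local Notation col := {set 'I_n}.
Local Notation weight := {ffun 'I_n -> int}.
Implicit Types (C D : col) (w : weight) (t : seq col).

Definition total_weight t : weight := \sum_(C <- t) col_weight C.

(** A walk is the list of the columns of a tableau, read from right to left. *)
Fixpoint walk_ok (good : pred weight) D w t : bool :=
  if t is C :: t' then
    [&& step_ok p (size t') D C, good (w + col_weight C) & walk_ok good C (w + col_weight C) t']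
  else true.

Lemma big_walk_ok good (A : weight -> R) m D w :
  \sum_(t : m.+1.-tuple col | walk_ok good D w t) A (w + total_weight t) =
  \sum_(C | step_ok p m D C && good (w + col_weight C))
    \sum_(t : m.-tuple col | walk_ok good C (w + col_weight C) t) A (w + col_weight C +
      total_weight t).
Proof.
rewrite (@big_tuple_cons _ _ _ (walk_ok good D w) (fun t => A (w + total_weight t))).
rewrite [RHS]big_mkcond; apply: eq_bigr => C _ /=.
case: ifP => [|] h; last first.
  by rewrite big_pred0 // => t; rewrite size_tuple andbA h.
apply: eq_big => t; first by rewrite size_tuple andbA h.
by rewrite /total_weight big_cons addrA.
Qed.

Lemma walksum_tuple (A : weight -> R) m D w :
  walksum p A m D w = \sum_(t : m.-tuple col | walk_ok xpredT D w t) A (w + total_weight t).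
Proof.
elim: m D w => [|m IH] D w /=.
  rewrite (big_pred1 [tuple]) ?/total_weight ?big_nil ?addr0 // => t.
  by rewrite [t]tuple0 /= eqxx.
by rewrite big_walk_ok; apply: eq_big => [C|C _]; rewrite ?andbT ?IH.
Qed.

Definition decreasing w : bool :=
  [forall i : 'I_n, forall j : 'I_n, (j == i.+1 :> nat) ==> (w j < w i)].

Definition same_parity (b : int) (m : nat) w : Prop :=
  forall i, exists z : int, w i = m%:Z + b + 2 * z.

Lemma same_parity_step b m w C : same_parity b m.+1 w -> same_parity b m (w + col_weight C).
Proof.
move=> H i; have [z e] := H i; rewrite !ffunE e.
by case: ifP => _; [exists (z + 1) | exists z]; lia.
Qed.

Variables (A : weight -> R) (lastgood : pred weight) (b : int).
Definition dominant w : bool := decreasing w && lastgood w.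

Hypothesis A_adj : forall (i i' : 'I_n), i' = i.+1 :> nat ->
  forall w, A (signed_act (tperm i i') set0 w) = - A w.
Hypothesis A_last : forall m D C w, dominant w -> same_parity b m.+1 w ->
  step_ok p m D C -> ~~ lastgood (w + col_weight C) -> walksum p A m C (w + col_weight C) = 0.

(** A step out of the chamber lands on a wall: the coordinates that are compared
have the same parity and their difference changes by at most 2.  For the walls
between consecutive coordinates the step must be a column that contains i' but
not i, so that the sum over its continuations is antisymmetric, hence zero at a
fixed point of the reflection. *)
Lemma walksum_dominant m D w : dominant w -> same_parity b m w ->
  walksum p A m D w =
  \sum_(t : m.-tuple col | walk_ok dominant D w t) A (w + total_weight t).
Proof.
elim: m D w => [|m IH] D w domw parw /=.
  rewrite (big_pred1 [tuple]) ?/total_weight ?big_nil ?addr0 // => t.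
  by rewrite [t]tuple0 /= eqxx.
rewrite big_walk_ok [RHS]big_mkcondr; apply: eq_bigr => C stepC.
have parC := same_parity_step C parw.
case: ifP => [domC|/negbT]; first by rewrite IH.
rewrite negb_and => /orP[|nl]; last exact: (A_last domw parw stepC nl).
case/forallPn => i /forallPn [i']; rewrite negb_imply -leNgt => /andP[/eqP ii' le].
have lt : w i' < w i.
  by case/andP: domw => /forallP/(_ i)/forallP/(_ i')/implyP H _; apply: H; apply/eqP.
have [z1 e1] := parw i; have [z2 e2] := parw i'.
have [iC i'C] : i \notin C /\ i' \in C.
  by move: le; rewrite !ffunE e1 e2; move: lt; rewrite e1 e2; case: (i \in C);
    case: (i' \in C) => /=; lia.
have eqw : signed_act (tperm i i') set0 (w + col_weight C) = w + col_weight C.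
  apply/ffunP => j; rewrite ffunE inE.
  have eqi : (w + col_weight C) i = (w + col_weight C) i'.
    by move: le lt; rewrite !ffunE e1 e2 i'C (negbTE iC); lia.
  by case: tpermP => [->|->|].
apply: R2; rewrite -{1}eqw walksum_adj ?addNr //; first exact: A_adj.
by rewrite /adj_stable (negbTE iC).
Qed.

End Straightening.

(** * Weyl group invariance and alternants *)

Section Invariance.
Variables (n : nat) (F : fieldType) (T : finType) (P : pred T).
Local Notation weight := {ffun 'I_n -> int}.
Variable wt : T -> weight.
Implicit Types (w : weight) (g h : weight -> weight) (s : 'S_n) (e : {set 'I_n}).

(** The multiset of the weights wt t, for t in P, is invariant under g. *)
Definition sums_invariant g : Prop :=
  forall f : weight -> F, \sum_(t | P t) f (g (wt t)) = \sum_(t | P t) f (wt t).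

Lemma invariant_ext g h : g =1 h -> sums_invariant g -> sums_invariant h.
Proof. by move=> gh H f; rewrite -H; apply: eq_bigr => t _; rewrite gh. Qed.

Lemma invariant_comp g h : sums_invariant g -> sums_invariant h -> sums_invariant (g \o h).
Proof. by move=> Hg Hh f; rewrite -(Hg f) -(Hh (f \o g)). Qed.

Lemma invariant_id : sums_invariant id.
Proof. by []. Qed.

Lemma signed_act_perm_comp s1 s2 w :
  signed_act s1 set0 (signed_act s2 set0 w) = signed_act (s1 * s2)%g set0 w.
Proof. by apply/ffunP => j; rewrite !ffunE !inE permM. Qed.

Lemma signed_act1 w : signed_act 1 set0 w = w.
Proof. by apply/ffunP => j; rewrite !ffunE !inE perm1. Qed.

Lemma signed_act_conj s e w :
  signed_act s set0 (signed_act 1 e (signed_act s^-1 set0 w)) = signed_act 1 (relabel s e) w.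
Proof. by apply/ffunP => j; rewrite !ffunE !inE !perm1 permK. Qed.

Lemma signed_act_split s e w : signed_act 1 e (signed_act s set0 w) = signed_act s e w.
Proof. by apply/ffunP => j; rewrite !ffunE !inE !perm1. Qed.

Lemma signed_act_sign_comp e1 e2 w : [disjoint e1 & e2] ->
  signed_act 1 e1 (signed_act 1 e2 w) = signed_act 1 (e1 :|: e2) w.
Proof.
move=> dis; apply/ffunP => j; rewrite !ffunE !inE !perm1.
by case: ifP => [/(disjointFr dis) ->|].
Qed.

Hypothesis invariant_adj : forall i i' : 'I_n, i' = i.+1 :> nat ->
  sums_invariant (signed_act (tperm i i') set0).

Lemma invariant_tperm i j : sums_invariant (signed_act (tperm i j) set0).
Proof.
suff H k (i' j' : 'I_n) : j' = (i' + k)%N :> nat ->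
  sums_invariant (signed_act (tperm i' j') set0).
  case: (leqP i j) => ij; first by apply: (H (j - i)%N); rewrite subnKC.
  by rewrite tpermC; apply: (H (i - j)%N); rewrite subnKC // ltnW.
elim: k i' j' => [|k IH] i' j' ej.
  have -> : j' = i' by apply: val_inj; rewrite /= ej addn0.
  by rewrite tperm1; apply: invariant_ext invariant_id => w; rewrite signed_act1.
have [k0|kpos] := posnP k; first by apply: invariant_adj; rewrite ej k0 addn1.
have ln : (i' + k < n)%N by have := ltn_ord j'; lia.
pose l := Ordinal ln.
have il : i' != l by rewrite -(inj_eq val_inj) /=; lia.
have ij : i' != j' by rewrite -(inj_eq val_inj) /=; lia.
have -> : tperm i' j' = (tperm l j' * (tperm i' l * tperm l j'))%g.
  rewrite -{1}[tperm l j']tpermV -conjgE tpermJ tpermL.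
  by rewrite tpermD // eq_sym.
have lj : sums_invariant (signed_act (tperm l j') set0) by apply: invariant_adj;
  rewrite /= ej addnS.
have il' : sums_invariant (signed_act (tperm i' l) set0) by apply: IH.
apply: invariant_ext (invariant_comp lj (invariant_comp il' lj)) => w /=.
by rewrite !signed_act_perm_comp !mulgA.
Qed.

Lemma invariant_perm s : sums_invariant (signed_act s set0).
Proof.
case: (prod_tpermP s) => ts -> _; elim: ts => [|[i j] ts IH].
  by rewrite big_nil; apply: invariant_ext invariant_id => w; rewrite signed_act1.
rewrite big_cons; apply: invariant_ext (invariant_comp (invariant_tperm i j) IH) => w /=.
by rewrite signed_act_perm_comp.
Qed.

Lemma invariant_relabel s e : sums_invariant (signed_act 1 e) ->
  sums_invariant (signed_act 1 (relabel s e)).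
Proof.
move=> He; have H1 := invariant_perm s; have H2 := invariant_perm s^-1.
by apply: invariant_ext (invariant_comp H1 (invariant_comp He H2)) => w /=;
  rewrite signed_act_conj.
Qed.

(** The permutations and one sign change generate the hyperoctahedral group. *)
Lemma invariant_signs l s e : sums_invariant (signed_act 1 [set l]) ->
  sums_invariant (signed_act s e).
Proof.
move=> Hl; suff H1 : sums_invariant (signed_act 1 e).
  by apply: invariant_ext (invariant_comp H1 (invariant_perm s)) => w /=;
    rewrite signed_act_split.
have H1 j : sums_invariant (signed_act 1 [set j]).
  have -> : [set j] = relabel (tperm j l) [set l]; last exact: invariant_relabel.
  by apply/setP => i; rewrite !inE (canF_eq (tpermK _ _)) tpermR.
move: {2}#|e| (leqnn #|e|) => k; elim: k e => [|k IH] e.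
  rewrite leqn0 cards_eq0 => /eqP->.
  by apply: invariant_ext invariant_id => w; rewrite signed_act1.
have [->|[j je] ek] := set_0Vmem e.
  by move=> _; apply: invariant_ext invariant_id => w; rewrite signed_act1.
have Hj : sums_invariant (signed_act 1 (e :\ j)).
  by apply: IH; rewrite (cardsD1 j) je in ek.
apply: invariant_ext (invariant_comp (H1 j) Hj) => w /=.
by rewrite signed_act_sign_comp ?setD1K // disjoints1 !inE eqxx.
Qed.

(** Conjugates of one double sign change generate all even sign changes. *)
Lemma invariant_even_signs a b s e : a != b -> ~~ odd #|e| ->
  sums_invariant (signed_act (tperm a b) [set a; b]) -> sums_invariant (signed_act s e).
Proof.
move=> ab ev Hab; suff H1 : sums_invariant (signed_act 1 e).
  by apply: invariant_ext (invariant_comp H1 (invariant_perm s)) => w /=;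
    rewrite signed_act_split.
have H0 : sums_invariant (signed_act 1 [set a; b]).
  apply: invariant_ext (invariant_comp Hab (invariant_tperm a b)) => w /=.
  apply/ffunP => j; rewrite !ffunE !inE perm1.
  by rewrite tpermK.
have H1 i j : i != j -> sums_invariant (signed_act 1 [set i; j]).
  move=> ij; pose u := (tperm i a * tperm (tperm i a j) b)%g.
  have ja : tperm i a j != a.
    by rewrite -[X in _ != X](tpermL i a) (inj_eq perm_inj) eq_sym.
  have ui : u i = a by rewrite permM tpermL tpermD // eq_sym.
  have uj : u j = b by rewrite permM tpermL.
  have -> : [set i; j] = relabel u [set a; b]; last exact: invariant_relabel.
  by apply/setP => k; rewrite !inE -{1}ui -uj !(inj_eq perm_inj).
move: {2}#|e| (leqnn #|e|) => k; elim: k e ev => [|k IH] e ev.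
  rewrite leqn0 cards_eq0 => /eqP->.
  by apply: invariant_ext invariant_id => w; rewrite signed_act1.
have [->|[i ie] ek] := set_0Vmem e.
  by move=> _; apply: invariant_ext invariant_id => w; rewrite signed_act1.
have [e0|[j je]] := set_0Vmem (e :\ i).
  by move: ev; rewrite (cardsD1 i) ie e0 cards0.
have ce : #|e| = #|e :\ i :\ j|.+2 by rewrite (cardsD1 i e) ie (cardsD1 j (e :\ i)) je.
have Hj : sums_invariant (signed_act 1 (e :\ i :\ j)).
  by apply: IH; [move: ev; rewrite ce /= negbK | move: ek; rewrite ce; lia].
have ij : i != j by move: je; rewrite !inE eq_sym => /andP[].
apply: invariant_ext (invariant_comp (H1 _ _ ij) Hj) => w /=.
rewrite signed_act_sign_comp; last first.
  by rewrite disjoint_subset; apply/subsetP => k'; rewrite !inE => /orP[]/eqP->;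
    rewrite eqxx ?andbF.
by rewrite -setUA !setD1K.
Qed.

Variable x : 'I_n -> F.
Hypothesis x0 : forall j, x j != 0.

Definition mon (w : weight) : F := \prod_j x j ^ w j.

(** The monomial of the image of w under a signed permutation.  It is indexed as the
terms of an expanded determinant are. *)
Definition signed_mon s e (w : weight) : F :=
  \prod_i (x (s i)) ^ (if i \in e then - w i else w i).

Lemma signed_monE s e w : signed_mon s e w = mon (signed_act s^-1 (relabel s^-1 e) w).
Proof.
rewrite /mon (reindex_inj (@perm_inj _ s)) /=; apply: eq_bigr => i _.
by rewrite !ffunE !inE !permK.
Qed.

Lemma signed_monD s e u v : signed_mon s e (u + v) = signed_mon s e u * signed_mon s e v.
Proof.
rewrite /signed_mon -big_split /=; apply: eq_bigr => i _.
by rewrite -expfzDr // !ffunE; case: ifP => _; rewrite // opprD.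
Qed.

Variable coef : {set 'I_n} -> F.

(** The weight [coef] on sign changes is (-1)^#|e| for the full hyperoctahedral
group, and 1 + (-1)^#|e| for its subgroup of even sign changes. *)
Definition alternant (w : weight) : F :=
  \sum_(s : 'S_n) \sum_(e : {set 'I_n}) (-1) ^+ s * coef e * signed_mon s e w.

(** Each term of the alternant is multiplicative in the weight, and its sum over the
tableaux does not depend on the signed permutation. *)
Lemma alternant_mul (w : weight) :
  (forall s e, coef e != 0 -> sums_invariant (signed_act s^-1 (relabel s^-1 e))) ->
  (\sum_(t | P t) mon (wt t)) * alternant w = \sum_(t | P t) alternant (w + wt t).
Proof.
move=> Hinv; rewrite /alternant mulr_sumr exchange_big /=; apply: eq_bigr => s _.
rewrite mulr_sumr exchange_big /=; apply: eq_bigr => e _.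
have [->|/(Hinv s) He] := eqVneq (coef e) 0.
  by rewrite mulr0 mul0r mulr0 big1 // => t _; rewrite mul0r.
rewrite -(He mon) mulr_suml; apply: eq_bigr => t _.
by rewrite -signed_monE signed_monD mulrCA [X in _ * X = _]mulrC.
Qed.

End Invariance.

Section Determinants.
Variables (n : nat) (F : fieldType) (x : 'I_n -> F).
Local Notation weight := {ffun 'I_n -> int}.

Definition det_alt (c : F) (w : weight) : F :=
  \det (\matrix_(i < n, j < n) (x j ^ w i + c * x j ^ (- w i))).

Lemma det_alt_alternant c w : det_alt c w = alternant x (fun e => c ^+ #|e|) w.
Proof.
rewrite /det_alt /determinant /alternant; apply: eq_bigr => s _.
under eq_bigr => i _ do rewrite !mxE addrC.
rewrite bigA_distr mulr_sumr; apply: eq_bigr => e _.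
rewrite -mulrA; congr (_ * _); rewrite /signed_mon -prodr_const [X in X * _]big_mkcond /=.
by rewrite -big_split /=; apply: eq_bigr => i _; case: ifP; rewrite ?mul1r.
Qed.

Lemma alternantD (f g : {set 'I_n} -> F) w :
  alternant x f w + alternant x g w = alternant x (fun e => f e + g e) w.
Proof.
rewrite /alternant -big_split /=; apply: eq_bigr => s _; rewrite -big_split /=.
by apply: eq_bigr => e _; rewrite -mulrDl -mulrDr.
Qed.

Lemma det_alt_swap c i j w : i != j ->
  det_alt c (signed_act (tperm i j) set0 w) = - det_alt c w.
Proof.
move=> ij; rewrite /det_alt.
set M := (X in _ = - \det X).
have -> : \matrix_(i0, j0) (x j0 ^ signed_act (tperm i j) set0 w i0
     + c * x j0 ^ (- signed_act (tperm i j) set0 w i0)) = row_perm (tperm i j) M.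
  by apply/matrixP => k l; rewrite !mxE !ffunE inE.
by rewrite row_permE det_mulmx det_perm odd_tperm ij expr1 mulN1r.
Qed.

Lemma det_alt_sign w l : det_alt (-1) (signed_act 1 [set l] w) = - det_alt (-1) w.
Proof.
rewrite -[RHS]mulN1r -[RHS]addr0 -[X in _ + X](mul0r (det_alt (-1) w)) /det_alt.
apply: (@determinant_multilinear _ _ _ _ _ l).
- by apply/matrixP => k j; rewrite !mxE !ffunE !inE eqxx perm1 opprK mul0r addr0 !mulN1r opprB.
- by apply/matrixP => k j; rewrite !mxE !ffunE !inE perm1 eq_sym (negbTE (neq_lift _ _)).
- by apply/matrixP => k j; rewrite !mxE !ffunE !inE perm1 eq_sym (negbTE (neq_lift _ _)).
Qed.

End Determinants.

(** * The character of a rectangle *)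

Section Products.
Variables (n : nat) (F : fieldType) (x : 'I_n -> F).
Hypothesis x0 : forall j, x j != 0.
Hypothesis F2 : (2 : F) != 0.
Local Notation weight := {ffun 'I_n -> int}.
Local Notation col := {set 'I_n}.
Implicit Types (w : weight) (C D : col) (b : int).

Lemma addrr_eq0 (y : F) : y + y = 0 -> y = 0.
Proof. by move/eqP; rewrite -mulr2n -mulr_natl mulf_eq0 (negbTE F2) => /eqP. Qed.

Lemma walk_ok_xpredT p D w t : walk_ok p xpredT D w t = walk_ok p xpredT D 0 t.
Proof. by elim: t D w => //= C t IH D w; rewrite IH [in RHS]IH. Qed.

(** The function f - f o s is antisymmetric, so its sum over the tableaux is
antisymmetric as well; at the weight 0 it vanishes. *)
Lemma walksum_invariant p d D s (e : {set 'I_n}) :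
  involutive (@signed_act n s e) ->
  (forall A : weight -> F, (forall w, A (signed_act s e w) = - A w) ->
     forall w, walksum p A d D (signed_act s e w) = - walksum p A d D w) ->
  sums_invariant F (fun t : d.-tuple col =>
    walk_ok p xpredT D 0 t) (@total_weight n) (signed_act s e).
Proof.
move=> sK H f.
have s0 : signed_act s e 0 = 0 by apply/ffunP => j; rewrite !ffunE oppr0 if_same.
pose g w := f w - f (signed_act s e w).
have g_anti w : g (signed_act s e w) = - g w by rewrite /g sK opprB.
have /eqP : walksum p g d D 0 = 0.
  by apply: addrr_eq0; rewrite -{1}s0 (H g g_anti) addNr.
rewrite walksum_tuple sumrB subr_eq0 eq_sym => /eqP.
under eq_bigr => t _ do rewrite add0r.
by under [in RHS]eq_bigr => t _ do rewrite add0r.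
Qed.

Section Uniform.
Variables (p : nat -> nat -> nat -> bool) (D0 : col) (d : nat).
Variables (lastgood : pred weight) (A : weight -> F) (coef : {set 'I_n} -> F).

Definition walk_poly : F :=
  \sum_(t : d.-tuple col | walk_ok p xpredT D0 0 t) mon x (total_weight t).

Lemma walk_poly_mul w :
  (forall w, A w = alternant x coef w) ->
  (forall s e, coef e != 0 -> sums_invariant F (fun t : d.-tuple col => walk_ok p xpredT D0 0 t)
     (@total_weight n) (signed_act s^-1 (relabel s^-1 e))) ->
  walk_poly * A w = walksum p A d D0 w.
Proof.
move=> HA Hinv; rewrite walksum_tuple HA alternant_mul //.
by apply: eq_big => [t|t _]; rewrite ?HA // walk_ok_xpredT.
Qed.

Lemma col_le_setT C : col_le C setT -> C = setT.
Proof.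
move/col_leP => /(_ n (leqnn n)); rewrite !nbelowT => h.
by apply/eqP; rewrite eqEcard subsetT.
Qed.

(** Once a column is full, so are all the columns to its left. *)
Lemma walk_ok_rect w0 t :
  (forall m C, step_ok p m D0 C -> dominant lastgood (w0 + col_weight C) -> C = setT) ->
  ((0 < size t)%N -> step_ok p (size t).-1 D0 setT) ->
  (forall m, step_ok p m [set: 'I_n] setT) ->
  (forall k, dominant lastgood (w0 + col_weight setT *+ k.+1)) ->
  walk_ok p (dominant lastgood) D0 w0 t = (t == nseq (size t) setT).
Proof.
move=> h1 h0 h2 h3.
have okT k u : walk_ok p (dominant lastgood) setT (w0 + col_weight setT *+ k) u =
  (u == nseq (size u) setT).
  elim: u k => //= C u IH k; apply/and3P/eqP => [[/andP[/col_le_setT -> _] _]|[-> e]].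
    by rewrite -addrA -mulrSr IH => /eqP {1}->.
  by rewrite -addrA -mulrSr h3 IH -e eqxx; split=> //.
case: t h0 => //= C t h0; apply/and3P/eqP => [[s1 s2]|[-> e]].
  by rewrite (h1 _ _ s1 s2) -[col_weight setT]mulr1n okT => /eqP {1}->.
by rewrite -[col_weight setT]mulr1n okT -e eqxx; split=> //; apply: h0.
Qed.

Lemma total_rect k : total_weight (nseq k [set: 'I_n]) = col_weight setT *+ k.
Proof. by rewrite /total_weight big_nseq -Monoid.iteropE. Qed.

End Uniform.

End Products.

Section Staircase.
Variable n : nat.
Implicit Types C : {set 'I_n}.

Lemma col_weightT : col_weight [set: 'I_n] = [ffun=> 1].
Proof. by apply/ffunP => j; rewrite !ffunE inE. Qed.

Lemma col_weightT_mul k j : (col_weight [set: 'I_n] *+ k) j = k%:Z.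
Proof. by rewrite ffunMnE col_weightT ffunE -mulr_natr mul1r natz. Qed.

Lemma staircase_full (q : int) C :
  decreasing ([ffun i : 'I_n => 2 * (n - i)%N%:Z + q] + col_weight C) ->
  forall i j : 'I_n, (i <= j)%N -> j \in C -> i \in C.
Proof.
move=> /forallP H i j ij; have [k ek] : exists k, j = (i + k)%N :> nat.
  by exists (j - i)%N; rewrite subnKC.
elim: k j ek {ij} => [|k IH] j ej jC.
  by have <- : j = i by apply: val_inj; rewrite /= ej addn0.
have jn := ltn_ord j; have ln : (i + k < n)%N by lia.
apply: (IH (Ordinal ln)) => //.
have /forallP/(_ j)/implyP := H (Ordinal ln); rewrite /= !ffunE /= jC ej addnS => /(_ (eqxx _)).
by case: (_ \in C) => // h; lia.
Qed.

Lemma decreasing_staircase (q : int) k :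
  decreasing ([ffun i : 'I_n => 2 * (n - i)%N%:Z + q] + col_weight setT *+ k).
Proof.
apply/forallP => i; apply/forallP => j; apply/implyP => /eqP ij.
rewrite !ffunE -![(col_weight setT *+ k) _]/(_) !col_weightT_mul ij.
have := ltn_ord j; lia.
Qed.

End Staircase.

Section EvenTop.
Variables (n : nat) (a b : 'I_n).
Hypotheses (ab : b = a.+1 :> nat) (bn : b.+1 = n).
Local Notation col := {set 'I_n}.
Implicit Types C : col.

(** The column to the right of the whole tableau: every column whose length has the
parity of n can stand to the left of it.  For the other two families the empty
column plays this part. *)
Definition even_top : col := if odd n then [set b] else set0.

Lemma pair_stable_top : pair_stable a b even_top.
Proof.
rewrite /pair_stable /even_top; case: ifP => _; rewrite !inE //.
by rewrite neq_pair.
Qed.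

Lemma adj_stable_top (i i' : 'I_n) : i' = i.+1 :> nat -> adj_stable i i' even_top.
Proof.
move=> ii'; rewrite /adj_stable /even_top; case: ifP => _; rewrite !inE //.
by apply/implyP => /eqP ib; have := ltn_ord i'; rewrite ii' ib bn ltnn.
Qed.

Lemma odd_top : odd #|even_top| = odd n.
Proof. by rewrite /even_top; case: ifP; rewrite ?cards1 ?cards0. Qed.

Lemma col_le_even_top C : odd #|C| = odd n -> col_le C even_top.
Proof.
move=> oC; apply/col_leP => v vn; rewrite /even_top; move: oC; case: (odd n) => oC; last first.
  by rewrite /nbelow (_ : [set _ in _ | _] = set0) ?cards0 //; apply/setP => i; rewrite !inE.
have [->|vn'] := eqVneq v n; first by rewrite !nbelowT cards1; case: #|C| oC.
rewrite /nbelow (_ : [set _ in _ | _] = set0) ?cards0 //; apply/setP => i; rewrite !inE.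
by apply/negP => /andP[/eqP->]; lia.
Qed.

End EvenTop.

Section Types.
Variables (n : nat) (F : fieldType) (x : 'I_n -> F).
Hypothesis x0 : forall j, x j != 0.
Hypothesis F2 : (2 : F) != 0.
Local Notation weight := {ffun 'I_n -> int}.
Local Notation col := {set 'I_n}.
Implicit Types (w : weight) (C D : col) (b : int).

Let R2 := addrr_eq0 F2.

(** The sum of the positive roots, for q = -1, 0 and -2 in the cases so_(2n+1), sp_2n
and so_2n. *)
Definition staircase (q : int) : weight := [ffun i : 'I_n => 2 * (n - i)%N%:Z + q].

Lemma sums_invariant_adj p d D : 
  (forall i i' : 'I_n, i' = i.+1 :> nat -> adj_stable i i' D) ->
  forall i i' : 'I_n, i' = i.+1 :> nat ->
  sums_invariant F (fun t : d.-tuple col => walk_ok p xpredT D 0 t)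
    (@total_weight n) (signed_act (tperm i i') set0).
Proof.
move=> st i i' ii'; apply: walksum_invariant => //; first exact: signed_act_adjK.
by move=> A Aanti w; apply: walksum_adj => //; apply: st.
Qed.

Lemma adj_stable0 (i i' : 'I_n) : adj_stable i i' set0.
Proof. by rewrite /adj_stable inE. Qed.

Lemma neq_succ (i i' : 'I_n) : i' = i.+1 :> nat -> i != i'.
Proof. by move=> e; rewrite -(inj_eq val_inj) /= e; lia. Qed.

Lemma vanish_on_wall (s : 'S_n) (e : {set 'I_n}) (f : weight -> F) w :
  (forall w, f (signed_act s e w) = - f w) -> signed_act s e w = w -> f w = 0.
Proof. by move=> H E; apply: R2; rewrite -{1}E H addNr. Qed.

Section LastCoordinate.
Variable l : 'I_n.
Hypothesis ln : l.+1 = n.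

Lemma signed_act_sign_fix w : w l = 0 -> signed_act 1 [set l] w = w.
Proof.
move=> wl; apply/ffunP => j; rewrite !ffunE !inE perm1.
by case: eqP => // ->; rewrite wl oppr0.
Qed.

Definition no_size (m u v : nat) := true.

Lemma short_walks d : exists Q : F,
  (forall b w, dominant (fun w => 0 < w l) w -> same_parity b d w ->
     Q * det_alt x (-1) w =
     \sum_(t : d.-tuple col | walk_ok no_size (dominant (fun w => 0 < w l)) set0 w t)
        det_alt x (-1) (w + total_weight t)) /\
  Q * det_alt x (-1) (staircase (-1)) =
    det_alt x (-1) (staircase (-1) + col_weight setT *+ d).
Proof.
pose lg w := 0 < w l; pose A := det_alt x (-1).
have Aanti w : A (signed_act 1 [set l] w) = - A w by exact: det_alt_sign.
have st0 : l \notin (set0 : col) by rewrite inE.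
have inv := @sums_invariant_adj no_size d set0 (fun i i' _ => adj_stable0 i i').
have invl : sums_invariant F (fun t : d.-tuple col => walk_ok no_size xpredT set0 0 t)
    (@total_weight n) (signed_act 1 [set l]).
  apply: walksum_invariant => //; first exact: signed_act_signK.
  by move=> B Banti w; apply: walksum_short.
exists (walk_poly x no_size set0 d).
have HQ b w : dominant lg w -> same_parity b d w -> walk_poly x no_size set0 d * A w =
     \sum_(t : d.-tuple col | walk_ok no_size (dominant lg) set0 w t) A (w + total_weight t).
  move=> dw pw; rewrite (@walk_poly_mul _ _ _ x0 _ _ _ A (fun e => (-1) ^+ #|e|)); first last.
  - by move=> s e _; apply: (invariant_signs inv _ _ invl).
  - by move=> u; rewrite -det_alt_alternant.
  apply: (walksum_dominant R2 _ _ _ dw pw) => [i i' ii' u|m D C u /andP[_ du] pu _ nl].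
    exact/det_alt_swap/neq_succ.
  have [z ez] := pu l.
  have lC : l \notin C.
    by apply: contra nl => lC; move: du; rewrite /lg /= !ffunE lC /=; lia.
  apply: (@vanish_on_wall 1 [set l] (walksum no_size A m C)).
    by move=> u'; apply: walksum_short.
  apply: signed_act_sign_fix; move: nl du; rewrite /lg /= !ffunE (negbTE lC) /=; lia.
split=> //.
have dom0 k : dominant lg (staircase (-1) + col_weight setT *+ k).
  apply/andP; split; first exact: decreasing_staircase.
  rewrite /lg !ffunE -![(col_weight setT *+ k) _]/(_) !col_weightT_mul; have := ltn_ord l; lia.
have dom00 := dom0 0; rewrite mulr0n addr0 in dom00.
rewrite (HQ (- 1 - d%:Z) _ dom00).
  rewrite (big_pred1 [tuple of nseq d setT]).
    by rewrite /= total_rect.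
  move=> t; rewrite (@walk_ok_rect _ no_size _ lg) ?size_tuple //.
  - move=> m C _ /andP[dC lC]; apply/setP => i; rewrite inE.
    apply: (@staircase_full n (-1) C dC i l); first by rewrite -ltnS ln.
    by move: lC; rewrite /lg !ffunE; case: (l \in C) => //; lia.
  - by move=> _; rewrite /step_ok andbT; apply/col_leP => v vn;
    rewrite nbelow_setT // nbelow_le.
  - by move=> m; rewrite /step_ok andbT; apply/col_leP => v vn;
    rewrite nbelow_setT // nbelow_le.
move=> i; exists (n - i)%N%:Z; rewrite ffunE; lia.
Qed.

Lemma long_walks c : let d := c.*2 in exists Q : F,
  (forall w, dominant (fun w => 1 < w l) w -> same_parity 0 d w ->
     Q * det_alt x (-1) w =
     \sum_(t : d.-tuple col | walk_ok pair_size (dominant (fun w => 1 < w l)) set0 w t)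
        det_alt x (-1) (w + total_weight t)) /\
  Q * det_alt x (-1) (staircase 0) =
    det_alt x (-1) (staircase 0 + col_weight setT *+ d).
Proof.
move=> d; pose lg w := 1 < w l; pose A := det_alt x (-1).
have Aanti w : A (signed_act 1 [set l] w) = - A w by exact: det_alt_sign.
have st0 : l \notin (set0 : col) by rewrite inE.
have inv := @sums_invariant_adj pair_size d set0 (fun i i' _ => adj_stable0 i i').
have invl : sums_invariant F (fun t : d.-tuple col => walk_ok pair_size xpredT set0 0 t)
    (@total_weight n) (signed_act 1 [set l]).
  apply: walksum_invariant => //; first exact: signed_act_signK.
  by move=> B Banti w; apply: walksum_long.
exists (walk_poly x pair_size set0 d).
have HQ w : dominant lg w -> same_parity 0 d w -> walk_poly x pair_size set0 d * A w =
     \sum_(t : d.-tuple col | walk_ok pair_size (dominant lg) set0 w t) A (w + total_weight t).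
  move=> dw pw; rewrite (@walk_poly_mul _ _ _ x0 _ _ _ A (fun e => (-1) ^+ #|e|)); first last.
  - by move=> s e _; apply: (invariant_signs inv _ _ invl).
  - by move=> u; rewrite -det_alt_alternant.
  apply: (walksum_dominant R2 _ _ _ dw pw) => [i i' ii' u|m D C u /andP[_ du] pu _ nl].
    exact/det_alt_swap/neq_succ.
  have [z ez] := pu l.
  have lC : l \notin C.
    by apply: contra nl => lC; move: du; rewrite /lg /= !ffunE lC /=; lia.
  (* The parity of the coordinate shows that the walk leaves the chamber in the
     middle of a pair of columns; the second column of the pair has the same
     length, so it brings the walk onto the wall. *)
  have [m' em] : exists m', m = m'.*2.+1.
    exists m./2; have := odd_double_half m; case: (odd m) => //= em.
    by exfalso; move: nl du; rewrite /lg /= !ffunE (negbTE lC) /=; lia.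
  rewrite em /=; apply: big1 => X /andP[/col_leP XC].
  rewrite /pair_size odd_double /= => /eqP sz.
  have lX : l \notin X.
    have := XC l (ltnW (ltn_ord l)); move: sz; rewrite !(card_last ln) (negbTE lC).
    by case: (l \in X) => //=; lia.
  apply: (@vanish_on_wall 1 [set l] (walksum pair_size A m'.*2 X)).
    by move=> u'; apply: walksum_long.
  apply: signed_act_sign_fix; move: nl du; rewrite /lg /= !ffunE (negbTE lC) (negbTE lX) /=;
    lia.
split=> //.
have dom0 k : dominant lg (staircase 0 + col_weight setT *+ k).
  apply/andP; split; first exact: decreasing_staircase.
  rewrite /lg !ffunE -![(col_weight setT *+ k) _]/(_) !col_weightT_mul; have := ltn_ord l; lia.
have dom00 := dom0 0; rewrite mulr0n addr0 in dom00.
rewrite (HQ _ dom00).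
  rewrite (big_pred1 [tuple of nseq d setT]).
    by rewrite /= total_rect.
  move=> t; rewrite (@walk_ok_rect _ pair_size _ lg) ?size_tuple //.
  - move=> m C _ /andP[dC lC]; apply/setP => i; rewrite inE.
    apply: (@staircase_full n 0 C dC i l); first by rewrite -ltnS ln.
    by move: lC; rewrite /lg !ffunE; case: (l \in C) => //; lia.
  - move=> dpos; rewrite /step_ok /pair_size; apply/andP; split.
      by apply/col_leP => v vn; rewrite nbelow_setT // nbelow_le.
    have c0 : (0 < c)%N by rewrite -double_gt0.
    by rewrite /d -(prednK c0) doubleS /= odd_double.
  - move=> m; rewrite /step_ok /pair_size eqxx orbT andbT; apply/col_leP => v vn.
    by rewrite nbelow_setT.
move=> i; exists ((n - i)%N%:Z - c%:Z); rewrite ffunE /d; lia.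
Qed.

End LastCoordinate.

Section LastTwo.
Variables a b : 'I_n.
Hypotheses (ab : b = a.+1 :> nat) (bn : b.+1 = n).

(** The numerator of the characters of so_2n. *)
Definition even_alt (w : weight) : F := det_alt x 1 w + det_alt x (-1) w.

Lemma signed_act_pairE w :
  signed_act (tperm a b) [set a; b] w
  = signed_act (tperm a b) set0 (signed_act 1 [set a] (signed_act 1 [set b] w)).
Proof.
have nab := neq_pair ab; have nba : (b == a) = false by rewrite eq_sym nab.
apply/ffunP => j; rewrite !ffunE !inE !perm1.
by case: tpermP => [->|->|/eqP/negbTE-> /eqP/negbTE->//];
  rewrite !eqxx ?orbT ?nab ?nba ?opprK.
Qed.

Lemma det_alt_plus_sign w i : det_alt x 1 (signed_act 1 [set i] w) = det_alt x 1 w.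
Proof.
congr (\det _); apply/matrixP => k j; rewrite !mxE !ffunE !inE perm1.
by case: ifP => // _; rewrite opprK !mul1r addrC.
Qed.

Lemma even_alt_anti w : even_alt (signed_act (tperm a b) [set a; b] w) = - even_alt w.
Proof.
have nab : a != b by rewrite neq_pair.
rewrite /even_alt !signed_act_pairE !det_alt_swap // !det_alt_plus_sign !det_alt_sign.
by rewrite opprK opprD.
Qed.

Lemma signed_act_pair_fix w : w a + w b = 0 -> signed_act (tperm a b) [set a; b] w = w.
Proof.
move=> wab; apply/ffunP => j; rewrite !ffunE !inE.
have nab := neq_pair ab.
have ea : w a = - w b by lia.
by case: tpermP => [->|->|/eqP/negbTE-> /eqP/negbTE->//];
  rewrite eqxx ?orbT /= ea ?opprK.
Qed.

Lemma even_walks d : exists Q : F,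
  (forall p w, dominant (fun w => 0 < w a + w b) w -> same_parity p d w ->
     Q * even_alt w =
     \sum_(t : d.-tuple col |
          walk_ok even_size (dominant (fun w => 0 < w a + w b)) (even_top b) w t)
        even_alt (w + total_weight t)) /\
  Q * even_alt (staircase (-2)) =
    even_alt (staircase (-2) + col_weight setT *+ d).
Proof.
pose lg w := 0 < w a + w b.
have nab : a != b by rewrite neq_pair.
have inv := @sums_invariant_adj even_size d (even_top b) (adj_stable_top bn).
have invl : sums_invariant F (fun t : d.-tuple col => walk_ok even_size xpredT (even_top b) 0 t)
    (@total_weight n) (signed_act (tperm a b) [set a; b]).
  apply: walksum_invariant => //; first exact: signed_act_pairK.
  by move=> B Banti w; apply: walksum_even => //; apply: (pair_stable_top ab).
exists (walk_poly x even_size (even_top b) d).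
have HQ p w : dominant lg w -> same_parity p d w ->
     walk_poly x even_size (even_top b) d * even_alt w =
     \sum_(t : d.-tuple col | walk_ok even_size (dominant lg) (even_top b) w t)
        even_alt (w + total_weight t).
  move=> dw pw.
  rewrite (@walk_poly_mul _ _ _ x0 _ _ _ even_alt (fun e => 1 ^+ #|e| + (-1) ^+ #|e|));
    first last.
  - move=> s e ce; apply: (invariant_even_signs inv _ nab _ invl).
    rewrite card_relabel; apply: contra ce => oe.
    by rewrite expr1n -signr_odd oe expr1 subrr.
  - by move=> u; rewrite /even_alt !det_alt_alternant alternantD.
  apply: (walksum_dominant R2 _ _ _ dw pw) => [i i' ii' u|m D C u /andP[_ du] pu _ nl].
    by rewrite /even_alt !det_alt_swap ?opprD //; exact: neq_succ.
  have [z ez] := pu a; have [z' ez'] := pu b.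
  have /andP[aC bC] : (a \notin C) && (b \notin C).
    move: nl du; rewrite /lg /= !ffunE ez ez'.
    by case: (a \in C); case: (b \in C) => //=; lia.
  apply: (@vanish_on_wall _ _ (walksum even_size even_alt m C)).
    move=> u'; apply: (walksum_even R2 ab bn) even_alt_anti _.
    by rewrite /pair_stable aC.
  apply: signed_act_pair_fix; move: nl du.
  by rewrite /lg /= !ffunE (negbTE aC) (negbTE bC) ez ez' /=; lia.
split=> //.
have dom0 k : dominant lg (staircase (-2) + col_weight setT *+ k).
  apply/andP; split; first exact: decreasing_staircase.
  rewrite /lg !ffunE -![(col_weight setT *+ k) _]/(_) !col_weightT_mul; have := ltn_ord a; lia.
have dom00 := dom0 0; rewrite mulr0n addr0 in dom00.
rewrite (HQ (- d%:Z) _ dom00).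
  rewrite (big_pred1 [tuple of nseq d setT]).
    by rewrite /= total_rect.
  move=> t; rewrite (@walk_ok_rect _ even_size _ lg) ?size_tuple //.
  - move=> m C /andP[_]; rewrite /even_size odd_top => /eqP oC /andP[dC lC].
    have full := @staircase_full n (-2) C dC.
    have aC : a \in C.
      have [bC|bC] := boolP (b \in C); first by apply: (full _ b); rewrite ?ab.
      by move: lC; rewrite /lg !ffunE (negbTE bC); case: (a \in C) => //; lia.
    have ra : nbelow C a = a.
      have : forall v, (v <= a)%N -> nbelow C v = v; last by apply.
      elim=> [|v IH] va; first by rewrite nbelow0.
      have vn : (v < n)%N by have := ltn_ord a; lia.
      rewrite (nbelowS C (Ordinal vn)) /= IH ?(ltnW va) // (full (Ordinal vn) a) ?addn1 //.
      exact: ltnW.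
    have bC : b \in C.
      move: oC; rewrite (card_lastb ab bn) ra aC -[in RHS]bn ab.
      by case: (b \in C) => //=; rewrite addn1 addn0 /=; case: (odd a).
    apply/setP => i; rewrite inE; apply: (full i b) => //.
    by rewrite -ltnS bn.
  - move=> _; rewrite /step_ok /even_size odd_top cardsT card_ord eqxx andbT.
    by apply: (col_le_even_top ab bn); rewrite cardsT card_ord.
  - by move=> m; rewrite /step_ok /even_size eqxx andbT; apply/col_leP => v vn.
move=> i; exists ((n - i)%N%:Z - 1); rewrite ffunE; lia.
Qed.

End LastTwo.
End Types.

(** * From fillings to walks *)

Section Ranks.
Variable n : nat.
Implicit Types (C D : {set 'I_n}).

Lemma nbelow_lt C (i j : 'I_n) : i \in C -> (i < j)%N -> (nbelow C i < nbelow C j)%N.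
Proof. by move=> iC ij; apply: leq_trans (nbelow_leq C ij); rewrite nbelowS iC addn1. Qed.

Lemma nbelow_inj C : {in C &, injective (fun i : 'I_n => nbelow C i)}.
Proof.
move=> i j iC jC /= e; apply: val_inj; have [lt|lt|//] := ltngtP i j.
  by have := nbelow_lt iC lt; rewrite e ltnn.
by have := nbelow_lt jC lt; rewrite e ltnn.
Qed.

Lemma nbelow_onto C v e : (v <= n)%N -> (e < nbelow C v)%N ->
  exists2 i : 'I_n, i \in C & (i < v)%N && (nbelow C i == e).
Proof.
elim: v => [|v IH] vn; first by rewrite nbelow0.
rewrite (nbelowS C (Ordinal vn)); case: (boolP (_ \in C)) => [vC|_]; last first.
  rewrite addn0 => /(IH (ltnW vn)) [i iC /andP[iv ie]]; exists i => //.
  by rewrite ie ltnS ltnW.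
rewrite addn1 ltnS leq_eqVlt => /orP[/eqP->|/(IH (ltnW vn)) [i iC /andP[iv ie]]].
  by exists (Ordinal vn); rewrite //= ltnSn eqxx.
by exists i => //; rewrite ie ltnS ltnW.
Qed.
End Ranks.

Lemma adjacent_antitone n (f : 'I_n -> int) :
  (forall i i' : 'I_n, i' = i.+1 :> nat -> f i' <= f i) ->
  forall i j : 'I_n, (i <= j)%N -> f j <= f i.
Proof.
move=> H i j ij; have [k ek] : exists k, j = (i + k)%N :> nat.
  by exists (j - i)%N; rewrite subnKC.
elim: k j ek {ij} => [|k IH] j ek.
  by have -> : j = i by apply: (@ord_inj n); rewrite ek addn0.
have kn : (i + k < n)%N by have := ltn_ord j; lia.
by apply: le_trans (IH (Ordinal kn) erefl); apply: H => //=; rewrite ek addnS.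
Qed.

Section Fillings.
Variables (n d : nat) (la rho : indexseq n) (b : rat) (lz : 'I_n -> int).
Local Notation len i := (Num.truncn (rho i - la i)).
Hypothesis la_lz : forall i, la i = b + (lz i)%:~R.
Hypothesis lz_dec : forall i j : 'I_n, (i < j)%N -> lz j <= lz i.
Hypothesis rz_dec : forall i j : 'I_n, (i < j)%N -> lz j + (len j)%:Z <= lz i + (len i)%:Z.
Local Notation col := {set 'I_n}.
Local Notation cell := (cell la rho).
Implicit Types (F : filling la rho) (x y z : cell) (i j e : 'I_n) (t : seq col).

Definition pos x : nat := tagged x.
(** The columns of the cells differ from integers by the constant b. *)
Definition icol x : int := lz (row_of x) + (pos x)%:Z + 1.

Lemma pos_lt x : (pos x < len (row_of x))%N.
Proof. exact: ltn_ord. Qed.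

Definition mkcell i p (pi : (p < len i)%N) : cell :=
  Tagged (fun i => 'I_(len i)) (Ordinal pi).

Lemma cell_eq x y : row_of x = row_of y -> pos x = pos y -> x = y.
Proof.
case: x y => i p [j q]; rewrite /row_of /pos /= => ij; case: _ / ij q => q pq.
by congr existT; apply: val_inj.
Qed.

Lemma col_ofE x : col_of x = b + (icol x)%:~R.
Proof.
case: x => i p; rewrite /col_of /icol /pos /row_of /=; move: (nat_of_ord p) => q.
by rewrite la_lz -addn1 natrD !intrD -!addrA !pmulrn.
Qed.

Lemma col_of_lt x y : (col_of x < col_of y) = (icol x < icol y).
Proof. by rewrite !col_ofE ltrD2l ltr_int. Qed.

Lemma col_of_eq x y : (col_of x == col_of y) = (icol x == icol y).
Proof. by rewrite !col_ofE (inj_eq (addrI b)) eqr_int. Qed.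

Definition copies F x : nat := copies_to_right F x.

Lemma copiesE F x : copies F x = #|[set y | (F y == F x) && (icol x < icol y)]|.
Proof. by apply: eq_card => y; rewrite !inE col_of_lt. Qed.

Definition entries_above F e (v : nat) : nat := #|[set y | (F y == e) && (row_of y < v)%N]|.

(** The lattice condition, tested only at the points of the reading word where it is
tightest: when row v has been read up to and including its entries e', but not
yet its entries e. *)
Definition ballot F : Prop :=
  forall v e e' : 'I_n, (e < e')%N -> (entries_above F e' v.+1 <= entries_above F e v)%N.

Definition row_weak F : Prop :=
  forall x y, row_of x = row_of y -> (pos x < pos y)%N -> (F x <= F y)%N.

Definition col_strict F : Prop :=
  forall x y, (row_of x < row_of y)%N -> icol x = icol y -> (F x < F y)%N.

Lemma semistandardP F : semistandard F <-> row_weak F /\ col_strict F.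
Proof.
split=> [/andP[/forallP H1 /forallP H2]|[H1 H2]].
  split=> x y h1 h2.
    have /forallP/(_ y)/implyP := H1 x; apply; rewrite h1 eqxx col_of_lt /icol h1 /=; lia.
  by have /forallP/(_ y)/implyP := H2 x; apply; rewrite h1 col_of_eq h2 eqxx.
apply/andP; split; apply/forallP => x; apply/forallP => y; apply/implyP => /andP[].
  rewrite col_of_lt => /eqP h1 h2; apply: H1 => //.
  by move: h2; rewrite /icol h1; lia.
by rewrite col_of_eq => h1 /eqP; apply: H2.
Qed.

Section FromFilling.
Variable F : filling la rho.
Hypotheses (Frow : row_weak F) (Fcol : col_strict F).

(** Otherwise the cell in the row of x and in the column of y would belong to the
skew diagram, with an entry that is both at least F x and less than F y. *)
Lemma row_antitone x y : F x = F y -> icol x < icol y -> (row_of y <= row_of x)%N.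
Proof.
move=> Fxy xy; rewrite leqNgt; apply/negP => rxy.
have := lz_dec rxy; have := rz_dec rxy; have py := pos_lt y; have px := pos_lt x.
move=> h1 h2; have [q eq] : exists q : nat, lz (row_of x) + q%:Z + 1 = icol y.
  by exists (absz (icol y - lz (row_of x) - 1)%R); move: xy; rewrite /icol; lia.
have qlt : (q < len (row_of x))%N by move: eq; rewrite /icol; lia.
pose z := mkcell qlt.
have xz : (F x <= F z)%N.
  by apply: Frow => //; change (pos x < q)%N; move: xy eq; rewrite /icol; lia.
have zy : (F z < F y)%N by apply: Fcol.
by move: xz; rewrite Fxy leqNgt zy.
Qed.

Lemma same_col x y : F x = F y -> icol x = icol y -> x = y.
Proof.
move=> Fxy xy; have [lt|lt|e] := ltngtP (row_of x) (row_of y).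
- by have := Fcol lt xy; rewrite Fxy ltnn.
- by have := Fcol lt (esym xy); rewrite Fxy ltnn.
- have e' : row_of x = row_of y by apply: val_inj.
  by apply: cell_eq => //; move: xy; rewrite /icol e'; lia.
Qed.

Lemma copies_lt_icol x y : F x = F y -> (copies F y < copies F x)%N = (icol x < icol y).
Proof.
move=> Fxy.
have H x' y' : F x' = F y' -> icol x' < icol y' -> (copies F y' < copies F x')%N.
  move=> e lt; rewrite !copiesE; apply: proper_card; apply/properP; split.
    by apply/subsetP => z; rewrite !inE -e => /andP[-> /(lt_trans lt)].
  by exists y'; rewrite !inE ?e ?eqxx // ltxx andbF.
have [lt|lt|e] := ltgtP (icol x) (icol y); first exact: H.
  by apply/negbTE; rewrite -leqNgt ltnW // H.
by rewrite (same_col Fxy e) ltnn.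
Qed.

Lemma copies_inj x y : F x = F y -> copies F x = copies F y -> x = y.
Proof.
move=> Fxy cxy; apply: same_col => //; apply/eqP; rewrite eq_le !leNgt.
by rewrite -(copies_lt_icol Fxy) -(copies_lt_icol (esym Fxy)) cxy ltnn.
Qed.

(** Equal entries move upwards from left to right, so the entries above a given row
are the rightmost ones. *)
Lemma copies_lt_entries x v : (copies F x < entries_above F (F x) v)%N = (row_of x < v)%N.
Proof.
rewrite copiesE; case: (ltnP (row_of x) v) => xv.
  apply: proper_card; apply/properP; split; last by exists x; rewrite !inE ?eqxx ?xv // ltxx.
  apply/subsetP => y; rewrite !inE => /andP[/eqP e lt]; rewrite e eqxx /=.
  by apply: leq_ltn_trans xv; apply: row_antitone.
apply/negbTE; rewrite -leqNgt; apply/subset_leq_card/subsetP => y.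
rewrite !inE => /andP[/eqP e yv]; rewrite e eqxx /= ltNge; apply/negP => le.
have yx : (row_of y < row_of x)%N by apply: leq_trans xv.
move: le; rewrite le_eqVlt => /orP[/eqP ec|lt].
  by have := Fcol yx ec; rewrite e ltnn.
by have := row_antitone e lt; rewrite leqNgt yx.
Qed.

Lemma entries_above_n e : entries_above F e n = #|[set y | F y == e]|.
Proof. by apply: eq_card => y; rewrite !inE ltn_ord andbT. Qed.

Lemma copies_onto e k : (k < entries_above F e n)%N -> exists2 x, F x = e & copies F x = k.
Proof.
move=> kN; pose S := [set y | F y == e].
have SN : #|S| = entries_above F e n by rewrite entries_above_n.
have cpS (x : cell) : x \in S -> (copies F x < #|S|)%N.
  by rewrite inE SN => /eqP <-; rewrite copies_lt_entries.
pose f x : 'I_(#|S|.+1) := inord (copies F x).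
have fE x : x \in S -> f x = copies F x :> nat by move=> xS; rewrite inordK // ltnW // ltnS cpS.
have finj : {in S &, injective f}.
  move=> x y xS yS /(congr1 val) /=; rewrite !fE //.
  move: xS yS; rewrite !inE => /eqP xe /eqP ye; apply: copies_inj; by rewrite xe ye.
have sub : f @: S \subset [set i : 'I_(#|S|.+1) | (i < #|S|)%N].
  by apply/subsetP => _ /imsetP[x xS ->]; rewrite inE fE // cpS.
have ceq : #|[set i : 'I_(#|S|.+1) | (i < #|S|)%N]| = #|S|.
  apply: etrans (@nbelow_setT (#|S|.+1) #|S| (leqnSn _)).
  by apply: eq_card => i; rewrite !inE.
have eqS : f @: S = [set i : 'I_(#|S|.+1) | (i < #|S|)%N].
  by apply/eqP; rewrite eqEcard sub ceq (card_in_imset finj) leqnn.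
have : inord k \in f @: S by rewrite eqS inE inordK SN // ltnS ltnW.
case/imsetP => x xS /(congr1 val) /=; rewrite fE // inordK; last by rewrite ltnS SN ltnW.
by move=> kx; exists x => //; move: xS; rewrite inE => /eqP.
Qed.

Hypothesis Fballot : ballot F.

Lemma ballot_weak e e' v : (e <= e')%N -> (v <= n)%N ->
  (entries_above F e' v <= entries_above F e v)%N.
Proof.
rewrite leq_eqVlt => /orP[/eqP /val_inj -> //|lt] vn.
case: v vn => [|v] vn; last first.
  apply: leq_trans (Fballot (Ordinal vn) lt) _.
  apply/subset_leq_card/subsetP => y; rewrite !inE => /andP[-> /=].
  by move=> h; rewrite ltnW.
rewrite /entries_above (_ : [set y | _ & _] = set0) ?cards0 //.
by apply/setP => y; rewrite !inE andbF.
Qed.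

Lemma row_copies_lt x y : row_of x = row_of y -> (pos x < pos y)%N ->
  (copies F y < copies F x)%N.
Proof.
move=> rxy pxy; have := Frow rxy pxy; rewrite leq_eqVlt => /orP[/eqP/val_inj e|lt].
  by rewrite copies_lt_icol // /icol rxy; lia.
rewrite ltnNge; apply/negP => le.
have : (copies F y < entries_above F (F y) (row_of y).+1)%N by rewrite copies_lt_entries.
move=> /leq_trans/(_ (Fballot (row_of y) lt))/(leq_ltn_trans le).
by rewrite copies_lt_entries rxy ltnn.
Qed.

Lemma row_copies_eq x y : row_of x = row_of y -> copies F x = copies F y -> x = y.
Proof.
move=> rxy cxy; apply: cell_eq => //.
have [lt|lt|//] := ltngtP (pos x) (pos y).
  by have := row_copies_lt rxy lt; rewrite cxy ltnn.
by have := row_copies_lt (esym rxy) lt; rewrite cxy ltnn.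
Qed.

(** If F y > F x + 1, the ballot condition at an intermediate entry suffices.
Otherwise the entries F x at and to the left of x, in the row of x, all have an
entry F y below them; so at least as many entries F y are at or to the left of
y, which makes up for the ballot inequality between the two totals. *)
Lemma copies_column x y : row_of y = (row_of x).+1 :> nat -> icol x = icol y ->
  (copies F y <= copies F x)%N.
Proof.
move=> rxy cxy; have rlt : (row_of x < row_of y)%N by rewrite rxy.
have exy := Fcol rlt cxy.
have cy : (copies F y < entries_above F (F y) (row_of y).+1)%N by rewrite copies_lt_entries.
have [lt|ge] := ltnP (F x).+1 (F y).
  have en : ((F x).+1 < n)%N by apply: ltn_trans lt _.
  pose e := Ordinal en.
  have h1 := Fballot (row_of y) (lt : (e < F y)%N).
  have h2 := Fballot (row_of x) (leqnn _ : (F x < e)%N).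
  have h3 : (entries_above F (F x) (row_of x) <= copies F x)%N by rewrite leqNgt
    copies_lt_entries ltnn.
  by rewrite rxy in h1; rewrite rxy in cy; lia.
have ey : F y = (F x).+1 :> nat by lia.
pose B z := [set u | [&& F u == F z, row_of u == row_of z & icol u <= icol z]].
have Bx : (entries_above F (F x) (row_of x).+1 <= copies F x + #|B x|)%N.
  rewrite copiesE; apply: leq_trans (leq_card_setU _ _); apply/subset_leq_card/subsetP => u.
  rewrite !inE ltnS => /andP[/eqP eu ru]; rewrite eu eqxx /= ltNge.
  case: (boolP (icol u <= icol x)) => //= le; rewrite -(inj_eq val_inj) /= eqn_leq ru /=.
  move: le; rewrite le_eqVlt => /orP[/eqP|] ce; last by rewrite andbT (row_antitone eu ce).
  by rewrite (same_col eu ce) leqnn.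
have By : (copies F y + #|B y| <= entries_above F (F y) (row_of y).+1)%N.
  pose S := [set u | (F u == F y) && (icol y < icol u)].
  have dis : S :&: B y = set0.
    by apply/setP => u; rewrite !inE ltNge; case: (icol u <= _); rewrite /= ?andbF.
  rewrite copiesE -/S -cardsUI dis cards0 addn0; apply/subset_leq_card/subsetP => u.
  rewrite !inE ltnS.
  case/orP => [/andP[/eqP eu ru]|/and3P[-> /eqP-> _]]; last by rewrite leqnn.
  by rewrite eu eqxx; apply: row_antitone.
have Bxy : (#|B x| <= #|B y|)%N.
  have below u : u \in B x -> exists2 v, v \in B y & icol v = icol u.
    rewrite !inE => /and3P[/eqP eu /eqP ru cu].
    have := lz_dec rlt; have py := pos_lt y => hl.
    have [q eq] : exists q : nat, lz (row_of y) + q%:Z + 1 = icol u.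
      exists (absz (icol u - lz (row_of y) - 1)%R); move: cu; rewrite cxy /icol ru; lia.
    have qlt : (q < len (row_of y))%N by move: eq cu; rewrite cxy /icol; lia.
    pose v := mkcell qlt.
    have vc : icol v = icol u by [].
    have uv : (F u < F v)%N by apply: Fcol; rewrite ?ru.
    exists v => //; rewrite inE eqxx vc -cxy cu andbT andbT -(inj_eq val_inj) /=.
    have vy : (F v <= F y)%N.
      have [lt|ge'] := ltnP q (pos y); first exact: Frow.
      suff -> : v = y by [].
      by apply: cell_eq => //; change (q = pos y); move: eq cu ge'; rewrite cxy /icol; lia.
    by rewrite eqn_leq vy ey -eu.
  pose g u := odflt y [pick v | (v \in B y) && (icol v == icol u)].
  have gP u : u \in B x -> (g u \in B y) /\ icol (g u) = icol u.
    move=> /below [v vB vu]; rewrite /g; case: pickP => [w /andP[wB /eqP wu] //|/(_ v)].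
    by rewrite vB vu eqxx.
  rewrite -(@card_in_imset _ _ g);
    first by apply/subset_leq_card/subsetP => _ /imsetP[u /gP[uB _] ->].
  move=> u v uB vB e; have [_ cu] := gP u uB; have [_ cv] := gP v vB.
  move: uB vB; rewrite !inE => /and3P[_ /eqP ru _] /and3P[_ /eqP rv _].
  have ruv : row_of u = row_of v by rewrite ru rv.
  by apply: cell_eq => //; move: cu cv; rewrite e /icol ruv => ->; lia.
have lt1 : (F x < F y)%N by [].
by have := Fballot (row_of y) lt1; rewrite {2}rxy; lia.
Qed.

(** The k-th column, from k = 0, of the tableau of a filling.  Deleting the k
rightmost copies of every entry leaves exactly the cells whose rows form the
columns k, k + 1, and so on. *)
Definition colset F k : col := [set i | [exists x, (row_of x == i) && (copies F x == k)]].

Lemma in_colset k i : reflect (exists2 x, row_of x = i & copies F x = k) (i \in colset F k).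
Proof.
rewrite inE; apply: (iffP existsP) => [[x /andP[/eqP h1 /eqP h2]]|[x h1 h2]]; exists x => //.
by rewrite h1 h2 !eqxx.
Qed.

(** Both sides count the cells above row v with exactly k copies to the right: the
left one by their rows, the right one by their entries. *)
Lemma nbelow_colset k v : (v <= n)%N ->
  nbelow (colset F k) v = #|[set e | (k < entries_above F e v)%N]|.
Proof.
move=> vn; pose S := [set x | (copies F x == k) && (row_of x < v)%N].
have -> : [set e | (k < entries_above F e v)%N] = F @: S.
  apply/setP => e; rewrite inE; apply/idP/imsetP => [lt|[x]].
    have [x xe xk] : exists2 x, F x = e & copies F x = k.
      apply: copies_onto; apply: leq_trans lt _; apply/subset_leq_card/subsetP => y.
      by rewrite !inE => /andP[-> _] /=.
    by exists x => //; rewrite inE xk eqxx -copies_lt_entries xe xk.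
  by rewrite inE => /andP[/eqP <- xv] ->; rewrite copies_lt_entries.
rewrite card_in_imset; last first.
  by move=> x y; rewrite !inE => /andP[/eqP kx _] /andP[/eqP ky _] e; apply: copies_inj => //;
    rewrite kx ky.
rewrite -(@card_in_imset _ _ (fun x : cell => row_of x) S); last first.
  move=> x y; rewrite !inE => /andP[/eqP kx _] /andP[/eqP ky _] e; apply: row_copies_eq => //.
  by rewrite kx ky.
apply: eq_card => i; rewrite !inE; apply/andP/imsetP => [[h iv]|[x]].
  case/existsP: h => x /andP[/eqP xi xk]; exists x => //.
  by rewrite inE xk xi iv.
rewrite inE => /andP[xk xv] ->; split=> //; apply/existsP; exists x.
by rewrite eqxx xk.
Qed.

(** The entries in column k strictly above the cell x are those smaller than F x, by
the ballot condition; hence a filling is determined by its columns. *)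
Lemma entry_nbelow x : F x = nbelow (colset F (copies F x)) (row_of x) :> nat.
Proof.
rewrite nbelow_colset; last exact: ltnW.
apply: etrans (esym (@nbelow_setT n (F x) (ltnW (ltn_ord _)))) _.
apply: eq_card => e; rewrite !inE /=.
case: (ltnP e (F x)) => ex; symmetry.
  by apply: leq_trans (Fballot _ ex); rewrite copies_lt_entries.
apply/negbTE; rewrite -leqNgt.
apply: leq_trans (ballot_weak ex (ltnW (ltn_ord _))) _.
by rewrite leqNgt copies_lt_entries ltnn.
Qed.

Hypothesis Fd : forall e, (entries_above F e n <= d)%N.

Lemma copies_lt_size x : (copies F x < d)%N.
Proof. by apply: leq_trans (Fd (F x)); rewrite copies_lt_entries. Qed.


End FromFilling.

(** The number of cells that the first l steps of the walk add to row i. *)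
Definition cnt t l i : nat := (\sum_(k < l) (i \in nth set0 t k))%N.

Lemma cnt0 t i : cnt t 0 i = 0%N.
Proof. by rewrite /cnt big_ord0. Qed.

Lemma cntS t l i : cnt t l.+1 i = (cnt t l i + (i \in nth set0 t l))%N.
Proof. by rewrite /cnt big_ord_recr. Qed.

(** The columns are listed from right to left, so that the l-th one is the column
d - l - 1 of the tableau. *)
Definition col_word F : d.-tuple col := [tuple colset F (d - l.+1)%N | l < d].

Lemma col_word_nth F l : (l < d)%N -> nth set0 (col_word F) l = colset F (d - l.+1)%N.
Proof. by move=> ld; rewrite -[l]/(nat_of_ord (Ordinal ld)) -tnth_nth tnth_mktuple. Qed.

Section FromFilling2.
Variable F : filling la rho.
Hypotheses (Frow : row_weak F) (Fcol : col_strict F) (Fballot : ballot F).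
Hypothesis Fd : forall e, (entries_above F e n <= d)%N.

Lemma cnt_col_word l i : (l <= d)%N ->
  cnt (col_word F) l i = #|[set x | (row_of x == i) && (d - l <= copies F x)%N]|.
Proof.
elim: l => [|l IH] ld.
  rewrite cnt0 (_ : [set x | _ & _] = set0) ?cards0 //; apply/setP => x.
  by rewrite !inE subn0 leqNgt copies_lt_size // andbF.
rewrite cntS IH ?(ltnW ld) // col_word_nth //.
have -> : [set x | (row_of x == i) && (d - l.+1 <= copies F x)%N] =
   [set x | (row_of x == i) && (d - l <= copies F x)%N] :|:
   [set x | (row_of x == i) && (copies F x == d - l.+1)%N].
  by apply/setP => x; rewrite !inE -andb_orr; congr (_ && _); lia.
rewrite cardsU (_ : _ :&: _ = set0) ?cards0 ?subn0; last first.
  apply/setP => x; rewrite !inE; case: (row_of x == i) => //=; lia.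
congr (_ + _)%N; case: in_colset => [[x xi xk]|nx]; last first.
  rewrite (_ : [set x | _ & _] = set0) ?cards0 //; apply/setP => x; rewrite !inE.
  by apply/negP => /andP[/eqP h1 /eqP h2]; apply: nx; exists x.
rewrite (_ : [set x | _ & _] = [set x]) ?cards1 //; apply/setP => y; rewrite !inE.
apply/andP/eqP => [[/eqP yi /eqP yk]|->]; last by rewrite xi xk !eqxx.
by apply: (row_copies_eq Frow Fcol Fballot); rewrite ?yi ?yk.
Qed.

Lemma row_count i m : (m <= len i)%N ->
  #|[set x : cell | (row_of x == i) && (pos x < m)%N]| = m.
Proof.
elim: m => [|m IH] mi.
  by rewrite (_ : [set x | _ & _] = set0) ?cards0 //; apply/setP => x; rewrite !inE andbF.
rewrite (cardsD1 (mkcell mi)) inE eqxx ltnSn add1n; congr _.+1.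
rewrite -[RHS]IH 1?ltnW //; apply: eq_card => x; rewrite !inE.
case: (eqVneq (row_of x) i) => [xi|]; rewrite ?andbF //=.
rewrite ltnS [in RHS]ltn_neqAle; congr (_ && _).
apply/negP/negP => h; first by move/eqP => e; apply: h; apply/eqP; apply: cell_eq.
by move/eqP => e; apply: h; rewrite e.
Qed.

Lemma cnt_pos x : cnt (col_word F) (d - (copies F x).+1) (row_of x) = pos x.
Proof.
have cx := copies_lt_size Frow Fcol Fd x.
rewrite cnt_col_word ?leq_subr // subKn //.
apply: etrans (row_count (ltnW (pos_lt x))).
apply: eq_card => y; rewrite !inE; case: eqVneq => //= yx.
have [lt|lt|e] := ltngtP (pos y) (pos x).
- exact: row_copies_lt.
- by apply/negbTE; rewrite -leqNgt ltnW // row_copies_lt.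
- by rewrite (cell_eq yx e) ltnn.
Qed.

Lemma cnt_col_word_len i : cnt (col_word F) d i = len i.
Proof.
rewrite cnt_col_word // subnn; apply: etrans (row_count (leqnn _)).
by apply: eq_card => x; rewrite !inE /=; case: eqP => //= <-; rewrite pos_lt.
Qed.

Lemma col_word_chain l : (l.+1 < d)%N ->
  col_le (nth set0 (col_word F) l.+1) (nth set0 (col_word F) l).
Proof.
move=> ld; rewrite (col_word_nth _ ld) (col_word_nth _ (ltnW ld)); apply/col_leP => v vn.
rewrite !nbelow_colset //; apply/subset_leq_card/subsetP => e; rewrite !inE.
by apply: leq_trans; lia.
Qed.

(** A violation would give a cell y that is added before the cell x above it,
against [copies_column]. *)
Lemma col_word_dominant l (i i' : 'I_n) : i' = i.+1 :> nat -> (l <= d)%N ->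
  lz i' + (cnt (col_word F) l i')%:Z <= lz i + (cnt (col_word F) l i)%:Z.
Proof.
move=> ii' ld; rewrite leNgt; apply/negP => lt.
have i0 : (i < i')%N by rewrite ii'.
have h1 := lz_dec i0; have h2 := rz_dec i0.
set c := cnt _ l i in lt *; set c' := cnt _ l i' in lt *.
have cle j : (cnt (col_word F) l j <= len j)%N.
  rewrite -(row_count (leqnn (len j))) cnt_col_word //.
  by apply/subset_leq_card/subsetP => x; rewrite !inE => /andP[/eqP <- _]; rewrite eqxx pos_lt.
have left x : (d - l <= copies F x)%N = (pos x < cnt (col_word F) l (row_of x))%N.
  rewrite cnt_col_word //.
  apply/idP/idP => [lx|].
    rewrite -(row_count (pos_lt x)); apply/subset_leq_card/subsetP => y.
    rewrite !inE ltnS => /andP[/eqP yx]; rewrite yx eqxx /=.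
    rewrite leq_eqVlt => /orP[/eqP/(cell_eq yx) -> //|lt'].
    by apply: leq_trans lx (ltnW _); apply: row_copies_lt.
  apply: contraLR; rewrite -!ltnNge ltnS => lx.
  rewrite -[X in (_ <= X)%N](row_count (ltnW (pos_lt x))).
  apply/subset_leq_card/subsetP => y; rewrite !inE => /andP[/eqP yx ly]; rewrite yx eqxx /=.
  rewrite ltnNge leq_eqVlt; apply/negP => /orP[/eqP e|lt'].
    by move: lx; rewrite (cell_eq (esym yx) e) ltnNge ly.
  by have := row_copies_lt Frow Fcol Fballot (esym yx) lt'; lia.
have [q eq] : exists q : nat, lz i' + q%:Z = lz i + c%:Z.
  by exists (absz (lz i + c%:Z - lz i')%R); lia.
have cl' := cle i'; have cl := cle i; rewrite -/c' in cl'; rewrite -/c in cl.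
have ql : (q < len i')%N by lia.
have pl : (c < len i)%N by lia.
have hc : (copies F (mkcell ql) <= copies F (mkcell pl))%N.
  apply: copies_column => //; rewrite /icol /row_of /pos /=.
  by rewrite -eq.
have hy : (d - l <= copies F (mkcell ql))%N.
  by rewrite left /row_of /pos /= -/c'; lia.
have := left (mkcell pl); rewrite (leq_trans hy hc) /row_of /pos /= -/c ltnn.
by [].
Qed.

End FromFilling2.
Definition LR_conditions F : Prop :=
  [/\ row_weak F, col_strict F, ballot F & forall e, (entries_above F e n <= d)%N].

Definition walk_conditions t : Prop :=
  [/\ forall l, (l.+1 < d)%N -> col_le (nth set0 t l.+1) (nth set0 t l),
      forall l (i i' : 'I_n), i' = i.+1 :> nat -> (l <= d)%N ->
        lz i' + (cnt t l i')%:Z <= lz i + (cnt t l i)%:Z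
    & forall i, cnt t d i = len i].

Lemma col_word_walk F : LR_conditions F -> walk_conditions (col_word F).
Proof.
case=> h1 h2 h3 h4; split=> *; [exact: col_word_chain|exact: col_word_dominant|].
exact: cnt_col_word_len.
Qed.

Lemma cnt_leq t l m i : (l <= m)%N -> (cnt t l i <= cnt t m i)%N.
Proof.
elim: m => [|m IH]; first by rewrite leqn0 => /eqP->.
rewrite leq_eqVlt => /orP[/eqP->//|lm].
by apply: leq_trans (IH lm) _; rewrite cntS leq_addr.
Qed.

Lemma cnt_lt t l m i : i \in nth set0 t l -> (l < m)%N -> (cnt t l i < cnt t m i)%N.
Proof. by move=> il lm; apply: leq_trans (cnt_leq t i lm); rewrite cntS il addn1. Qed.

Lemma cnt_inj t l m i : i \in nth set0 t l -> i \in nth set0 t m ->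
  cnt t l i = cnt t m i -> l = m.
Proof.
move=> il im e; have [lt|lt|//] := ltngtP l m.
  by have := cnt_lt il lt; rewrite e ltnn.
by have := cnt_lt im lt; rewrite e ltnn.
Qed.

Lemma cnt_find t m i p : (p < cnt t m i)%N ->
  exists l, [/\ (l < m)%N, i \in nth set0 t l & cnt t l i = p].
Proof.
elim: m => [|m IH]; first by rewrite cnt0.
rewrite cntS; have [/IH [l [lm li lp]]|ge] := ltnP p (cnt t m i).
  by exists l; split=> //; apply: ltnW.
case: (boolP (i \in nth set0 t m)) => im; last by rewrite addn0 ltnNge ge.
by rewrite addn1 ltnS => le; exists m; split=> //; apply/eqP; rewrite eqn_leq ge le.
Qed.

Lemma in_col_word F x : LR_conditions F ->
  row_of x \in nth set0 (col_word F) (d - (copies F x).+1).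
Proof.
case=> h1 h2 h3 h4; have cx := copies_lt_size h1 h2 h4 x.
rewrite col_word_nth; last by lia.
by apply/in_colset; exists x => //; lia.
Qed.

Lemma col_word_inj F F' : LR_conditions F -> LR_conditions F' -> col_word F = col_word F' ->
  F = F'.
Proof.
move=> HF HF' e; have [h1 h2 h3 h4] := HF; have [h1' h2' h3' h4'] := HF'.
apply/ffunP => x; apply: (@ord_inj n).
have cx := copies_lt_size h1 h2 h4 x; have cx' := copies_lt_size h1' h2' h4' x.
have el : (d - (copies F x).+1)%N = (d - (copies F' x).+1)%N.
  apply: (@cnt_inj (col_word F) _ _ (row_of x)); first exact: in_col_word.
    by rewrite e; apply: in_col_word.
  by rewrite cnt_pos // e cnt_pos.
have ec : copies F x = copies F' x by lia.
rewrite (entry_nbelow h1 h2 h3) (entry_nbelow h1' h2' h3') -ec; congr (nbelow _ _).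
have ld : (d - (copies F x).+1 < d)%N by lia.
have -> : copies F x = (d - (d - (copies F x).+1).+1)%N by lia.
by rewrite -!col_word_nth // e.
Qed.

(** * From walks to fillings *)

Section FromWalk.
Variable t : seq col.
Hypothesis Ht : walk_conditions t.
Local Notation T l := (nth set0 t l).

Lemma walk_chain l m : (l <= m)%N -> (m < d)%N -> col_le (T m) (T l).
Proof.
have [h _ _] := Ht; elim: m => [|m IH].
  by rewrite leqn0 => /eqP-> _; apply/col_leP.
rewrite leq_eqVlt => /orP[/eqP-> _|lm md]; first by apply/col_leP.
by apply: col_le_trans (h _ md) (IH lm (ltnW md)).
Qed.

Lemma nbelow_walk l m v : (v <= n)%N -> (l <= m)%N -> (m < d)%N ->
  (nbelow (T l) v <= nbelow (T m) v)%N.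
Proof. by move=> vn lm md; have /col_leP := walk_chain lm md; apply. Qed.

Lemma walk_dom l (i i' : 'I_n) : (i <= i')%N -> (l <= d)%N ->
  lz i' + (cnt t l i')%:Z <= lz i + (cnt t l i)%:Z.
Proof.
have [_ h _] := Ht; move=> ii ld.
by apply: (adjacent_antitone (f := fun i => lz i + (cnt t l i)%:Z)) ii => j j' jj; apply: h.
Qed.

(** The step of the walk that adds the cell x. *)
Definition arrival x : nat :=
  find (fun l => (row_of x \in T l) && (cnt t l (row_of x) == pos x)) (iota 0 d).

Lemma arrivalP x : [/\ (arrival x < d)%N,
  row_of x \in T (arrival x) & cnt t (arrival x) (row_of x) = pos x].
Proof.
have [_ _ h] := Ht; have := pos_lt x; rewrite -h => /cnt_find [l [ld lr lp]].
have hs : has (fun l => (row_of x \in T l) && (cnt t l (row_of x) == pos x)) (iota 0 d).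
  by apply/hasP; exists l; rewrite ?mem_iota // lr lp eqxx.
have ltd : (arrival x < d)%N by move: hs; rewrite has_find size_iota.
have := nth_find 0%N hs; rewrite -/(arrival x) nth_iota // add0n => /andP[h1 /eqP h2].
by split.
Qed.

Lemma arrival_row x y : row_of x = row_of y -> (pos x < pos y)%N -> (arrival x < arrival y)%N.
Proof.
move=> rxy; have [_ _ <-] := arrivalP x; have [_ _ <-] := arrivalP y; rewrite rxy.
by apply: contraTltn => ?; rewrite -leqNgt cnt_leq.
Qed.

Definition walk_filling : filling la rho :=
  [ffun x : cell => Ordinal (leq_ltn_trans (nbelow_le (T (arrival x)) (ltnW (ltn_ord (row_of
    x))))
                                           (ltn_ord (row_of x)))].

Lemma walk_fillingE x : walk_filling x = nbelow (T (arrival x)) (row_of x) :> nat.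
Proof. by rewrite ffunE. Qed.

Lemma walk_row_weak : row_weak walk_filling.
Proof.
move=> x y rxy pxy; rewrite !walk_fillingE rxy.
by apply: nbelow_walk; [exact: ltnW|exact/ltnW/arrival_row|have [] := arrivalP y].
Qed.

Lemma nbelow_succ x v : (row_of x < v)%N -> (v <= n)%N ->
  (walk_filling x < nbelow (T (arrival x)) v)%N.
Proof.
move=> xv vn; have [_ rx _] := arrivalP x; rewrite walk_fillingE.
by apply: leq_trans (nbelow_leq _ xv); rewrite nbelowS rx addn1.
Qed.

(** Within a column of the diagram, cells are added from top to bottom, because the
shape is a skew diagram after every step. *)
Lemma arrival_col x y : (row_of x < row_of y)%N -> icol x = icol y ->
  (arrival x <= arrival y)%N.
Proof.
move=> rxy cxy; rewrite leqNgt; apply/negP => lt.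
have [dx _ px] := arrivalP x; have [dy ry py] := arrivalP y.
have := walk_dom (ltnW rxy) (dy : (arrival y).+1 <= d)%N.
rewrite cntS ry py; have := cnt_leq t (row_of x) lt; rewrite px.
move: cxy; rewrite /icol; lia.
Qed.

Lemma walk_col_strict : col_strict walk_filling.
Proof.
move=> x y rxy cxy; have [dy _ _] := arrivalP y.
apply: leq_trans (nbelow_succ rxy (ltnW (ltn_ord _))) _.
by rewrite walk_fillingE; apply: nbelow_walk => //; [exact: ltnW|exact: arrival_col].
Qed.

Lemma arrival_inj x y : walk_filling x = walk_filling y -> arrival x = arrival y -> x = y.
Proof.
move=> /(congr1 (@nat_of_ord n)); rewrite !walk_fillingE => e txy.
have [_ rx px] := arrivalP x; have [_ ry py] := arrivalP y; rewrite txy in rx px e.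
have rxy := nbelow_inj rx ry e.
by apply: cell_eq => //; rewrite -px -py rxy.
Qed.

(** Equal entries are added from left to right: the later one is not in a lower row,
as columns get larger from right to left, and if it is in a higher row then that
row has already outgrown the column of the earlier one. *)
Lemma arrival_icol x y : walk_filling x = walk_filling y -> (arrival x < arrival y)%N ->
  icol x < icol y.
Proof.
move=> Fxy lt; have [dx rx px] := arrivalP x; have [dy ry py] := arrivalP y.
have ryx : (row_of y <= row_of x)%N.
  rewrite leqNgt; apply/negP => rxy.
  have := nbelow_succ rxy (ltnW (ltn_ord _)); rewrite Fxy walk_fillingE ltnNge.
  by rewrite nbelow_walk // ltnW // ltnW.
move: ryx; rewrite leq_eqVlt => /orP[/eqP/(@ord_inj n) e|ryx].
  have : (pos x < pos y)%N by rewrite -px -py e cnt_lt // -e.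
  by rewrite /icol e; lia.
have := walk_dom (ltnW ryx) (dx : (arrival x).+1 <= d)%N.
rewrite cntS rx px; have := cnt_leq t (row_of y) lt; rewrite py /icol; lia.
Qed.

Lemma icol_arrival x y : walk_filling x = walk_filling y ->
  (icol x < icol y) = (arrival x < arrival y)%N.
Proof.
move=> Fxy; have [lt|lt|e] := ltngtP (arrival x) (arrival y); first exact: arrival_icol.
  by apply/negbTE; rewrite -leNgt ltW // arrival_icol.
by rewrite (arrival_inj Fxy e) ltxx.
Qed.

Lemma walk_entry e l v : (v <= n)%N -> (l < d)%N -> (e < nbelow (T l) v)%N ->
  exists x, [/\ walk_filling x = e :> nat, arrival x = l & (row_of x < v)%N].
Proof.
have [_ _ h] := Ht; move=> vn ld /(nbelow_onto vn) [i il /andP[iv /eqP ie]].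
have pl : (cnt t l i < len i)%N by rewrite -h cnt_lt.
pose x := mkcell pl; have [dx rx px] := arrivalP x.
have tx : arrival x = l by apply: (cnt_inj rx il); rewrite px.
by exists x; split=> //; rewrite walk_fillingE tx.
Qed.

Lemma walk_entries_above e v : (v <= n)%N ->
  entries_above walk_filling e v = #|[set l : 'I_d | (e < nbelow (T l) v)%N]|.
Proof.
move=> vn; pose g x : 'I_d := Ordinal (let: And3 h _ _ := arrivalP x in h).
rewrite /entries_above -(@card_in_imset _ _ g); last first.
  move=> x y; rewrite !inE => /andP[/eqP ex _] /andP[/eqP ey _] /(congr1 val) /=.
  by apply: arrival_inj; rewrite ex ey.
apply: eq_card => l; rewrite inE; apply/imsetP/idP => [[x]|lt].
  by rewrite inE => /andP[/eqP <- xv] ->; apply: nbelow_succ.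
have [x [xe xl xv]] := walk_entry vn (ltn_ord l) lt.
exists x; last by apply: val_inj.
by rewrite inE xv andbT; apply/eqP/ord_inj.
Qed.

Lemma walk_filling_LR : LR_conditions walk_filling.
Proof.
split; [exact: walk_row_weak|exact: walk_col_strict| |].
  move=> v e e' ee; rewrite !walk_entries_above ?(ltnW (ltn_ord v)) //.
  apply/subset_leq_card/subsetP => l; rewrite !inE.
  by have := nbelowS (T l) v; case: (v \in T l) => /=; lia.
by move=> e; rewrite walk_entries_above // -[leqRHS]card_ord max_card.
Qed.

(** Every step after the arrival of x adds one more entry F x, to the right of x. *)
Lemma copies_walk_filling x : copies walk_filling x = (d - (arrival x).+1)%N.
Proof.
have [h1 h2 h3 h4] := walk_filling_LR; have [dx rx px] := arrivalP x.
have cx := copies_lt_size h1 h2 h4 x.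
suff : (d - (copies walk_filling x).+1)%N = arrival x by lia.
rewrite copiesE; set S := [set y | _ & _].
pose g y : 'I_d := Ordinal (let: And3 h _ _ := arrivalP y in h).
have -> : #|S| = #|[set l : 'I_d | (arrival x < l)%N]|.
  rewrite -(@card_in_imset _ _ g); last first.
    move=> u v; rewrite !inE => /andP[/eqP eu _] /andP[/eqP ev _] /(congr1 val) /=.
    by apply: arrival_inj; rewrite eu ev.
  apply: eq_card => l; rewrite inE; apply/imsetP/idP => [[u]|lt].
    by rewrite inE => /andP[/eqP eu]; rewrite icol_arrival // => + ->.
  have : (walk_filling x < nbelow (T l) n)%N.
    apply: leq_trans (nbelow_walk (leqnn n) (ltnW lt) (ltn_ord l)).
    exact: nbelow_succ.
  case/(walk_entry (leqnn n) (ltn_ord l)) => u [ue ul _].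
  have eu : walk_filling u = walk_filling x by apply: ord_inj.
  exists u; last by apply: val_inj.
  by rewrite inE eu eqxx icol_arrival ?eu // ul.
have := cardsC [set l : 'I_d | (arrival x < l)%N]; rewrite card_ord.
have -> : #|~: [set l : 'I_d | (arrival x < l)%N]| = (arrival x).+1.
  apply: etrans (@nbelow_setT d (arrival x).+1 dx).
  by apply: eq_card => l; rewrite !inE -leqNgt ltnS.
by move: #|_| => N e; lia.
Qed.

Lemma walk_filling_col_word : size t = d -> col_word walk_filling = t :> seq col.
Proof.
move=> st; apply: (@eq_from_nth _ set0); first by rewrite size_tuple.
move=> l; rewrite size_tuple => ld; rewrite col_word_nth //.
apply/setP => i; apply/in_colset/idP => [[x <-]|il].
  rewrite copies_walk_filling; have [dx rx px] := arrivalP x => e.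
  by have -> : l = arrival x by lia.
have [_ _ h] := Ht.
have pl : (cnt t l i < len i)%N by rewrite -h cnt_lt.
exists (mkcell pl) => //; rewrite copies_walk_filling.
have [dx rx px] := arrivalP (mkcell pl); congr (_ - _.+1)%N.
exact: (cnt_inj rx il).
Qed.

End FromWalk.
End Fillings.

(** * Lattice words *)

Lemma take_flatten (T : Type) (ss : seq (seq T)) p :
  exists v q, (v <= size ss)%N /\
    take p (flatten ss) = flatten (take v ss) ++ take q (nth [::] ss v).
Proof.
elim: ss p => [|s ss IH] p; first by exists 0%N, 0%N.
rewrite [flatten (s :: ss)]/=; have [ps|ps] := leqP p (size s).
  by exists 0%N, p; rewrite takel_cat.
have [v [q [vs e]]] := IH (p - size s)%N.
exists v.+1, q; split; rewrite //= take_cat ltnNge (ltnW ps) /= e catA //.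
Qed.

Lemma filter_gt_sorted (n e : nat) (s : seq 'I_n) :
  sorted (fun x y : 'I_n => (y <= x)%N) s ->
  [seq x : 'I_n <- s | (e < x)%N] = take (count (fun x : 'I_n => (e < x)%N) s) s.
Proof.
have tr : transitive (fun x y : 'I_n => (y <= x)%N) by move=> x y z h1 h2;
  apply: leq_trans h2 h1.
elim: s => //= a s IH h; case: ltnP => ea; first by rewrite IH // (path_sorted h).
have no : all (fun x : 'I_n => ~~ (e < x)%N) s.
  apply/allP => x xs; rewrite -leqNgt; apply: leq_trans ea.
  by have /allP := order_path_min tr h; apply.
rewrite (_ : count _ s = 0%N) ?take0; last first.
  by apply/eqP; rewrite -leqn0 leqNgt -has_count -all_predC.
by apply/eqP; rewrite -size_eq0 size_filter -leqn0 leqNgt -has_count -all_predC.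
Qed.

Section LatticeWord.
Variables (n : nat) (la rho : indexseq n).
Local Notation len i := (Num.truncn (rho i - la i)).
Local Notation cell := (cell la rho).
Variable F : filling la rho.
Implicit Types (x y : cell) (i e : 'I_n).

Definition row_entries i : seq 'I_n :=
  [seq F (Tagged (fun i => 'I_(len i)) k) | k : 'I_(len i)].

Definition read_rows : seq (seq 'I_n) := [seq rev (row_entries i) | i : 'I_n].

Lemma size_read_rows : size read_rows = n.
Proof. by rewrite size_map size_enum_ord. Qed.

Lemma nth_read_rows i : nth [::] read_rows i = rev (row_entries i).
Proof. by rewrite (nth_map i) ?size_enum_ord // nth_ord_enum. Qed.

Lemma count_row_entries e i :
  count_mem e (row_entries i) = #|[set x : cell | (F x == e) && (row_of x == i)]|.
Proof.
rewrite count_map -sum1_count big_enum_cond sum1dep_card.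
rewrite -(@card_imset _ _ (fun k => Tagged (fun i => 'I_(len i)) k : cell)); last first.
  by move=> k k' /eqP; rewrite eq_Tagged => /eqP.
apply: eq_card => x; apply/imsetP/idP => [[k]|].
  by rewrite !inE /= => ke ->; rewrite ke eqxx.
rewrite !inE; case: x => j k; rewrite /row_of /= => /andP[h /eqP ji].
by subst j; exists k; rewrite // inE.
Qed.

Lemma count_read_rows e v : (v <= n)%N ->
  count_mem e (flatten (take v read_rows)) = entries_above F e v.
Proof.
elim: v => [|v IH] vn.
  rewrite take0 /= /entries_above (_ : [set y | _ & _] = set0) ?cards0 //.
  by apply/setP => y; rewrite !inE andbF.
rewrite (take_nth [::]) ?size_read_rows // flatten_rcons count_cat IH ?(ltnW vn) //.
rewrite (nth_read_rows (Ordinal vn)) count_rev count_row_entries.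
have -> : entries_above F e v.+1 = #|[set y : cell | (F y == e) && (row_of y < v)%N] :|:
    [set y : cell | (F y == e) && (row_of y == Ordinal vn)]|.
  apply: eq_card => y; rewrite !inE -andb_orr ltnS leq_eqVlt orbC.
  by rewrite -(inj_eq val_inj (row_of y)).
rewrite cardsU (_ : _ :&: _ = set0) ?cards0 ?subn0 //.
apply/setP => y; rewrite !inE; case: (F y == e) => //=.
by case: eqVneq => [->|]; rewrite ?andbF // ltnn.
Qed.

Lemma reading_wordE : reading_word F = flatten read_rows.
Proof. by []. Qed.

Lemma ballot_lattice_word : ballot F -> lattice_word (reading_word F).
Proof.
move=> H; apply/forallP => p; apply/forallP => e; apply/forallP => e'; apply/implyP => ee.
move: (nat_of_ord p) => {}p; rewrite reading_wordE;
  have [v [q [vs ->]]] := take_flatten read_rows p.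
rewrite size_read_rows in vs; rewrite !count_cat !count_read_rows //.
have [vn|nv] := ltnP v n; last first.
  rewrite nth_default ?size_read_rows //= addn0.
  apply: leq_trans (leq_addr _ _); exact: (ballot_weak H (ltnW ee)).
have le : (count_mem e' (take q (nth [::] read_rows v)) <= 
           count_mem e' (nth [::] read_rows v))%N.
  by rewrite -{2}(cat_take_drop q (nth _ _ _)) count_cat leq_addr.
apply: leq_trans (leq_addr _ _); apply: leq_trans (leq_add (leqnn _) le) _.
apply: leq_trans (H (Ordinal vn) e e' ee).
rewrite /= -(count_read_rows e' vn) (take_nth [::]) ?size_read_rows // flatten_rcons count_cat.
by rewrite count_read_rows // ltnW.
Qed.

Lemma row_entries_sorted i : row_weak F ->
  sorted (fun x y : 'I_n => (x <= y)%N) (row_entries i).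
Proof.
move=> H; rewrite sorted_map.
have : sorted (fun k k' : 'I_(len i) => (k < k')%N) (enum 'I_(len i)).
  have := iota_ltn_sorted 0 (len i); rewrite -val_enum_ord sorted_map.
  by apply: sub_sorted => k k'.
by apply: sub_sorted => k k' kk; apply: H.
Qed.

(** As a row is read from right to left, its entries greater than e come first; the
prefix that ends with them is the one to consider. *)
Lemma lattice_word_ballot : row_weak F -> lattice_word (reading_word F) -> ballot F.
Proof.
move=> Frow /forallP H v e e' ee.
have sv : sorted (fun x y : 'I_n => (y <= x)%N) (rev (row_entries v)).
  by rewrite rev_sorted; apply: row_entries_sorted.
pose u := flatten (take v read_rows);
  pose f := [seq x : 'I_n <- rev (row_entries v) | (e < x)%N].
have [r er] : exists r, reading_word F = (u ++ f) ++ r.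
  have := filter_gt_sorted e sv; rewrite -/f => ef.
  exists (drop (count (fun x : 'I_n => (e < x)%N) (rev (row_entries v))) (rev (row_entries v))
           ++ flatten (drop v.+1 read_rows)).
  rewrite ef -catA [X in _ = _ ++ X]catA cat_take_drop reading_wordE.
  rewrite -[in LHS](cat_take_drop v read_rows) flatten_cat; congr (_ ++ _).
  by rewrite (drop_nth [::]) ?size_read_rows // nth_read_rows.
have sz : (size (u ++ f) < (size (reading_word F)).+1)%N.
  by rewrite er [in X in (_ < X)%N]size_cat ltnS leq_addr.
have /forallP/(_ e)/forallP/(_ e')/implyP/(_ ee) := H (Ordinal sz).
rewrite /= er take_size_cat // !count_cat !count_read_rows ?(ltnW (ltn_ord v)) //.
rewrite /f !count_filter.
have -> : count (predI (pred1 e) (fun x : 'I_n => (e < x)%N)) (rev (row_entries v)) = 0%N.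
  rewrite (eq_count (a2 := pred0)) ?count_pred0 // => x /=.
  by case: eqVneq => // ->; rewrite ltnn.
rewrite addn0 (eq_count (a2 := pred1 e')); last first.
  by move=> x /=; case: eqVneq => // ->.
apply: leq_trans.
rewrite -(count_read_rows e' (ltn_ord v)) (take_nth [::]) ?size_read_rows // flatten_rcons
  count_cat.
by rewrite nth_read_rows count_read_rows // ltnW.
Qed.

End LatticeWord.

(** * Characters as quotients of alternants *)

Lemma fsbig_count (K : nzRingType) (T : choiceType) (I : finType) (P : pred I) (f : I -> T)
    (A : set T) (g : T -> K) :
  finite_set A -> (forall i, P i -> A (f i)) ->
  (\sum_(t \in A) g t * #|[set i | P i && (f i == t)]|%:R)%R = \sum_(i | P i) g (f i).
Proof.
move=> finA PA; rewrite fsbig_finite //=.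
transitivity (\sum_(t <- finmap.enum_fset (fset_set A)) \sum_(i | P i) (if f i == t then g t
  else 0)).
  apply: eq_bigr => t _; rewrite -sum1dep_card natr_sum mulr_sumr big_mkcondr /=.
  by apply: eq_bigr => i _; case: eqP; rewrite ?mulr1.
rewrite exchange_big /=; apply: eq_bigr => i Pi.
have fi : f i \in finmap.enum_fset (fset_set A).
  by have := @in_fset_set _ A finA (f i); rewrite mem_set => [h|]; [exact: h|exact: PA].
rewrite (bigD1_seq _ fi) ?finmap.fset_uniq //= eqxx big1 ?addr0 // => t.
by rewrite eq_sym => /negbTE->.
Qed.

Section Characters.
Variable n : nat.
Local Notation K := (charField n).
Local Notation weight := {ffun 'I_n -> int}.

Definition xvar (j : 'I_n) : K := tofrac ('X_j : {mpoly rat[n]}).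

Lemma xvar_neq0 j : xvar j != 0.
Proof.
rewrite /xvar tofrac_eq0; apply/eqP => /(congr1 (mcoeff U_(j)%MM)) /eqP.
by rewrite mcoeffX eqxx mcoeff0 oner_eq0.
Qed.

Lemma two_neq0 : (2 : K) != 0.
Proof.
have -> : (2 : K) = tofrac (2%:R : {mpoly rat[n]}) by rewrite rmorph_nat.
by rewrite tofrac_eq0 -mpolyC_nat mpolyC_eq0.
Qed.

Lemma xpow_half j (a : rat) (z : int) : 2 * a = z%:~R ->
  xpow j a = xvar j ^ z /\ xpow j (- a) = xvar j ^ (- z).
Proof. by move=> e; rewrite /xpow mulrN e -intrN !intrKfloor. Qed.

Lemma alt_minusE (a : 'I_n -> rat) (w : weight) : (forall i, 2 * a i = (w i)%:~R) ->
  alt_minus a = det_alt xvar (-1) w.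
Proof.
move=> H; rewrite /alt_minus /det_alt; congr (\det _); apply/matrixP => i j; rewrite !mxE.
by have [-> ->] := xpow_half j (H i); rewrite mulN1r.
Qed.

Lemma alt_plusE (a : 'I_n -> rat) (w : weight) : (forall i, 2 * a i = (w i)%:~R) ->
  alt_plus a = det_alt xvar 1 w.
Proof.
move=> H; rewrite /alt_plus /det_alt; congr (\det _); apply/matrixP => i j; rewrite !mxE.
by have [-> ->] := xpow_half j (H i); rewrite mul1r.
Qed.

Definition doubled (la : indexseq n) : weight := [ffun i => Num.floor (2 * la i)].

Definition half_integral (la : indexseq n) : Prop := forall i, 2 * la i \is a Num.int.

(** The exponents in the numerators of the three characters are la + rho, with
r = 1, 1/2, 0. *)
Lemma shifted (la : indexseq n) (q : int) (r : rat) : half_integral la ->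
  2 * r - 2 = q%:~R ->
  forall i : 'I_n, 2 * (la i + n%:R - i.+1%:R + r) = ((doubled la + staircase n q) i)%:~R.
Proof.
move=> hla hq i; rewrite !ffunE intrD floorK // intrD intrM -hq.
have -> : ((n - i)%N%:Z)%:~R = n%:R - i%:R :> rat.
  by rewrite -pmulrn natrB // ltnW.
by rewrite -[i.+1]addn1 natrD; lra.
Qed.

Lemma sp_charE la : half_integral la ->
  sp_char la = det_alt xvar (-1) (doubled la + staircase n 0)
               / det_alt xvar (-1) (staircase n 0).
Proof.
move=> hla; rewrite /sp_char (alt_minusE (shifted hla (_ : 2 * 1 - 2 = 0%:~R))) //.
have h0 : half_integral (0 : indexseq n) by move=> i; rewrite ffunE mulr0.
congr (_ / _); rewrite -[staircase n 0]add0r.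
have -> : 0 = doubled 0 by apply/ffunP => i; rewrite !ffunE mulr0 floor0.
apply: alt_minusE => i; rewrite -(shifted h0 (_ : 2 * 1 - 2 = 0%:~R)) //.
by rewrite ffunE add0r.
Qed.

Lemma so_odd_charE la : half_integral la ->
  so_odd_char la = det_alt xvar (-1) (doubled la + staircase n (-1))
               / det_alt xvar (-1) (staircase n (-1)).
Proof.
move=> hla; rewrite /so_odd_char (alt_minusE (shifted hla (_ : 2 * (1 / 2) - 2 = (-1)%:~R))) //.
have h0 : half_integral (0 : indexseq n) by move=> i; rewrite ffunE mulr0.
congr (_ / _); rewrite -[staircase n _]add0r.
have -> : 0 = doubled 0 by apply/ffunP => i; rewrite !ffunE mulr0 floor0.
apply: alt_minusE => i; rewrite -(shifted h0 (_ : 2 * (1/2) - 2 = (-1)%:~R)) //.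
by rewrite ffunE add0r.
Qed.

(** In the denominator the determinant of the differences vanishes, as the last
exponent is 0. *)
Lemma so_even_charE la (b : 'I_n) : b.+1 = n -> half_integral la ->
  so_even_char la = even_alt xvar (doubled la + staircase n (-2))
               / even_alt xvar (staircase n (-2)).
Proof.
move=> bn hla; have e (i : 'I_n) : 2 * (la i + n%:R - i.+1%:R) =
  ((doubled la + staircase n (-2)) i)%:~R.
  by rewrite -(shifted hla (_ : 2 * 0 - 2 = (-2)%:~R)) // addr0.
rewrite /so_even_char (alt_minusE e) (alt_plusE e); congr (_ / _).
have h0 : half_integral (0 : indexseq n) by move=> i; rewrite ffunE mulr0.
have e0 (i : 'I_n) : 2 * (n%:R - i.+1%:R : rat) = (staircase n (-2) i)%:~R.
  rewrite -[staircase n _]add0r.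
  have -> : 0 = doubled 0 by apply/ffunP => j; rewrite !ffunE mulr0 floor0.
  by rewrite -(shifted h0 (_ : 2 * 0 - 2 = (-2)%:~R)) // ffunE add0r addr0.
rewrite (alt_plusE e0) /even_alt [X in _ + X](_ : _ = 0) ?addr0 //.
rewrite /det_alt (expand_det_row _ b) big1 // => j _; rewrite mxE.
have -> : staircase n (-2) b = 0 by rewrite ffunE; lia.
by rewrite oppr0 expr0z mulN1r subrr mul0r.
Qed.

End Characters.

(** * Counting fillings by walks *)

Section Counting.
Variables (n d : nat) (c : rat) (la : indexseq n) (b : rat) (lz : 'I_n -> int).
Hypothesis dc : 2 * c = d%:R.
Hypothesis la_lz : forall i, la i = b + (lz i)%:~R.
Hypothesis lz_dec : forall i j : 'I_n, (i < j)%N -> lz j <= lz i.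
Local Notation col := {set 'I_n}.
Local Notation word := (d.-tuple col).

Definition end_shape (t : seq col) : indexseq n := [ffun i => la i + (cnt t d i)%:R - c].

Definition walk_in_chamber (t : seq col) : Prop :=
  (forall l, (l.+1 < d)%N -> col_le (nth set0 t l.+1) (nth set0 t l)) /\
  (forall l (i i' : 'I_n), i' = i.+1 :> nat -> (l <= d)%N ->
     lz i' + (cnt t l i')%:Z <= lz i + (cnt t l i)%:Z).

Definition content (rho : indexseq n) (F : filling la rho) : indexseq n :=
  [ffun e => #|[set x | F x == e]|%:R].

Lemma has_contentE rho (mu : indexseq n) (F : filling la rho) :
  has_content mu F = (content F == mu).
Proof.
apply/forallP/eqP => [H|<- e]; last by rewrite ffunE.
by apply/ffunP => e; rewrite ffunE; apply/eqP/H.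
Qed.

Section Shape.
Variable nu : indexseq n.
Hypothesis nu_dec : weakly_decreasing nu.
Hypothesis nu_int : forall i, nu i + c - la i \is a Num.int.
Local Notation rho := (nu + rect n c).
Local Notation len i := (Num.truncn (rho i - la i)).

Lemma rhoE i : rho i = nu i + c.
Proof. by rewrite !ffunE. Qed.

Lemma lenE i : contained la rho -> la i + (len i)%:R = nu i + c.
Proof.
move=> /forallP/(_ i); rewrite rhoE => h.
by rewrite truncnK ?rhoE ?subrKC // natrEint nu_int subr_ge0.
Qed.

Lemma len_dec (i j : 'I_n) : contained la rho -> (i < j)%N ->
  lz j + (len j)%:Z <= lz i + (len i)%:Z.
Proof.
move=> cont ij; have := lenE i cont; have := lenE j cont.
have /forallP/(_ i)/forallP/(_ j)/implyP/(_ ij) := nu_dec.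
rewrite -(ler_int rat) !la_lz !intrD -!pmulrn; lra.
Qed.

Lemma content_entries (F : filling la rho) e : content F e = (entries_above F e n)%:R.
Proof. by rewrite ffunE entries_above_n. Qed.

Lemma LR_conditionsP (F : filling la rho) (A : set (indexseq n)) :
  contained la rho -> (A `<=` partitions_in (rect n (2 * c)))%classic ->
  semistandard F -> lattice_word (reading_word F) -> A (content F) -> LR_conditions d lz F.
Proof.
move=> cont AP /(semistandardP la_lz)[h1 h2] h3 /AP [_ /forallP h4]; split=> //.
  exact: lattice_word_ballot.
by move=> e; have := h4 e; rewrite content_entries ffunE dc ler_nat.
Qed.

Lemma content_partition (F : filling la rho) : LR_conditions d lz F ->
  partitions_in (rect n (2 * c)) (content F).
Proof.
case=> h1 h2 h3 h4; split; last by apply/forallP => e; rewrite content_entries ffunE dc ler_nat.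
apply/and3P; split; apply/forallP => e; rewrite ?content_entries ?ler0n //.
apply/forallP => e'; apply/implyP => ee; rewrite !content_entries ler_nat.
exact: (ballot_weak h3 (ltnW ee)).
Qed.

Lemma LR_conditions_filling (F : filling la rho) : LR_conditions d lz F ->
  semistandard F /\ lattice_word (reading_word F).
Proof.
case=> h1 h2 h3 h4; split; first exact/(semistandardP la_lz).
exact: ballot_lattice_word.
Qed.

Lemma walk_conditions_end t : contained la rho ->
  walk_conditions d la rho lz t <-> walk_in_chamber t /\ end_shape t = nu.
Proof.
move=> cont; split=> [[h1 h2 h3]|[[h1 h2] h3]]; split=> //.
  by apply/ffunP => i; rewrite ffunE h3 lenE // addrK.
move=> i; have e1 := lenE i cont; have := congr1 (fun f : indexseq n => f i) h3.
rewrite /= ffunE => e2; apply/eqP; rewrite -(eqr_nat rat); apply/eqP.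
by move: e1 e2; lra.
Qed.

(** The sum over mu removes the condition on the content, up to membership in A; what
remains is in bijection with walks through [col_word]. *)
Lemma LR_count (K : nzRingType) (A : set (indexseq n)) (prop : pred (filling la rho))
    (good : pred word) :
  (A `<=` partitions_in (rect n (2 * c)))%classic ->
  (forall t, good t -> walk_in_chamber t) ->
  (contained la rho -> forall F, LR_conditions d lz F ->
     (A (content F) /\ prop F) <-> good (col_word d F)) ->
  (\sum_(mu \in A) (#|[set F : filling la rho | LR_filling mu F && prop F]|%:R : K))%R
  = #|[set t : word | good t && (end_shape t == nu)]|%:R.
Proof.
move=> AP goodP propP.
have finA : finite_set A.
  exact: sub_finite_set AP (finite_partitions_in (rect n (2 * c))).
have [cont|ncont] := boolP (contained la rho); last first.
  rewrite fsbig1 => [|mu _].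
    rewrite (_ : [set t | _ & _]%SET = finset.set0) ?cards0 //.
    apply/setP => t; rewrite !inE; apply/negP => /andP[gt /eqP et].
    move/negP: ncont; apply; apply/forallP => i; rewrite rhoE -et ffunE subrK.
    by rewrite lerDl ler0n.
  rewrite (_ : [set F | _ & _]%SET = finset.set0) ?cards0 //.
  by apply/setP => F; rewrite !inE /LR_filling (negbTE ncont).
pose P (F : filling la rho) := [&& semistandard F, lattice_word (reading_word F),
  `[< A (content F) >] & prop F].
transitivity (\sum_(mu \in A) (1 : K) * #|[set F | P F && (content F == mu)]|%:R)%R.
  apply: eq_fsbigr => mu /set_mem Amu; rewrite mul1r; congr _%:R; apply: eq_card => F.
  rewrite !inE /LR_filling cont has_contentE /P; case: eqP => [->|]; rewrite ?andbF //.
  by rewrite (asboolT Amu) !andbT -!andbA.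
rewrite fsbig_count // => [|F /and4P[_ _ /asboolP //]].
rewrite sumr_const -[#|P|]/(#|[pred F | P F]|); congr _%:R.
have PE F : P F -> LR_conditions d lz F.
  by case/and4P => h1 h2 /asboolP h3 _; apply: LR_conditionsP h3.
have rz (i j : 'I_n) : (i < j)%N -> lz j + (len j)%:Z <= lz i + (len i)%:Z by exact: len_dec.
rewrite -(@card_in_imset _ _ (@col_word n d la rho) P); last first.
  by move=> F F' /PE h /PE h' ; apply: (col_word_inj la_lz lz_dec rz h h').
apply: eq_card => t; rewrite inE; apply/imsetP/andP => [[F PF ->]|[gt /eqP et]].
  have [_ _ /asboolP AF pF] := and4P PF.
  have := col_word_walk la_lz lz_dec rz (PE F PF) => /(walk_conditions_end _ cont) [_ ->].
  by split=> //; apply/(propP cont _ (PE F PF)).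
have wt : walk_conditions d la rho lz t by apply/walk_conditions_end => //; split=> //;
  apply: goodP.
have LRF := walk_filling_LR wt.
have et' : col_word d (walk_filling d la rho t) = t.
  by apply: val_inj; apply: (walk_filling_col_word la_lz lz_dec rz wt); rewrite size_tuple.
exists (walk_filling d la rho t) => //.
have [h1 h2] := LR_conditions_filling LRF.
have [h3 h4] := (propP cont _ LRF).2 ltac:(by rewrite et').
by rewrite unfold_in; apply/and4P; split=> //; apply/asboolP.
Qed.

End Shape.
End Counting.

(** * The product rule *)

Section WalkConditions.
Variable n : nat.
Local Notation col := {set 'I_n}.
Local Notation weight := {ffun 'I_n -> int}.

Lemma walk_ok_nthP p (good : pred weight) (D : col) (w : weight) (t : seq col) :
  reflect ((forall l, (l < size t)%N ->
              step_ok p (size t - l.+1)%N (nth set0 (D :: t) l) (nth set0 t l)) /\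
           (forall l, (l < size t)%N -> good (w + total_weight (take l.+1 t))))
          (walk_ok p good D w t).
Proof.
elim: t D w => [|C t IH] D w /=; first by apply: ReflectT.
have tot u : total_weight (C :: u) = col_weight C + total_weight u.
  by rewrite /total_weight big_cons.
have tot0 : total_weight ([::] : seq col) = 0 by rewrite /total_weight big_nil.
apply: (iffP and3P) => [[h1 h2 /IH [h3 h4]]|[h1 h2]].
  split=> [[|l]|[|l]] //= lt; rewrite ?subn1 ?tot ?take0 ?tot0 ?addr0 ?addrA //.
    by rewrite subSS; apply: h3.
  exact: h4.
have h1' := h1 0%N isT; have h2' := h2 0%N isT.
rewrite /= subn1 in h1'; rewrite /= take0 tot tot0 addr0 in h2'.
split=> //; apply/IH; split=> l lt; first by have := h1 l.+1 lt; rewrite /= subSS.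
by have := h2 l.+1 lt; rewrite /= tot addrA.
Qed.

Lemma total_weight_take (t : seq col) l i : (l <= size t)%N ->
  total_weight (take l t) i = 2 * (cnt t l i)%:Z - l%:Z.
Proof.
elim: l => [|l IH] lt; first by rewrite take0 /total_weight big_nil ffunE cnt0.
rewrite (take_nth set0 lt) /total_weight big_rcons /= ffunE -/(total_weight _).
by rewrite IH 1?ltnW // cntS !ffunE; case: (i \in _) => /=; lia.
Qed.

End WalkConditions.

Section ProductRule.
Variables (n d : nat) (c : rat) (la : indexseq n) (b : rat) (lz : 'I_n -> int) (b2 : int).
Hypothesis dc : 2 * c = d%:R.
Hypothesis la_lz : forall i, la i = b + (lz i)%:~R.
Hypothesis bb : 2 * b = b2%:~R.
Hypothesis lz_dec : forall i j : 'I_n, (i < j)%N -> lz j <= lz i.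
Local Notation col := {set 'I_n}.
Local Notation word := (d.-tuple col).
Local Notation weight := {ffun 'I_n -> int}.
Local Notation K := (charField n).

Lemma double_la i : 2 * la i = (b2 + 2 * lz i)%:~R.
Proof. by rewrite la_lz intrD intrM -bb; ring. Qed.

Lemma doubled_la i : doubled la i = b2 + 2 * lz i.
Proof. by rewrite ffunE double_la intrKfloor. Qed.

Lemma half_integral_la : half_integral la.
Proof. by move=> i; rewrite double_la. Qed.

Lemma double_end_shape t i :
  2 * end_shape d c la t i = (b2 + 2 * lz i + 2 * (cnt t d i)%:Z - d%:Z)%:~R.
Proof.
rewrite ffunE mulrBr mulrDr double_la dc !intrB !intrD !intrM.
by rewrite -!pmulrn.
Qed.

Lemma half_integral_end_shape t : half_integral (end_shape d c la t).
Proof. by move=> i; rewrite double_end_shape. Qed.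

Variable q : int.
Let w0 := doubled la + staircase n q.

Lemma partial_weight (t : word) l i : (l <= d)%N ->
  (w0 + total_weight (take l t)) i =
  b2 + 2 * lz i + 2 * (cnt t l i)%:Z - l%:Z + 2 * (n - i)%N%:Z + q.
Proof.
move=> ld; rewrite ffunE total_weight_take ?size_tuple // ffunE doubled_la ffunE.
ring.
Qed.

Lemma end_weight (t : word) :
  w0 + total_weight t = doubled (end_shape d c la t) + staircase n q.
Proof.
apply/ffunP => i; rewrite -[tval t in LHS](@take_oversize _ d) ?size_tuple //.
rewrite partial_weight // [RHS]ffunE [doubled _ i]ffunE double_end_shape intrKfloor ffunE.
ring.
Qed.

Lemma decreasing_partial (t : word) l : (l <= d)%N ->
  decreasing (w0 + total_weight (take l t)) <->
  (forall i i' : 'I_n, i' = i.+1 :> nat ->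
     lz i' + (cnt t l i')%:Z <= lz i + (cnt t l i)%:Z).
Proof.
move=> ld; split=> [/forallP H i i' ii'|H].
  have /forallP/(_ i')/implyP/(_ (introT eqP ii')) := H i.
  rewrite !partial_weight // ii'; have := ltn_ord i'; lia.
apply/forallP => i; apply/forallP => i'; apply/implyP => /eqP ii'.
rewrite !partial_weight //; have := H i i' ii'; rewrite ii'.
have := ltn_ord i'; lia.
Qed.

Lemma walk_ok_chamberP (p : nat -> nat -> nat ->
  bool) (lg : pred weight) (D0 : col) (t : word) :
  (forall C : col, p d.-1 #|C| #|D0| -> col_le C D0) ->
  walk_ok p (dominant lg) D0 w0 t <->
  [/\ walk_in_chamber d lz t,
      forall l, (l < d)%N -> p (d - l.+1)%N #|nth set0 t l| #|nth set0 (D0 :: t) l|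
    & forall l, (0 < l <= d)%N -> lg (w0 + total_weight (take l t))].
Proof.
move=> topD; split=> [/walk_ok_nthP|[[h1 h2] h3 h4]].
  rewrite size_tuple => -[h1 h2]; split; first split.
  - by move=> l ld; have /andP[] := h1 _ ld.
  - move=> [|l] i i' ii' ld; last first.
      have /andP[dec _] := h2 _ ld; exact: (decreasing_partial t ld).1 dec i i' ii'.
    by rewrite !cnt0 !addr0; apply: lz_dec; rewrite ii'.
  - by move=> l ld; have /andP[] := h1 _ ld.
  - by move=> [|l] // ld; have /andP[] := h2 _ ld.
apply/walk_ok_nthP; rewrite size_tuple; split=> l ld.
  rewrite /step_ok h3 // andbT; case: l ld => [|l] ld /=; last exact: h1.
  by apply: topD; have := h3 0%N ld; rewrite subn1.
apply/andP; split; last exact: h4.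
by apply/decreasing_partial => // i i' ii'; apply: h2.
Qed.

(** Grouping the walks in the chamber by their end points nu turns the sum of their
characters into a sum over nu of numbers of fillings.  The hypothesis on Q makes
it both the character of the rectangle and the multiplier of alternants. *)
Lemma product_rule (chi : indexseq n -> K) (alt : weight -> K)
    (p : nat -> nat -> nat -> bool) (lg : pred weight) (D0 : col)
    (S M : set (indexseq n)) (prop : forall nu, pred (filling la (nu + rect n c))) :
  (forall nu, half_integral nu ->
     chi nu = alt (doubled nu + staircase n q) / alt (staircase n q)) ->
  (exists Q,
     Q * alt w0 = \sum_(t : word | walk_ok p (dominant lg) D0 w0 t) alt (w0 + total_weight t) /\
     Q * alt (staircase n q) = alt (staircase n q + col_weight setT *+ d)) ->
  finite_set S ->
  (forall t : word, walk_ok p (dominant lg) D0 w0 t -> S (end_shape d c la t)) ->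
  (forall nu, S nu -> weakly_decreasing nu /\ forall i, nu i + c - la i \is a Num.int) ->
  (M `<=` partitions_in (rect n (2 * c)))%classic ->
  (forall C : col, p d.-1 #|C| #|D0| -> col_le C D0) ->
  (forall nu, S nu -> contained la (nu + rect n c) ->
     forall F : filling la (nu + rect n c), LR_conditions d lz F ->
     (M (content F) /\ prop nu F) <-> walk_ok p (dominant lg) D0 w0 (col_word d F)) ->
  chi (rect n c) * chi la =
  (\sum_(nu \in S) chi nu *
     \sum_(mu \in M) (#|[set F : filling la (nu +
       rect n c) | LR_filling mu F && prop nu F]|%:R : K))%R.
Proof.
move=> chiE [Q [Q1 Q2]] finS endS Sint MP topD propP.
transitivity (\sum_(t : word | walk_ok p (dominant lg) D0 w0 t) chi (end_shape d c la t)).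
  have chi_end t : chi (end_shape d c la t) =
      alt (doubled (end_shape d c la t) + staircase n q) / alt (staircase n q).
    exact/chiE/half_integral_end_shape.
  under eq_bigr => t _ do rewrite chi_end -end_weight.
  have hr : half_integral (rect n c) by move=> i; rewrite ffunE dc.
  rewrite -mulr_suml -Q1 (chiE _ half_integral_la) (chiE _ hr).
  have -> : doubled (rect n c) + staircase n q = staircase n q + col_weight setT *+ d.
    apply/ffunP => i; rewrite addrC [LHS]ffunE [RHS]ffunE col_weightT_mul !ffunE dc.
    by rewrite (intrKfloor d%:Z).
  (* If the denominator is 0, so are all the quotients. *)
  rewrite -Q2; have [->|nz] := eqVneq (alt (staircase n q)) 0.
    by rewrite invr0 !mulr0.
  by rewrite mulfK // mulrA.
rewrite -(fsbig_count chi finS endS); apply: eq_fsbigr => nu /set_mem Snu.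
congr (_ * _); have [nu_dec nu_int] := Sint nu Snu; symmetry.
have H := (@LR_count n d c la b lz dc la_lz lz_dec nu nu_dec nu_int K M (@prop nu)
 (fun t : word => walk_ok p (dominant lg) D0 w0 t) MP).
rewrite H //; first by move=> t /(walk_ok_chamberP _ _ topD)[].
by move=> cont F LRF; apply: propP.
Qed.

End ProductRule.

(** * The conditions on fillings read on the walk *)

Lemma half_nat_int (N : nat) : ((N%:R : rat) / 2 \is a Num.int) = ~~ odd N.
Proof.
apply/intrP/idP => [[z e]|ev].
  have : (N%:Z)%:~R = (2 * z)%:~R :> rat.
    by rewrite intrM -e mulrC divfK // pmulrn.
  by move/intr_inj; lia.
exists (N./2)%:Z; rewrite -[in LHS](odd_double_half N) (negbTE ev) add0n -muln2 natrM mulfK //.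
Qed.

(** In column k + 1 of the complement of mu lie the rows e with mu e at most k. *)
Lemma oddcols_eq0 (n d : nat) (mu : indexseq n) (N : 'I_n -> nat) :
  (forall e, mu e = (N e)%:R) -> (forall e, (N e <= d)%N) ->
  oddcols mu (rect n d%:R) = 0%N <->
  (forall k, (k < d)%N -> ~~ odd #|[set e | (N e <= k)%N]|).
Proof.
move=> muN Nd; pose cellT := cell mu (rect n d%:R).
have lenE e : Num.truncn (rect n d%:R e - mu e) = (d - N e)%N.
  by rewrite ffunE muN -natrB // natrK.
have colE (x : cellT) : col_of x = (N (tag x) + tagged x).+1%:R.
  case: x => e p; rewrite /col_of /=; move: (nat_of_ord p) => m.
  by rewrite muN -natrD addnS.
have colcard k : (k < d)%N ->
    #|[set x : cellT | col_of x == k.+1%:R]| = #|[set e | (N e <= k)%N]|.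
  move=> kd; rewrite -(@card_in_imset _ _ (fun x : cellT => tag x)); last first.
    move=> [e p] [e' p'] ; rewrite !inE !colE !eqr_nat /= => /eqP [h] /eqP [h'] ee.
    subst e'; congr existT; apply: val_inj => /=.
    by apply/eqP; rewrite -(eqn_add2l (N e)) h h'.
  apply: eq_card => e; rewrite inE; apply/imsetP/idP => [[x]|le].
    by rewrite inE colE eqr_nat eqSS => /eqP <- ->; rewrite leq_addr.
  have pl : (k - N e < Num.truncn (rect n d%:R e - mu e))%N by rewrite lenE; lia.
  exists (Tagged (fun i => 'I_(Num.truncn (rect n d%:R i - mu i))) (Ordinal pl)) => //.
  by rewrite inE colE /= subnKC.
rewrite /oddcols; split=> [/eqP h k kd|h].
  move: h; rewrite -leqn0 leqNgt -has_count => /hasPn h.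
  have [e0|[e eS]] := set_0Vmem [set e | (N e <= k)%N]; first by rewrite e0 cards0.
  rewrite -colcard //; apply: (h (k.+1%:R)); rewrite mem_undup.
  have : (0 < #|[set x : cellT | col_of x == k.+1%:R]|)%N.
    by rewrite colcard //; apply/card_gt0P; exists e.
  case/card_gt0P => x; rewrite inE => /eqP <-; exact: image_f.
apply/eqP; rewrite -leqn0 leqNgt -has_count; apply/hasPn => j.
rewrite mem_undup => /mapP [x _ ->]; have kd : (N (tag x) + tagged x < d)%N.
  have := ltn_ord (tagged x); rewrite {2}lenE => lt.
  by have := Nd (tag x); lia.
by rewrite colE colcard //; apply: h.
Qed.

Section FillingProperties.
Variables (n d : nat) (c : rat) (la : indexseq n) (b : rat) (lz : 'I_n -> int) (b2 : int).
Hypothesis dc : 2 * c = d%:R.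
Hypothesis la_lz : forall i, la i = b + (lz i)%:~R.
Hypothesis bb : 2 * b = b2%:~R.
Hypothesis lz_dec : forall i j : 'I_n, (i < j)%N -> lz j <= lz i.
Local Notation col := {set 'I_n}.
Variable nu : indexseq n.
Hypothesis nu_dec : weakly_decreasing nu.
Hypothesis nu_int : forall i, nu i + c - la i \is a Num.int.
Local Notation rho := (nu + rect n c).
Hypothesis cont : contained la rho.
Variable F : filling la rho.
Hypothesis LRF : LR_conditions d lz F.

Let rz (i j : 'I_n) (ij : (i < j)%N) := len_dec la_lz nu_dec nu_int cont ij.

Lemma card_col_word l : (l < d)%N ->
  #|nth set0 (col_word d F) l| = #|[set e | (d - l.+1 < entries_above F e n)%N]|.
Proof.
move=> ld; have [h1 h2 h3 h4] := LRF.
by rewrite col_word_nth // -nbelowT (nbelow_colset la_lz lz_dec rz h1 h2 h3).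
Qed.

Lemma col_word_end : walk_in_chamber d lz (col_word d F) /\
  end_shape d c la (col_word d F) = nu.
Proof.
by apply/(walk_conditions_end d lz nu_int _ cont); apply: (col_word_walk la_lz lz_dec rz).
Qed.

Lemma end_col_word i : 2 * nu i = (b2 + 2 * lz i + 2 * (cnt (col_word d F) d i)%:Z - d%:Z)%:~R.
Proof. by rewrite -(double_end_shape dc la_lz bb) col_word_end.2. Qed.

(** The distance to the last wall decreases except at the steps that add a cell to
the last row, so it suffices to test it before these steps and at the end.  For
a cell x of the last row with k copies to the right, the test before the step
that adds x is the inequality of the property. *)
Lemma last_row_walk (l0 : 'I_n) : l0.+1 = n -> 0 <= nu l0 ->
  last_row_property c F <->
  (forall l, (l <= d)%N -> l%:Z <= b2 + 2 * lz l0 + 2 * (cnt (col_word d F) l l0)%:Z).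
Proof.
move=> ln nu0; have [h1 h2 h3 h4] := LRF.
have xP x : row_of x = l0 ->
  (2 * c - 2 * col_of x + 1 <= (copies_to_right F x)%:R) =
  ((d - (copies F x).+1)%N%:Z <= b2 + 2 * lz l0 +
    2 * (cnt (col_word d F) (d - (copies F x).+1) l0)%:Z).
  move=> xl; have cx := copies_lt_size la_lz lz_dec rz h1 h2 h4 x.
  have := cnt_pos la_lz lz_dec rz h1 h2 h3 h4 x; rewrite xl => ->.
  have -> : 2 * c - 2 * col_of x + 1 = (d%:Z - b2 - 2 * icol lz x + 1)%:~R.
    rewrite (col_ofE la_lz); move: (icol lz x) => z.
    by rewrite !intrD !intrN (intrM _ 2) -bb -[(d%:Z)%:~R]pmulrn -dc; ring.
  rewrite -/(copies F x) -[(copies F x)%:R]/((copies F x)%:Z%:~R) ler_int /icol xl.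
  by apply/idP/idP; lia.
split=> [/forallP H l ld|H].
  have [k ek] : exists k, (l + k = d)%N by exists (d - l)%N; rewrite subnKC.
  elim: k l ek {ld} => [|k IH] l ek.
    have -> : l = d by lia.
    have : 0 <= 2 * nu l0 by rewrite mulr_ge0.
    rewrite end_col_word; rewrite (ler_int rat 0); lia.
  have := IH l.+1 ltac:(lia); rewrite cntS.
  case: (boolP (l0 \in _)) => [|_]; last by lia.
  have ld : (l < d)%N by lia.
  rewrite col_word_nth // => /in_colset [x xl xk].
  have := H x; rewrite xl ln eqxx /= (xP x xl) xk.
  by have -> : (d - (d - l.+1).+1)%N = l by lia.
apply/forallP => x; apply/implyP => /eqP xl.
have xl0 : row_of x = l0 by apply: ord_inj; lia.
by rewrite (xP x xl0); apply: H; rewrite leq_subr.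
Qed.

Lemma orth_walk (i0 j0 : 'I_n) : i0.+2 = n -> j0.+1 = n ->
  orth_property c F <->
  (forall l, (0 < l <= d)%N -> l%:Z <= b2 + lz i0 + lz j0
     + (cnt (col_word d F) l i0)%:Z + (cnt (col_word d F) l j0)%:Z).
Proof.
move=> i0n j0n; have [h1 h2 h3 h4] := LRF.
have td : Num.truncn (2 * c) = d by rewrite dc natrK.
have shapeE l i : (l <= d)%N ->
    remaining_shape (d - l) F i = la i + (cnt (col_word d F) l i)%:R.
  move=> ld; rewrite ffunE (cnt_col_word la_lz lz_dec rz h1 h2 h3 h4) //; congr (_ + _%:R).
  by apply: eq_card => x; rewrite !inE andbC.
have lP l : (l <= d)%N ->
   (l%:R <= remaining_shape (d - l) F i0 + remaining_shape (d - l) F j0) =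
   (l%:Z <= b2 + lz i0 + lz j0 + (cnt (col_word d F) l i0)%:Z + (cnt (col_word d F) l j0)%:Z).
  move=> ld; rewrite !shapeE // !la_lz -(ler_int rat) !intrD -bb -!pmulrn.
  by congr (_ <= _); ring.
rewrite /orth_property td; split=> [/forallP H l /andP[l0 ld]|H].
  have := H (Ordinal (ld : (l < d.+1)%N)); rewrite /= l0 /= => /forallP/(_ i0)/forallP/(_ j0).
  by rewrite i0n j0n !eqxx /= lP.
apply/forallP => l; apply/implyP => l0; apply/forallP => i; apply/forallP => j.
apply/implyP => /andP[/eqP i2 /eqP j1].
have -> : i = i0 by apply: ord_inj; lia.
have -> : j = j0 by apply: ord_inj; lia.
have ld : (l <= d)%N by rewrite -ltnS.
by rewrite lP //; apply: H; rewrite l0.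
Qed.

(** A row of odd length 2k + 1 ends in column 2k of the tableau, which is then longer
than column 2k + 1. *)
Lemma even_rows_walk k : d = k.*2 ->
  even_rows (content F) <->
  (forall l, (l < d)%N -> pair_size (d - l.+1) #|nth set0 (col_word d F) l|
                            #|nth set0 (set0 :: col_word d F) l|).
Proof.
move=> dk; have [_ _ _ h4] := LRF.
have evE : even_rows (content F) = [forall e, ~~ odd (entries_above F e n)].
  by apply: eq_forallb => e; rewrite content_entries half_nat_int.
rewrite evE; split=> [/forallP ev l ld|H].
  rewrite /pair_size; case: (boolP (odd _)) => //= od.
  case: l ld od => [|l] ld od.
    by move: od; rewrite subn1 dk; case: k dk ld => [->//|k dk _];
      rewrite doubleS /= odd_double.
  rewrite /= !card_col_word ?(ltnW ld) //; apply/eqP/eq_card => e; rewrite !inE.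
  have ne : (d - l.+2).+1 != entries_above F e n.
    by apply: contraNneq (ev e) => <-; rewrite /= od.
  by move: ne; lia.
apply/forallP => e; apply/negP => od; have Npos := odd_gt0 od; have Nd := h4 e.
have od' : odd (entries_above F e n).-1 = false by rewrite -(prednK Npos) /= in od;
  apply/negbTE.
have ld : (d - entries_above F e n < d)%N by lia.
have := H _ ld; rewrite /pair_size.
have -> : (d - (d - entries_above F e n).+1 = (entries_above F e n).-1)%N by lia.
rewrite od' /=; case el : (d - entries_above F e n)%N => [|l].
  exfalso; have Nd' : d = entries_above F e n by lia.
  by move: od; rewrite -Nd' dk odd_double.
rewrite /= !card_col_word; [|by lia|by lia].
apply/negP; rewrite neq_ltn orbC; apply/orP; left.
apply: proper_card; apply/properP; split.
  by apply/subsetP => e'; rewrite !inE; lia.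
by exists e; rewrite !inE; lia.
Qed.

Lemma oddcols_walk (D0 : col) : odd #|D0| = odd n ->
  oddcols (content F) (rect n (2 * c)) = 0%N <->
  (forall l, (l < d)%N -> even_size (d - l.+1) #|nth set0 (col_word d F) l|
                            #|nth set0 (D0 :: col_word d F) l|).
Proof.
move=> oD; have [_ _ _ h4] := LRF; rewrite dc (oddcols_eq0 (fun e => content_entries F e) h4).
have cE k : (k < d)%N -> ~~ odd #|[set e | (entries_above F e n <= k)%N]| =
    (odd #|nth set0 (col_word d F) (d - k.+1)| == odd n).
  move=> kd; rewrite card_col_word; last by lia.
  have -> : (d - (d - k.+1).+1 = k)%N by lia.
  have -> : odd n = odd (#|[set e | (entries_above F e n <= k)%N]| +
    #|~: [set e | (entries_above F e n <= k)%N]|).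
    by rewrite cardsC card_ord.
  have -> : ~: [set e | (entries_above F e n <= k)%N] = [set e | (k < entries_above F e n)%N].
    by apply/setP => e; rewrite !inE ltnNge.
  by rewrite oddD; case: (odd _); case: (odd _).
split=> [H l ld|H k kd].
  have key m : (m < d)%N -> odd #|nth set0 (col_word d F) m| = odd n.
    move=> md; have := H (d - m.+1)%N ltac:(lia); rewrite cE; last by lia.
    have -> : (d - (d - m.+1).+1 = m)%N by lia. by move/eqP.
  rewrite /even_size (key _ ld); case: l ld => [|l] ld /=; first by rewrite oD eqxx.
  by rewrite (key _ (ltnW ld)) eqxx.
rewrite cE //; have : (d - k.+1 < d)%N by lia.
elim: (d - k.+1)%N => [|l IH] ld; first by have := H _ ld; rewrite /even_size /= oD.
have /eqP := H _ ld => /= ->; exact: IH (ltnW ld).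
Qed.

End FillingProperties.

(** * The three product rules *)

Section Kinds.
Variable n : nat.
Implicit Types (la mu nu : indexseq n) (c : rat).

Definition one_kind la : Prop :=
  (forall i, la i \is a Num.int) \/ (forall i, half_integer (la i)).

Lemma half_integerP (x : rat) : reflect (exists z : int, x = 1 / 2 + z%:~R) (half_integer x).
Proof.
apply: (iffP idP) => [/intrP[z e]|[z ->]]; last by rewrite /half_integer addrAC subrr add0r.
by exists z; rewrite -e subrKC.
Qed.

Lemma one_kind_base la : weakly_decreasing la -> one_kind la ->
  exists b (lz : 'I_n -> int) b2,
    [/\ forall i, la i = b + (lz i)%:~R, 2 * b = b2%:~R
      & forall i j : 'I_n, (i < j)%N -> lz j <= lz i].
Proof.
move=> dec kind; suff [b [lz [b2 [h1 h2]]]] : exists b (lz : 'I_n -> int) b2,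
    (forall i, la i = b + (lz i)%:~R) /\ 2 * b = b2%:~R.
  exists b, lz, b2; split=> // i j ij.
  have /forallP/(_ i)/forallP/(_ j)/implyP/(_ ij) := dec.
  by rewrite !h1 lerD2l ler_int.
case: kind => H.
  exists 0, (fun i => Num.floor (la i)), 0; split=> [i|]; last by rewrite mulr0.
  by rewrite add0r floorK.
exists (1 / 2), (fun i => Num.floor (la i - 1 / 2)), 1; split=> [i|];
  last by rewrite mulrC divfK.
by rewrite floorK ?subrKC //; apply: H.
Qed.

Lemma one_kind_add la c : one_kind la -> (c \is a Num.int) \/ half_integer c ->
  one_kind (la + rect n c).
Proof.
move=> [H|H] [hc|hc].
- by left=> i; rewrite !ffunE rpredD.
- right=> i; rewrite !ffunE; apply/half_integerP.
  by have /intrP[z ->] := H i; have /half_integerP[y ->] := hc; exists (z + y); rewrite intrD;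
    ring.
- right=> i; rewrite !ffunE; apply/half_integerP.
  by have /half_integerP[z ->] := H i; have /intrP[y ->] := hc; exists (z + y); rewrite intrD;
    ring.
- left=> i; rewrite !ffunE; apply/intrP.
  have /half_integerP[z ->] := H i; have /half_integerP[y ->] := hc.
  by exists (z + y + 1); rewrite !intrD; field.
Qed.

Lemma double_nat c : 0 <= c -> (c \is a Num.int) \/ half_integer c ->
  exists d : nat, 2 * c = d%:R.
Proof.
move=> c0 /int_double h; have : 2 * c \is a Num.nat by rewrite natrEint h mulr_ge0.
by case/natrP => d ->; exists d.
Qed.

Lemma same_kind_diff (x y c : rat) (d : nat) : 2 * c = d%:R ->
  (y + c \is a Num.int) /\ (x \is a Num.int) \/ half_integer (y + c) /\ half_integer x ->
  x + c - y \is a Num.int.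
Proof.
move=> dc H; suff : x - (y + c) \is a Num.int.
  have -> : x + c - y = x - (y + c) + d%:R by rewrite -dc; ring.
  by move=> h; apply: rpredD => //; rewrite pmulrn; apply: intr_int.
case: H => -[]; first by move=> h1 h2; rewrite rpredB.
move=> /half_integerP[z ->] /half_integerP[u ->].
by rewrite opprD addrACA subrr add0r rpredB ?intr_int.
Qed.

Section EndShape.
Variables (d : nat) (c : rat) (la : indexseq n) (b : rat) (lz : 'I_n -> int) (b2 : int).
Hypothesis dc : 2 * c = d%:R.
Hypothesis la_lz : forall i, la i = b + (lz i)%:~R.
Variable t : d.-tuple {set 'I_n}.

Lemma cnt_le l i : (cnt t l i <= l)%N.
Proof. by elim: l => [|l IH]; rewrite ?cnt0 // cntS; case: (_ \in _) => /=; lia. Qed.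

Lemma end_shape_contained : contained (end_shape d c la t) (la + rect n c).
Proof.
apply/forallP => i; rewrite !ffunE.
have : (cnt t d i)%:R <= d%:R :> rat by rewrite ler_nat cnt_le.
rewrite -dc; lra.
Qed.

Lemma end_shape_shift i :
  end_shape d c la t i = (la + rect n c) i + ((cnt t d i)%:Z - d%:Z)%:~R.
Proof. by rewrite !ffunE intrB -!pmulrn -dc; ring. Qed.

Lemma end_shape_kind :
  ((forall i, (la + rect n c) i \is a Num.int) ->
    forall i, end_shape d c la t i \is a Num.int) /\
  ((forall i, half_integer ((la + rect n c) i)) ->
    forall i, half_integer (end_shape d c la t i)).
Proof.
split=> H i; rewrite end_shape_shift; first by rewrite rpredD ?intr_int.
have /half_integerP[z ->] := H i; apply/half_integerP.
by exists (z + ((cnt t d i)%:Z - d%:Z)); rewrite [in RHS]intrD addrA.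
Qed.

Lemma end_shape_dec : walk_in_chamber d lz t -> weakly_decreasing (end_shape d c la t).
Proof.
case=> _ H; apply/forallP => i; apply/forallP => j; apply/implyP => ij.
rewrite !ffunE lerD2r !la_lz -!addrA lerD2l !pmulrn -!intrD ler_int.
apply: (adjacent_antitone (f := fun i => lz i + (cnt t d i)%:Z)) (ltnW ij) => k k' kk.
exact: H.
Qed.
End EndShape.

Lemma addr_rect_dec la c : weakly_decreasing la -> weakly_decreasing (la + rect n c).
Proof.
move=> /forallP H; apply/forallP => i; apply/forallP => j; apply/implyP => ij.
by rewrite !ffunE lerD2r; have /forallP/(_ j)/implyP/(_ ij) := H i.
Qed.

Lemma dec_last_ge0 (l : 'I_n) la : l.+1 = n -> weakly_decreasing la -> 0 <= la l ->
  forall i, 0 <= la i.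
Proof.
move=> ln /forallP H l0 i; have := ltn_ord i; rewrite -[X in (_ < X)%N]ln ltnS.
rewrite leq_eqVlt => /orP[/eqP/ord_inj -> //|il].
by apply: le_trans l0 _; have /forallP/(_ l)/implyP/(_ il) := H i.
Qed.

End Kinds.

Section Cases.
Variable n : nat.
Local Notation K := (charField n).
Local Notation col := {set 'I_n}.

Section StartingWeight.
Variables (la : indexseq n) (b : rat) (lz : 'I_n -> int) (b2 : int).
Hypothesis la_lz : forall i, la i = b + (lz i)%:~R.
Hypothesis bb : 2 * b = b2%:~R.
Hypothesis lz_dec : forall i j : 'I_n, (i < j)%N -> lz j <= lz i.
Variable q : int.

Lemma starting_weight i : (doubled la + staircase n q) i = b2 + 2 * lz i + 2 * (n - i)%N%:Z + q.
Proof. by rewrite ffunE (doubled_la la_lz bb) ffunE; ring. Qed.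

Lemma starting_decreasing : decreasing (doubled la + staircase n q).
Proof.
apply/forallP => i; apply/forallP => j; apply/implyP => /eqP ij.
have := lz_dec (_ : (i < j)%N); rewrite !starting_weight ij => /(_ (leqnn _)).
have := ltn_ord j; lia.
Qed.

Lemma starting_parity (d : nat) : same_parity (b2 + q - d%:Z) d (doubled la + staircase n q).
Proof. by move=> i; exists (lz i + (n - i)%N%:Z); rewrite starting_weight; lia. Qed.

Lemma last_ge0 i : 0 <= la i -> 0 <= b2 + 2 * lz i.
Proof. by move=> h; rewrite -(ler_int rat) -(double_la la_lz bb) mulr_ge0. Qed.

End StartingWeight.

Lemma symplectic_rule (c : nat) (la : indexseq n) : (0 < n)%N -> is_partition la ->
  sp_char (rect n c%:R) * sp_char la =
  (\sum_(nu \in partitions_in (la + rect n c%:R))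
     sp_char nu *
     \sum_(mu \in [set mu | partitions_in (rect n (2 * c%:R)) mu /\ even_rows mu]%classic)
       ((LR_bar la mu (nu + rect n c%:R) c%:R)%:R : K))%R.
Proof.
move=> n0 /and3P[la_dec /forallP la0 /forallP la_int].
have [l ln] : exists l : 'I_n, l.+1 = n.
  by have h : (n.-1 < n)%N by [rewrite prednK]; exists (Ordinal h); rewrite /= prednK.
pose lz i := Num.floor (la i); pose d := c.*2.
have la_lz i : la i = 0 + (lz i)%:~R by rewrite add0r floorK.
have bb : 2 * 0 = 0%:~R :> rat by rewrite mulr0.
have lz_dec (i j : 'I_n) : (i < j)%N -> lz j <= lz i.
  move=> ij; have /forallP/(_ i)/forallP/(_ j)/implyP/(_ ij) := la_dec.
  by rewrite !la_lz lerD2l ler_int.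
have dc : 2 * c%:R = d%:R :> rat by rewrite /d -muln2 natrM mulrC.
have top (C : col) : pair_size d.-1 #|C| #|(set0 : col)| -> col_le C set0.
  by move=> _; apply/col_leP => v vn; rewrite /nbelow (_ : [set _ in _ | _] = set0) ?cards0 //;
     apply/setP => i; rewrite !inE.
have lgE (t : d.-tuple col) m : (m <= d)%N ->
    (1 < (doubled la + staircase n 0 + total_weight (take m t)) l) =
    (m%:Z <= 0 + 2 * lz l + 2 * (cnt t m l)%:Z).
  by move=> md; rewrite (partial_weight la_lz bb) //; apply/idP/idP; lia.
have okE t := walk_ok_chamberP la_lz bb lz_dec 0 (fun w => 1 < w l) t top.
apply: (product_rule dc la_lz bb lz_dec (q := 0) (p := pair_size)
  (lg := fun w => 1 < w l) (D0 := set0) (alt := det_alt (@xvar n) (-1))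
  (prop := fun nu F => last_row_property c%:R F)).
- exact: sp_charE.
- have [Q [Q1 Q2]] := long_walks (@xvar_neq0 n) (two_neq0 n) ln c; exists Q; split=> //.
  apply: Q1; first (apply/andP; split; first exact: starting_decreasing la_lz bb lz_dec _).
    have := last_ge0 la_lz bb (la0 l); rewrite (starting_weight la_lz bb); lia.
  move=> i; have [z ->] := starting_parity la_lz bb 0 d i; exists (z - c%:Z).
  by rewrite /d; lia.
- exact: finite_partitions_in.
- move=> t /okE [walk _ lg]; have endd := end_shape_dec c%:R la_lz walk.
  split; last exact: end_shape_contained.
  have [kint _] := end_shape_kind la dc t.
  apply/and3P; split=> //; apply/forallP.
    apply: (dec_last_ge0 ln endd).
    suff : 0 <= 2 * end_shape d c%:R la t l by lra.
    rewrite (double_end_shape dc la_lz bb) (ler_int _ 0).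
    case: (posnP d) => [d0|dpos].
      by have := last_ge0 la_lz bb (la0 l); lia.
    by have := lg d; rewrite lgE // dpos leqnn => /(_ isT); lia.
  apply: kint => i; rewrite !ffunE; apply: rpredD => //; rewrite pmulrn; exact: intr_int.
- move=> nu [/and3P[nu_dec _ /forallP nu_int] _]; split=> // i.
  by apply: rpredB => //; apply: rpredD => //; rewrite pmulrn; apply: intr_int.
- by move=> mu [].
- exact: top.
- move=> nu [/and3P[nu_dec /forallP nu0 /forallP nu_int] _] cont F LRF.
  have nu_int' i : nu i + c%:R - la i \is a Num.int.
    by apply: rpredB => //; apply: rpredD => //; rewrite pmulrn; apply: intr_int.
  have [walk _] := col_word_end la_lz lz_dec nu_dec nu_int' cont LRF.
  have evE := even_rows_walk la_lz lz_dec nu_dec nu_int' cont LRF (erefl : d = c.*2).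
  have lastE := last_row_walk dc la_lz bb lz_dec nu_dec nu_int' cont LRF ln (nu0 l).
  rewrite okE; split=> [[[_ ev] last]|[_ sz lg]].
    split=> //; first exact/evE.
    by move=> m /andP[_ md]; rewrite lgE //; apply: lastE.1.
  split; first by split; [exact: (content_partition dc LRF)|exact/evE].
  apply/lastE => -[|m] md; last by rewrite -lgE //; apply: lg.
  by rewrite cnt0; have := last_ge0 la_lz bb (la0 l); lia.
Qed.

Lemma odd_orthogonal_rule (c : rat) (la : indexseq n) : (0 < n)%N ->
  0 <= c -> (c \is a Num.int) \/ half_integer c ->
  is_partition la \/ is_half_partition la ->
  so_odd_char (rect n c) * so_odd_char la =
  (\sum_(nu \in same_kind_partitions_in (la + rect n c))
     so_odd_char nu *
     \sum_(mu \in partitions_in (rect n (2 * c)))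
       ((LR_bar la mu (nu + rect n c) c)%:R : K))%R.
Proof.
move=> n0 c0 kc kla.
have [la_dec [la0 la_kind]] : weakly_decreasing la /\ (forall i, 0 <= la i) /\ one_kind la.
  by case: kla => /and3P[h1 /forallP h2 /forallP h3]; split=> //; split=> //; [left|right].
have [l ln] : exists l : 'I_n, l.+1 = n.
  by have h : (n.-1 < n)%N by [rewrite prednK]; exists (Ordinal h); rewrite /= prednK.
have [b [lz [b2 [la_lz bb lz_dec]]]] := one_kind_base la_dec la_kind.
have [d dc] := double_nat c0 kc.
have top (C : col) : no_size d.-1 #|C| #|(set0 : col)| -> col_le C set0.
  by move=> _; apply/col_leP => v vn; rewrite /nbelow (_ : [set _ in _ | _] = set0) ?cards0 //;
     apply/setP => i; rewrite !inE.
have lgE (t : d.-tuple col) m : (m <= d)%N ->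
    (0 < (doubled la + staircase n (-1) + total_weight (take m t)) l) =
    (m%:Z <= b2 + 2 * lz l + 2 * (cnt t m l)%:Z).
  by move=> md; rewrite (partial_weight la_lz bb) //; apply/idP/idP; lia.
have okE t := walk_ok_chamberP la_lz bb lz_dec (-1) (fun w => 0 < w l) t top.
have sum_kind := one_kind_add la_kind kc.
have range nu : same_kind_partitions_in (la + rect n c) nu ->
    [/\ weakly_decreasing nu, forall i, 0 <= nu i & forall i, nu i + c - la i \is a Num.int].
  case=> [[|]] [] /and3P[_ _ /forallP k1] /and3P[h1 /forallP h2 /forallP k2] _; split=> // i;
    apply: (same_kind_diff dc); have := k1 i; rewrite !ffunE => h; [left|right]; split=> //;
      exact: k2.
apply: (product_rule dc la_lz bb lz_dec (q := -1) (p := no_size)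
  (lg := fun w => 0 < w l) (D0 := set0) (alt := det_alt (@xvar n) (-1))
  (prop := fun nu F => last_row_property c F)).
- exact: so_odd_charE.
- have [Q [Q1 Q2]] := short_walks (@xvar_neq0 n) (two_neq0 n) ln d; exists Q; split=> //.
  apply: Q1 (starting_parity la_lz bb (-1) d).
  apply/andP; split; first exact: starting_decreasing la_lz bb lz_dec _.
  have := last_ge0 la_lz bb (la0 l); rewrite (starting_weight la_lz bb); lia.
- exact: finite_same_kind_partitions_in.
- move=> t /okE [walk _ lg]; have endd := end_shape_dec c la_lz walk.
  have end0 : forall i, 0 <= end_shape d c la t i.
    apply: (dec_last_ge0 ln endd).
    suff : 0 <= 2 * end_shape d c la t l by lra.
    rewrite (double_end_shape dc la_lz bb) (ler_int _ 0).
    case: (posnP d) => [d0|dpos].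
      by have := last_ge0 la_lz bb (la0 l); lia.
    by have := lg d; rewrite lgE // dpos leqnn => /(_ isT); lia.
  have sum0 i : 0 <= (la + rect n c) i by rewrite !ffunE addr_ge0.
  have sumd := addr_rect_dec c la_dec; have [kint khalf] := end_shape_kind la dc t.
  split; last exact: end_shape_contained.
  case: sum_kind => k; [left|right]; split; apply/and3P; split=> //; apply/forallP => //.
    exact: kint.
  exact: khalf.
- by move=> nu /range [].
- by [].
- exact: top.
- move=> nu /range [nu_dec nu0 nu_int] cont F LRF.
  have [walk _] := col_word_end la_lz lz_dec nu_dec nu_int cont LRF.
  have lastE := last_row_walk dc la_lz bb lz_dec nu_dec nu_int cont LRF ln (nu0 l).
  rewrite okE; split=> [[_ last]|[_ _ lg]].
    by split=> // m /andP[_ md]; rewrite lgE //; apply: lastE.1.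
  split; first exact: (content_partition dc LRF).
  apply/lastE => -[|m] md; last by rewrite -lgE //; apply: lg.
  by rewrite cnt0; have := last_ge0 la_lz bb (la0 l); lia.
Qed.

Lemma even_orthogonal_rule (c : rat) (la : indexseq n) : (1 < n)%N ->
  0 <= c -> (c \is a Num.int) \/ half_integer c ->
  is_orth_partition la \/ is_orth_half_partition la ->
  so_even_char (rect n c) * so_even_char la =
  (\sum_(nu \in same_kind_orth_partitions_in (la + rect n c))
     so_even_char nu *
     \sum_(mu \in [set mu | partitions_in (rect n (2 * c)) mu
                            /\ oddcols mu (rect n (2 * c)) = 0%N]%classic)
       ((LR_tilde la mu (nu + rect n c) c)%:R : K))%R.
Proof.
move=> n1 c0 kc kla.
have n2 : (n.-2 < n)%N by lia.
have n3 : (n.-1 < n)%N by lia.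
pose u : 'I_n := Ordinal n2; pose v : 'I_n := Ordinal n3.
have un : u.+2 = n by rewrite /=; lia.
have vn : v.+1 = n by rewrite /=; lia.
have uv : v = u.+1 :> nat by rewrite /=; lia.
have uv' : (u < v)%N by rewrite uv.
have orthP mu : orthogonal_shape mu = weakly_decreasing mu && (0 <= mu u + mu v).
  rewrite /orthogonal_shape; case dec: (weakly_decreasing mu) => //=.
  have le : mu v <= mu u by have /forallP/(_ u)/forallP/(_ v)/implyP/(_ uv') := dec.
  apply/forallP/idP => [H|H i].
    have /forallP/(_ v) := H u; rewrite un vn !eqxx /= => h.
    by have := ler_norm (- mu v); rewrite normrN; lra.
  apply/forallP => j; apply/implyP => /andP[/eqP iu /eqP jv].
  have -> : i = u by apply: ord_inj; rewrite /=; lia.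
  have -> : j = v by apply: ord_inj; rewrite /=; lia.
  by rewrite ler_norml; lra.
have [la_dec [la0 la_kind]] : weakly_decreasing la /\ 0 <= la u + la v /\ one_kind la.
  by case: kla => /andP[+ /forallP k]; rewrite orthP => /andP[h1 h2]; split=> //; split=> //;
    [left|right].
have [b [lz [b2 [la_lz bb lz_dec]]]] := one_kind_base la_dec la_kind.
have [d dc] := double_nat c0 kc.
have la0' : 0 <= b2 + lz u + lz v.
  move: la0; rewrite !la_lz -(ler_int rat) !intrD -bb; lra.
have top (C : col) : even_size d.-1 #|C| #|even_top v| -> col_le C (even_top v).
  rewrite /even_size odd_top => /eqP; exact: (col_le_even_top uv vn).
have lgE (t : d.-tuple col) m : (m <= d)%N ->
    (0 < (doubled la + staircase n (-2) + total_weight (take m t)) u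
         + (doubled la + staircase n (-2) + total_weight (take m t)) v) =
    (m%:Z <= b2 + lz u + lz v + (cnt t m u)%:Z + (cnt t m v)%:Z).
  by move=> md; rewrite !(partial_weight la_lz bb) //; apply/idP/idP => /=; lia.
have okE t := walk_ok_chamberP la_lz bb lz_dec (-2) (fun w => 0 < w u + w v) t top.
have sum_kind := one_kind_add la_kind kc.
have range nu : same_kind_orth_partitions_in (la + rect n c) nu ->
    weakly_decreasing nu /\ forall i, nu i + c - la i \is a Num.int.
  case=> [[|]] [] /andP[_ /forallP k1] /andP[+ /forallP k2] _; rewrite orthP => /andP[h1 h2];
    split=> // i; apply: (same_kind_diff dc); have := k1 i; rewrite !ffunE => h;
    [left|right]; split=> //; exact: k2.
apply: (product_rule dc la_lz bb lz_dec (q := -2) (p := even_size)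
  (lg := fun w => 0 < w u + w v) (D0 := even_top v) (alt := even_alt (@xvar n))
  (prop := fun nu F => orth_property c F)).
- by move=> nu; apply: so_even_charE vn.
- have [Q [Q1 Q2]] := even_walks (@xvar_neq0 n) (two_neq0 n) uv vn d; exists Q; split=> //.
  apply: Q1 (starting_parity la_lz bb (-2) d).
  apply/andP; split; first exact: starting_decreasing la_lz bb lz_dec _.
  by rewrite !(starting_weight la_lz bb) /=; lia.
- exact: finite_same_kind_orth_partitions_in.
- move=> t /okE [walk _ lg]; have endd := end_shape_dec c la_lz walk.
  have end0 : 0 <= end_shape d c la t u + end_shape d c la t v.
    suff : 0 <= 2 * end_shape d c la t u + 2 * end_shape d c la t v by lra.
    rewrite !(double_end_shape dc la_lz bb) -intrD (ler_int _ 0).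
    case: (posnP d) => [d0|dpos]; first by lia.
    by have := lg d; rewrite lgE // dpos leqnn => /(_ isT); lia.
  have sum0 : 0 <= (la + rect n c) u + (la + rect n c) v by rewrite !ffunE; lra.
  have sumd := addr_rect_dec c la_dec; have [kint khalf] := end_shape_kind la dc t.
  split; last exact: end_shape_contained.
  case: sum_kind => k; [left|right]; split; apply/andP; split; rewrite ?orthP ?sumd ?endd //;
    apply/forallP => //; [exact: kint|exact: khalf].
- exact: range.
- by move=> mu [].
- exact: top.
- move=> nu /range [nu_dec nu_int] cont F LRF.
  have [walk _] := col_word_end la_lz lz_dec nu_dec nu_int cont LRF.
  have oddE := oddcols_walk dc la_lz lz_dec nu_dec nu_int cont LRF (odd_top v).
  have orthE := orth_walk dc la_lz bb lz_dec nu_dec nu_int cont LRF un vn.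
  rewrite okE; split=> [[[_ od] orth]|[_ sz lg]].
    split=> //; first exact/oddE.
    by move=> m m0d; rewrite lgE; [apply: orthE.1|case/andP: m0d].
  split; first by split; [exact: (content_partition dc LRF)|exact/oddE].
  by apply/orthE => m m0d; rewrite -lgE; [apply: lg|case/andP: m0d].
Qed.

End Cases.

Local Open Scope classical_set_scope.
Local Open Scope ring_scope.

Theorem proposition1 (n : nat) (hn : (0 < n)%N) :
  (forall (c : nat) (la : indexseq n),
     is_partition la ->
     sp_char (rect n c%:R) * sp_char la =
     \sum_(nu \in partitions_in (la + rect n c%:R))
       sp_char nu *
       \sum_(mu \in [set mu | partitions_in (rect n (2 * c%:R)) mu
                              /\ even_rows mu])
         ((LR_bar la mu (nu + rect n c%:R) c%:R)%:R : charField n))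
  /\
  (forall (c : rat) (la : indexseq n),
     0 <= c -> (c \is a Num.int) \/ half_integer c ->
     is_partition la \/ is_half_partition la ->
     so_odd_char (rect n c) * so_odd_char la =
     \sum_(nu \in same_kind_partitions_in (la + rect n c))
       so_odd_char nu *
       \sum_(mu \in partitions_in (rect n (2 * c)))
         ((LR_bar la mu (nu + rect n c) c)%:R : charField n))
  /\
  ((1 < n)%N ->
   forall (c : rat) (la : indexseq n),
     0 <= c -> (c \is a Num.int) \/ half_integer c ->
     is_orth_partition la \/ is_orth_half_partition la ->
     so_even_char (rect n c) * so_even_char la =
     \sum_(nu \in same_kind_orth_partitions_in (la + rect n c))
       so_even_char nu *
       \sum_(mu \in [set mu | partitions_in (rect n (2 * c)) mu
                              /\ oddcols mu (rect n (2 * c)) = 0%N])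
         ((LR_tilde la mu (nu + rect n c) c)%:R : charField n)).
Proof.
split; first by move=> c la; apply: symplectic_rule.
split; first by move=> c la; apply: odd_orthogonal_rule.
by move=> n1 c la; apply: even_orthogonal_rule.
Qed.
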